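(* Let $\tau$, $B$, $\wp$ satisfy the standing assumptions listed in the context. Then for all $t>0$ and all $\beta>\alpha>1$, $T_t$ is a bounded linear operator from $L^1_\alpha$ into $L^1_\beta$. More precisely, for all $\beta>\alpha>1$ and all $\delta<\alpha$ there exist two positive constants $a=a(\alpha,\beta)$ (not depending on $\delta$) and $C=C(\alpha,\beta,\delta)$ such that for all $f\in L^1_\alpha$ and all $t>0$ $$\|T_tf\|_{L^1_\beta}\leq C\,t^{-(\beta-\delta)/\gamma_0}\,\mathrm e^{at}\,\|f\|_{L^1_\alpha}.$$
   Context: Standing assumptions. (a) $\tau:(0,\infty)\to(0,\infty)$ is $C^1$, $1/\tau\in L^1(0,1)$, and there are constants $\nu_0\leq1$, $\tau_1\geq\tau_0>0$ with $\tau_0\mathbf 1_{x\geq1}x^{\nu_0}\leq\tau(x)\leq\tau_1\max(1,x)$ for all $x>0$. (b) $B:(0,\infty)\to[0,\infty)$ is continuous with connected support and there are constants $\gamma_1\geq\gamma_0>0$, $B_1\geq B_0>0$, $x_0>0$ with $B_0\mathbf 1_{x\geq x_0}x^{\gamma_0}\leq B(x)\leq B_1\max(1,x^{\gamma_1})$ for all $x>0$. (c) $\wp$ is a finite positive measure on the open interval $(0,1)$ with $\int_0^1 z\,\wp(dz)=1$. Notation. $\wp_\alpha:=\int_0^1z^\alpha\wp(dz)$ and $\underline\alpha:=\inf\{\alpha\in\mathbb R:\wp_\alpha<+\infty\}\in[-\infty,0]$. For a positive weight $\psi$, $L^1(\psi):=L^1((0,\infty);\psi\,dx)$ with $\|f\|_{L^1(\psi)}=\|f\psi\|_{L^1}$;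 $L^1_\alpha$ is the case $\psi(x)=(1+x)^\alpha$. $\mathcal F_+f(x):=\int_0^1B(x/z)f(x/z)\frac{\wp(dz)}{z}$ for $f\in C_c(0,\infty)$, extended by continuity, for each $\alpha>\underline\alpha$, to a bounded operator from $L^1((1+B(x))(1+x)^\alpha)$ to $L^1_\alpha$. Perron elements (existence, uniqueness and the properties below are known under the standing assumptions). $(\lambda,G)\in\mathbb R\times L^1_0$ is the unique distributional solution of $(\tau G)'+\lambda G+BG=\mathcal F_+G$, $G\geq0$, $\int_0^\infty G=1$, and $\phi\in C^1(0,\infty)$ is the unique function with $-\tau\phi'+\lambda\phi+B\phi=\mathcal F_+^*\phi$, $\phi\geq0$, $\int_0^\infty G\phi=1$, where $\mathcal F_+^*\phi(x):=B(x)\int_0^1\phi(zx)\wp(dz)$. Moreover $\lambda>0$, $G\in L^1_\alpha$ for all $\alpha>0$, and $\frac1C(1+x)\leq\phi(x)\leq C(1+x)$ for some $C>0$; in particular $L^1(\phi)\simeq L^1_1$. Semigroup. On $L^1(\phi)$ let $\mathcal A_0f:=-(\tau f)'-\lambda f-Bf$ with domain $D(\mathcal A_0)=\{f\in L^1(\phi):(\tau f)'\in L^1(\phi),\ (\tau f)(0)=0,\ Bf\in L^1(\phi)\}$. The closure in $L^1(\phi)$ of $(\mathcal A_0+\mathcal F_+,D(\mathcal A_0))$ generates a positive $C_0$-semigroup $(T_t)_{t\geq0}$ on $L^1(\phi)$, with $\|T_tf\|_{L^1(\phi)}=\|f\|_{L^1(\phi)}$ for $f\geq0$; for $\alpha>1$,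 $T_t$ leaves $L^1_\alpha\subset L^1(\phi)$ invariant and $(T_t)_{t\ge0}$ restricts to a $C_0$-semigroup on $L^1_\alpha$. *)

(* Defs.v *)
From mathcomp Require Import all_boot all_order all_algebra.
From mathcomp Require Import all_classical all_reals all_analysis.

Set Implicit Arguments.
Unset Strict Implicit.
Unset Printing Implicit Defensive.

Import Order.TTheory GRing.Theory Num.Theory numFieldNormedType.Exports.

Local Open Scope classical_set_scope.
Local Open Scope ring_scope.

(* An element of L^1((0,oo); psi dx) is represented by a function R -> R, of
   which only the restriction to (0,oo), up to a.e. equality, is meaningful.
   An unbounded operator is represented by its graph, a relation between such
   functions. *)

Definition halfline (R : realType) : set R := `]0, +oo[%classic.
Arguments halfline {R}.

Definition eq_ae {R : realType} (f g : R -> R) : Prop :=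
  {ae lebesgue_measure, forall x : R, halfline x -> f x = g x}.

Definition ge0_ae {R : realType} (f : R -> R) : Prop :=
  {ae lebesgue_measure, forall x : R, halfline x -> 0 <= f x}.

Definition L1 {R : realType} (psi f : R -> R) : Prop :=
  lebesgue_measure.-integrable halfline (fun x : R => (f x * psi x)%:E).

Definition L1norm {R : realType} (psi f : R -> R) : \bar R :=
  (\int[lebesgue_measure]_(x in (halfline : set R)) `|(f x * psi x)%:E|)%E.

Definition weight {R : realType} (alpha : R) (x : R) : R := (1 + x) `^ alpha.

Definition C1 {R : realType} (f : R -> R) : Prop :=
  forall x : R, 0 < x -> derivable f x 1 /\ {for x, continuous (derive1 f)}.

Definition growth_rate {R : realType} (tau : R -> R) : Prop :=
  [/\ forall x : R, 0 < x -> 0 < tau x,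
      C1 tau,
      lebesgue_measure.-integrable `]0, 1[ (fun x : R => ((tau x)^-1)%:E) &
      exists nu0 tau0 tau1 : R,
        [/\ nu0 <= 1, 0 < tau0, tau0 <= tau1 &
            forall x : R, 0 < x ->
              tau0 * \1_(`[1, +oo[%classic : set R) x * x `^ nu0 <= tau x
                <= tau1 * Num.max 1 x]].

Definition fragmentation_rate {R : realType} (B : R -> R) (gamma0 : R) : Prop :=
  [/\ forall x : R, 0 < x -> 0 <= B x,
      forall x : R, 0 < x -> {for x, continuous B},
      connected (closure [set x : R | 0 < x /\ B x != 0] `&` halfline) &
      exists gamma1 B0 B1 x0 : R,
        [/\ 0 < gamma0 <= gamma1, 0 < B0 <= B1, 0 < x0 &
            forall x : R, 0 < x ->
              B0 * \1_(`[x0, +oo[%classic : set R) x * x `^ gamma0 <= B x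
                <= B1 * Num.max 1 (x `^ gamma1)]].

Section Fragmentation.
Context {R : realType}.
Implicit Types (B f g : R -> R)
  (wp : {finite_measure set (measurableTypeR R) -> \bar R}).

Definition fragmentation_measure wp : Prop :=
  wp (~` `]0, 1[%classic) = 0%E /\
  (\int[wp]_(z in `]0%R, 1%R[) z%:E = 1)%E.

Definition wp_moment wp (alpha : R) : \bar R :=
  (\int[wp]_(z in `]0%R, 1%R[) (z `^ alpha)%:E)%E.

Definition alpha_inf wp : \bar R :=
  ereal_inf [set alpha%:E | alpha in [set alpha | wp_moment wp alpha < +oo]%E].

Definition Cc f : Prop :=
  (forall x : R, 0 < x -> {for x, continuous f}) /\
  (exists a b : R, 0 < a /\ forall x : R, 0 < x -> f x != 0 -> a <= x <= b).

Definition Fplus_Cc B wp f : R -> R :=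
  fun x => \int[wp]_(z in `]0, 1[) (B (x / z) * f (x / z) / z).

Definition Fplus_weight B (alpha x : R) : R := (1 + B x) * weight alpha x.

(* [Fplus B wp f g] says that F_+ f = g.  The extensions by continuity obtained
   for different alpha agree on common arguments, so that quantifying alpha
   existentially defines a single operator. *)
Definition Fplus B wp f g : Prop :=
  exists alpha : R,
    [/\ (alpha_inf wp < alpha%:E)%E,
        L1 (Fplus_weight B alpha) f,
        L1 (weight alpha) g &
        exists f_ : nat -> R -> R,
          [/\ forall n, Cc (f_ n),
              L1norm (Fplus_weight B alpha) (f_ n \- f) @[n --> \oo] --> 0%E &
              L1norm (weight alpha) (Fplus_Cc B wp (f_ n) \- g) @[n --> \oo]
                --> 0%E]].

Definition Fplus_adj B wp f : R -> R :=
  fun x => B x * \int[wp]_(z in `]0, 1[) f (z * x).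

Definition test_function f : Prop :=
  (forall n x, derivable (derive1n n f) x 1) /\
  (exists a b : R, 0 < a /\ forall x, f x != 0 -> a <= x <= b).

(* u' = g in the sense of distributions on (0,oo) *)
Definition weak_derivative (u g : R -> R) : Prop :=
  [/\ locally_integrable halfline u,
      locally_integrable halfline g &
      forall chi, test_function chi ->
        \int[lebesgue_measure]_(x in (halfline : set R)) (u x * derive1 chi x) =
        - \int[lebesgue_measure]_(x in (halfline : set R)) (g x * chi x)].

(* u has a continuous representative on (0,oo) with limit 0 at 0^+ *)
Definition zero_trace (u : R -> R) : Prop :=
  exists v : R -> R,
    [/\ eq_ae u v,
        forall x : R, 0 < x -> {for x, continuous v} &
        v x @[x --> 0^'+] --> 0].

(* The last three fields are known consequences of the others under the
   standing assumptions on tau, B and wp. *)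
Record perron_elements (tau B : R -> R) wp (lambda : R) (G phi : R -> R)
    : Prop := PerronElements {
  perron_G_L1 : L1 (weight 0) G;
  perron_G_eq : exists2 FG, Fplus B wp G FG &
    weak_derivative (tau \* G) (fun x => FG x - lambda * G x - B x * G x);
  perron_G_ge0 : ge0_ae G;
  perron_G_mass :
    (\int[lebesgue_measure]_(x in (halfline : set R)) (G x)%:E = 1)%E;
  perron_phi_C1 : C1 phi;
  perron_phi_eq : forall x : R, 0 < x ->
    - tau x * derive1 phi x + lambda * phi x + B x * phi x =
      Fplus_adj B wp phi x;
  perron_phi_ge0 : forall x : R, 0 < x -> 0 <= phi x;
  perron_normalization :
    (\int[lebesgue_measure]_(x in (halfline : set R)) (G x * phi x)%:E = 1)%E;
  perron_lambda_gt0 : 0 < lambda;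
  perron_G_moments : forall alpha : R, 0 < alpha -> L1 (weight alpha) G;
  perron_phi_bounds : exists2 C : R, 0 < C &
    forall x : R, 0 < x -> C^-1 * (1 + x) <= phi x <= C * (1 + x)
}.

Definition bounded_linear (psi1 psi2 : R -> R) (S : (R -> R) -> R -> R)
    : Prop :=
  [/\ forall f, L1 psi1 f -> L1 psi2 (S f),
      forall (c : R) f g, L1 psi1 f -> L1 psi1 g ->
        eq_ae (S (fun x => c * f x + g x)) (fun x => c * S f x + S g x) &
      exists M : R, forall f, L1 psi1 f ->
        (L1norm psi2 (S f) <= M%:E * L1norm psi1 f)%E].

Record C0_semigroup (psi : R -> R) (T : R -> (R -> R) -> R -> R)
    : Prop := C0Semigroup {
  semigroup_bounded : forall t : R, 0 <= t -> bounded_linear psi psi (T t);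
  semigroup_0 : forall f, L1 psi f -> eq_ae (T 0 f) f;
  semigroup_D : forall (s t : R) f, 0 <= s -> 0 <= t -> L1 psi f ->
    eq_ae (T (s + t) f) (T s (T t f));
  semigroup_continuous : forall f, L1 psi f ->
    L1norm psi (T t f \- f) @[t --> 0^'+] --> 0%E
}.

Definition generator (psi : R -> R) (T : R -> (R -> R) -> R -> R) f g : Prop :=
  [/\ L1 psi f, L1 psi g &
      L1norm psi (fun x => (T t f x - f x) / t - g x) @[t --> 0^'+] --> 0%E].

Definition closure_operator (psi : R -> R) (A : (R -> R) -> (R -> R) -> Prop)
    f g : Prop :=
  [/\ L1 psi f, L1 psi g &
      forall eps : R, 0 < eps -> exists f' g', [/\ A f' g',
        (L1norm psi (f' \- f)%R < eps%:E)%E & (L1norm psi (g' \- g)%R < eps%:E)%E]].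

(* graph of the sum of A_0 and F_+, on the domain of A_0 *)
Definition A0_plus_Fplus (tau B : R -> R) wp (lambda : R) (phi : R -> R) f g
    : Prop :=
  exists tf' Ff : R -> R,
    [/\ L1 phi f /\ L1 phi (B \* f),
        weak_derivative (tau \* f) tf' /\ L1 phi tf',
        zero_trace (tau \* f),
        Fplus B wp f Ff &
        L1 phi g /\
        eq_ae g (fun x => - tf' x - lambda * f x - B x * f x + Ff x)].

(* T is determined by its first two fields; the other ones are known properties
   of it under the standing assumptions. *)
Record growth_fragmentation_semigroup (tau B : R -> R) wp (lambda : R)
    (phi : R -> R) (T : R -> (R -> R) -> R -> R) : Prop :=
  GrowthFragmentationSemigroup {
  gf_semigroup : C0_semigroup phi T;
  gf_generator : forall f g, generator phi T f g <->
    closure_operator phi (A0_plus_Fplus tau B wp lambda phi) f g;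
  gf_ge0 : forall (t : R) f, 0 <= t -> L1 phi f -> ge0_ae f -> ge0_ae (T t f);
  gf_norm : forall (t : R) f, 0 <= t -> L1 phi f -> ge0_ae f ->
    L1norm phi (T t f) = L1norm phi f;
  gf_weight : forall alpha : R, 1 < alpha -> C0_semigroup (weight alpha) T
}.

End Fragmentation.

(* Main.v *)
(* Let p = alpha - 1. On the generator of T, one tests f - h g with sg(f) times the weights
   W_N = C phi + x (x / (1 + x / N))^p, each of which is comparable to phi. Kato's inequality handles
   the transport term. Fragmentation strictly decreases the superlinear part, because
   z (2 z / (1 + z))^p has integral less than 1 against wp; hence, with a independent of N,
     (1 - h a) |f|_{W_N} + h |f|_{D_N} <= |f - h g|_{W_N},   D_N = c x^(alpha + gamma0) on [x0, N].
   This inequality passes to the closure of the operator, and the implicit Euler scheme along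
   t |-> T_t f turns it into |T_t f|_{W_N} <= e^{2 a t} |f|_{W_N} together with a time s <= t such
   that t |T_s f|_{D_N} <= e^{2 a t} |f|_{W_N}. Letting N tend to infinity, and using the density
   of the domain, T_t maps L^1_alpha to L^1_{alpha + gamma0} with norm at most C e^{c t} / t.
   Iterating k times and interpolating between alpha and alpha + k gamma0 yields the exponent
   (beta - alpha) / gamma0; replacing alpha by delta < alpha costs at most a factor C e^t. *)
From HB Require Import structures.
Require Import Defs.
From mathcomp Require Import all_boot all_order all_algebra.
From mathcomp Require Import all_classical all_reals all_analysis.
From mathcomp Require Import ring lra measurable_realfun.

Set Implicit Arguments.
Unset Strict Implicit.
Unset Printing Implicit Defensive.

Import Order.TTheory GRing.Theory Num.Theory numFieldNormedType.Exports.

Local Open Scope classical_set_scope.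
Local Open Scope ring_scope.

(** * Smooth step functions *)

Section SmoothStep.
Context {R : realType}.
Implicit Types f g : R -> R.

(** The domain of the closure has no explicit description, and its elements are not known to have
    $Bf$ or $(\tau f)'$ in $L^1(\phi)$. Hence only inequalities between seminorms continuous on
    $L^1(\phi)$ can be carried over from $D(\mathcal A_0)$ to the generator. This forces the
    truncation of the weight and the resolvent form of the estimate, with $f-hg$ instead of a
    pairing of $g$ with the sign of $f$. The multiple of $\phi$ in $W_N$ costs nothing, $\phi$ being
    annihilated by the adjoint, and it bounds the transport term of the power part near 0, where
    that part is too small. Strictness of $\alpha>1$ enters through $p>0$: at $p=0$ the integral
    against $\wp$ equals 1 and the dissipation vanishes. The scheme bounds a time average of
    $|T_sf|_{D_N}$, hence gives one good time $s$ only; the gain is carried from $s$ to $t$ by the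
    growth estimate at the stronger exponent $p+\gamma_0$, with a truncation level $M$ of its own.
    There $N\to\infty$ at fixed $M$, and $M\to\infty$ comes last, the constants being independent of
    both. *)

Lemma is_derive_addfun f g (x a b : R) : is_derive x 1 f a ->
  is_derive x 1 g b -> is_derive x 1 (fun y => f y + g y) (a + b).
Proof. exact: is_deriveD. Qed.

Lemma is_derive_mulfun f g (x a b : R) : is_derive x 1 f a ->
  is_derive x 1 g b -> is_derive x 1 (fun y => f y * g y) (f x * b + g x * a).
Proof. exact: is_deriveM. Qed.

Lemma is_derive_compfun f g (x a b : R) : is_derive (g x) 1 f a ->
  is_derive x 1 g b -> is_derive x 1 (fun y => f (g y)) (a * b).
Proof. exact: is_derive1_comp. Qed.

Lemma is_derive_derive1 f (x : R) : derivable f x 1 -> is_derive x 1 f (derive1 f x).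
Proof. by move=> df; rewrite derive1E; apply: DeriveDef. Qed.

Lemma derivable_continuous f (x : R) : derivable f x 1 -> {for x, continuous f}.
Proof. by move=> df; apply: differentiable_continuous; exact/derivable1_diffP. Qed.

Lemma is_derive_affine (a b x : R) : is_derive x 1 (fun y : R => a * y + b) a.
Proof. by apply: is_derive_eq; rewrite addr0 -[_ *: _]/(_ * _) mulr1. Qed.

(** Differentiability of $f, f', \dots, f^{(n)}$, with the derivative taken first: the sum, product
    and affine rules then follow by induction on $n$, without a Leibniz formula. *)
Fixpoint derivable_upto (n : nat) f : Prop :=
  (forall x : R, derivable f x 1) /\
  if n is m.+1 then derivable_upto m (derive1 f) else True.

Lemma derivable_upto0 n f : derivable_upto n f -> forall x, derivable f x 1.
Proof. by case: n => [|n] []. Qed.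

Lemma derivable_uptoS n f : derivable_upto n.+1 f -> derivable_upto n f.
Proof.
elim: n f => [|n IHn] f [df Df]; first by split.
by split; [exact: df|exact: IHn].
Qed.

Lemma derivable_uptoP f :
  (forall n x, derivable (derive1n n f) x 1) <-> forall n, derivable_upto n f.
Proof.
split=> [+ n|+ n].
  elim: n f => [|n IHn] f df; first by split; [exact: (df 0%N)|].
  split=> [x|]; first exact: (df 0%N).
  by apply: IHn => m x; rewrite -derive1Sn; exact: df.
elim: n f => [|n IHn] f df x; first by have /derivable_upto0 := df 0%N; exact.
by rewrite derive1Sn; apply: IHn => m; have [] := df m.+1.
Qed.

Lemma derivable_uptoD n f g : derivable_upto n f -> derivable_upto n g ->
  derivable_upto n (fun x => f x + g x).
Proof.
elim: n f g => [|n IHn] f g [df Df] [dg Dg].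
  by split; [move=> x; exact: (@derivableD _ _ _ f g)|].
split=> [x|]; first exact: (@derivableD _ _ _ f g).
rewrite (_ : derive1 _ = fun x => derive1 f x + derive1 g x); first exact: IHn.
by apply/funext => x; rewrite !derive1E (@deriveD _ _ _ f g).
Qed.

Lemma derivable_uptoM n f g : derivable_upto n f -> derivable_upto n g ->
  derivable_upto n (fun x => f x * g x).
Proof.
elim: n f g => [|n IHn] f g.
  by move=> [df Df] [dg Dg]; split; [move=> x; exact: (@derivableM _ _ f g)|].
move=> hf hg; have [df Df] := hf; have [dg Dg] := hg.
split=> [x|]; first exact: (@derivableM _ _ f g).
rewrite (_ : derive1 _ = fun x => f x * derive1 g x + g x * derive1 f x).
  by apply: derivable_uptoD; apply: IHn; rewrite //; exact: derivable_uptoS.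
by apply/funext => x; rewrite !derive1E (@deriveM _ _ f g).
Qed.

Lemma derivable_upto_cst n (c : R) : derivable_upto n (fun=> c).
Proof.
have dc (d x : R) : derivable (fun=> d : R) x 1 by exact: derivable_cst.
elim: n c => [|n IHn] c; first by split; [exact: dc|].
split; first exact: dc.
rewrite (_ : derive1 _ = fun=> 0); first exact: IHn.
by apply/funext => x; rewrite derive1_cst.
Qed.

Lemma derivable_upto_affine n f (a b : R) : derivable_upto n f ->
  derivable_upto n (fun x => f (a * x + b)).
Proof.
have daff g (x : R) : (forall y, derivable g y 1) ->
    is_derive x 1 (fun y => g (a * y + b)) (derive1 g (a * x + b) * a).
  move=> dg; apply: (@is_derive_compfun g (fun y => a * y + b)).
    exact: is_derive_derive1.
  exact: is_derive_affine.
elim: n f => [|n IHn] f [df Df]; first by split; [move=> x; have [] := daff f x df|].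
split=> [x|]; first by have [] := daff f x df.
rewrite (_ : derive1 _ = fun x => (fun=> a) x * (fun x => derive1 f (a * x + b)) x).
  by apply: derivable_uptoM; [exact: derivable_upto_cst|exact: IHn].
by apply/funext => x; rewrite derive1E; have [_ ->] := daff f x df; rewrite mulrC.
Qed.

Lemma exprn_le_fact_expR (n : nat) (y : R) : 0 <= y -> y ^+ n <= n`!%:R * expR y.
Proof.
move=> y0; case: n => [|n].
  by rewrite expr0 fact0 mul1r (le_trans _ (expR_ge1Dx y))// lerDl.
have /= := expR_ge1Dxn n y0.
rewrite [_%:R * _]mulrC -ler_pdivrMr ?ltr0n ?fact_gt0// => /(le_trans _); apply.
by rewrite lerDr.
Qed.

Lemma horner_le_expR (P : {poly R}) :
  exists2 C : R, 0 <= C & forall y, 0 <= y -> `|P.[y]| <= C * expR y.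
Proof.
exists (\sum_(i < size P) `|P`_i| * i`!%:R).
  by apply: sumr_ge0 => i _; apply: mulr_ge0.
move=> y y0; rewrite horner_coef mulr_suml; apply: (le_trans (ler_norm_sum _ _ _)).
apply: ler_sum => i _; rewrite normrM -mulrA ler_wpM2l//.
by rewrite ger0_norm ?exprn_ge0// exprn_le_fact_expR.
Qed.

(** The functions $P(1/x)\mathrm e^{-1/x}$, extended by 0 to $x\le0$, form a class stable under
    differentiation; $P=1$ gives the classical flat function. *)
Definition poly_exp_inv (P : {poly R}) (x : R) : R :=
  if 0 < x then P.[x^-1] * expR (- x^-1) else 0.

(** Flatness at 0 to second order, obtained from the exponential bound on $PX^2$ at $1/x$; it yields
    the zero derivative at the origin. *)
Lemma poly_exp_inv_le (P : {poly R}) :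
  exists2 C : R, 0 <= C & forall x, `|poly_exp_inv P x| <= C * x ^+ 2.
Proof.
have [C C0 hC] := horner_le_expR (P * 'X^2).
exists C => // x; rewrite /poly_exp_inv; case: ifPn => [x0|_]; last first.
  by rewrite normr0 mulr_ge0// sqr_ge0.
have := hC x^-1; rewrite invr_ge0 => /(_ (ltW x0)).
rewrite hornerM hornerXn normrM (ger0_norm (exprn_ge0 _ _)) ?invr_ge0 ?(ltW x0)// => h.
rewrite normrM (ger0_norm (expR_ge0 _)) expRN ler_pdivrMr ?expR_gt0//.
rewrite mulrAC -ler_pdivrMr ?exprn_gt0//; rewrite exprVn in h.
by [].
Qed.

Lemma is_derive_poly_exp_inv (P : {poly R}) (x : R) :
  is_derive x 1 (poly_exp_inv P) (poly_exp_inv ((P - P^`()) * 'X^2) x).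
Proof.
have [x0|x0|x0] := ltgtP x 0.
- apply: (@near_eq_is_derive _ _ _ (cst 0)).
    near=> y; rewrite /poly_exp_inv ltNge ifF//; apply/negbTE/negPn/ltW.
    by near: y; exact: lt_nbhsl.
  rewrite /poly_exp_inv ltNge (ltW x0)/=; exact: is_derive_cst.
- apply: (@near_eq_is_derive _ _ _ ((fun y => P.[y^-1] * expR (- y^-1)) : R -> R)).
    near=> y; rewrite /poly_exp_inv ifT//.
    by near: y; exact: lt_nbhsr.
  rewrite /poly_exp_inv x0.
  have dV : is_derive x 1 (fun y : R => y^-1) (- x ^- 2).
    have := @is_deriveV R id x 1 1 _ (is_derive_id _ _).
    by rewrite -[_ *: 1]/(_ * 1) mulr1; apply; rewrite gt_eqF.
  have dNV : is_derive x 1 (fun y : R => - y^-1) (x ^- 2).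
    by rewrite -[X in is_derive _ _ _ X]opprK; exact: is_deriveN.
  have dP : is_derive x 1 (fun y : R => P.[y^-1]) (P^`().[x^-1] * - x ^- 2).
    by apply: (@is_derive_compfun (horner P) (fun y => y^-1)) => //; exact: is_derive_poly.
  have dE : is_derive x 1 (fun y : R => expR (- y^-1)) (expR (- x^-1) * x ^- 2).
    by apply: (@is_derive_compfun expR (fun y => - y^-1)) => //; exact: is_derive_expR.
  apply: (is_derive_eq (is_derive_mulfun dP dE)).
  rewrite hornerM hornerXn hornerD hornerN exprVn; ring.
- rewrite x0; have [C C0 hC] := poly_exp_inv_le P.
  have p0 Q : poly_exp_inv Q 0 = 0 by rewrite /poly_exp_inv ltxx.
  have h : h^-1 *: (poly_exp_inv P (h *: 1 + 0) - poly_exp_inv P 0) @[h --> 0^'] --> (0:R).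
    apply/cvgr0Pnorm_lt => e e0; near=> h.
    have hn0 : h != 0 by near: h; exact: nbhs_dnbhs_neq.
    rewrite p0 subr0 addr0 -[_ *: 1]/(_ * _) mulr1 normrZ normfV.
    rewrite ltr_pdivrMl ?normr_gt0//; apply: (le_lt_trans (hC h)).
    rewrite -real_normK ?num_real// expr2 mulrCA ltr_pM2l ?normr_gt0//.
    have he : `|h| < e / (C + 1).
      by near: h; apply: dnbhs0_lt; rewrite divr_gt0// ltr_wpDl.
    rewrite ltr_pdivlMr ?ltr_wpDl// in he.
    by apply: le_lt_trans he; rewrite mulrC ler_wpM2l// lerDl.
  rewrite p0; apply: DeriveDef.
    by apply/cvg_ex; exists 0.
  by rewrite /derive; apply/cvg_lim.
Unshelve. all: by end_near. Qed.

Lemma derivable_upto_poly_exp_inv n (P : {poly R}) : derivable_upto n (poly_exp_inv P).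
Proof.
have dP Q x : derivable (poly_exp_inv Q) x 1 by have [] := is_derive_poly_exp_inv Q x.
elim: n P => [|n IHn] P; first by split; [exact: dP|].
split; first exact: dP.
rewrite (_ : derive1 _ = poly_exp_inv ((P - P^`()) * 'X^2)); first exact: IHn.
by apply/funext => x; rewrite derive1E; have [] := is_derive_poly_exp_inv P x.
Qed.

(** Primitive of the bump $e(x)e(1-x)$, with $e(x)=\mathrm e^{-1/x}$ for $x>0$, divided by its total
    mass. *)
Lemma smooth_step : exists S : R -> R,
  [/\ forall n x, derivable (derive1n n S) x 1,
      forall x, x <= 0 -> S x = 0,
      forall x, 1 <= x -> S x = 1,
      forall x, 0 <= derive1 S x &
      forall x, 0 <= S x <= 1].
Proof.
pose e := poly_exp_inv 1.
have e0 x : x <= 0 -> e x = 0 by move=> x0; rewrite /e /poly_exp_inv ltNge x0.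
have egt0 x : 0 < x -> 0 < e x.
  by move=> x0; rewrite /e /poly_exp_inv x0 hornerC mul1r expR_gt0.
have ege0 x : 0 <= e x by have [/e0 ->//|/egt0/ltW] := leP x 0.
pose b x := e x * e (-1 * x + 1).
have Db n : derivable_upto n b.
  apply: derivable_uptoM; first exact: derivable_upto_poly_exp_inv.
  by apply: derivable_upto_affine; exact: derivable_upto_poly_exp_inv.
have bge0 x : 0 <= b x by rewrite mulr_ge0.
have b_le0 x : x <= 0 -> b x = 0 by move=> x0; rewrite /b e0// mul0r.
have b_ge1 x : 1 <= x -> b x = 0.
  by move=> x1; rewrite /b [X in _ * X]e0 ?mulr0// mulN1r addrC subr_le0.
have cb : continuous b.
  by move=> x; apply: derivable_continuous; exact: (derivable_upto0 (Db 0%N)).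
have mb : measurable_fun setT b by exact: continuous_measurable_fun.
have ib : lebesgue_measure.-integrable setT (EFin \o b).
  have : lebesgue_measure.-integrable `[0, 1] (EFin \o b).
    by apply: continuous_compact_integrable; [exact: segment_compact|exact: continuous_subspaceT].
  rewrite integrable_mkcond//=; apply: eq_integrable => // x _.
  rewrite /patch; case: ifPn => //; rewrite notin_setE/= in_itv/= => /negP.
  by rewrite negb_and -!ltNge => /orP[/ltW/b_le0|/ltW/b_ge1] ->.
have ibS D : measurable D -> lebesgue_measure.-integrable D (EFin \o b).
  by move=> mD; apply: integrableS ib.
pose F x := \int[lebesgue_measure]_(t in `]-oo, x]) b t.
have dF x : derivable F x 1 /\ derive1 F x = b x.
  apply: (@continuous_FTC1 _ b -oo%O x (x + 1)) => //; first by rewrite ltrDl.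
  - exact: ibS.
  - by rewrite ltNyr.
  - exact: cb.
have F_le0 x : x <= 0 -> F x = 0.
  move=> x0; rewrite /F (@eq_Rintegral _ _ _ _ _ (fun=> 0)) ?Rintegral_cst ?mul0r// => t.
  by rewrite inE/= in_itv/= => tx; rewrite b_le0// (le_trans tx).
have FB x y : x <= y -> F y - F x = \int[lebesgue_measure]_(t in `]x, y]) b t.
  by move=> xy; rewrite /F (@Rintegral_itvB _ b -oo%O (BRight y) x)//; exact: ibS.
have F1 x : 1 <= x -> F x = F 1.
  move=> x1; apply/eqP; rewrite -subr_eq0 FB//.
  rewrite (@eq_Rintegral _ _ _ _ _ (fun=> 0)) ?Rintegral_cst ?mul0r// => t.
  by rewrite inE/= in_itv/= => /andP[/ltW/b_ge1].
have Fnd x y : x <= y -> F x <= F y.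
  by move=> xy; rewrite -subr_ge0 FB// Rintegral_ge0.
(* A zero mass would make the monotone [F] constant on $[0,1]$, hence its derivative [b] zero at
   $1/2$. *)
have F1gt0 : 0 < F 1.
  rewrite lt0r -{2}(F_le0 0)// Fnd ?ler01// andbT; apply/eqP => F10.
  have Fc x : x \in `]0, 1[ -> F x = 0.
    rewrite in_itv/= => /andP[/ltW x0 /ltW x1]; apply/eqP; rewrite eq_le.
    by rewrite -{1}F10 Fnd//= -(F_le0 0)// Fnd.
  have : b 2^-1 = 0.
    rewrite -(dF 2^-1).2 derive1E (@near_eq_derive _ _ _ F (cst 0)) ?derive_cst//.
    have : (2^-1 : R) \in `]0, 1[ by rewrite in_itv/=; apply/andP; split; lra.
    by move=> /near_in_itvoo; apply: filterS => y; exact: Fc.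
  by apply/eqP; rewrite gt_eqF// /b mulr_gt0 ?egt0//; lra.
exists (fun x => (F 1)^-1 * F x).
have D1 x : derive1 (fun x => (F 1)^-1 * F x) x = (F 1)^-1 * b x.
  by rewrite (derive1Ml (F 1)^-1 (dF x).1) (dF x).2.
split=> [|x x0|x x1|x|x].
- apply/derivable_uptoP => n; apply: derivable_uptoM; first exact: derivable_upto_cst.
  case: n => [|n]; first by split; [move=> x; exact: (dF x).1|].
  split=> [x|]; first exact: (dF x).1.
  by rewrite (_ : derive1 F = b) ?Db//; apply/funext => x; exact: (dF x).2.
- by rewrite (F_le0 x x0) mulr0.
- by rewrite (F1 x x1) mulVf// gt_eqF.
- by rewrite D1 mulr_ge0// invr_ge0 ltW.
- rewrite mulrC divr_ge0 ?(ltW F1gt0)//=; last first.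
    by have [/F_le0 ->//|/ltW/Fnd] := leP x 0; rewrite (F_le0 0 (lexx 0)).
  rewrite ler_pdivrMr// mul1r.
  by have [x1|/ltW x1] := leP x 1; [exact: Fnd|rewrite F1].
Qed.

End SmoothStep.

(** * Integration and weak derivatives *)

Section RealIntegrals.
Context {d} {T : measurableType d} {R : realType} (mu : {measure set T -> \bar R}).
Implicit Types (A D : set T) (f g : T -> R).

Lemma aeS (P Q : T -> Prop) : (forall x, P x -> Q x) ->
  {ae mu, forall x, P x} -> {ae mu, forall x, Q x}.
Proof. by move=> PQ; apply: filterS. Qed.

Lemma aeS2 (P Q S : T -> Prop) : (forall x, P x -> Q x -> S x) ->
  {ae mu, forall x, P x} -> {ae mu, forall x, Q x} -> {ae mu, forall x, S x}.
Proof. by move=> PQ; apply: filterS2. Qed.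

Lemma Rintegral_support A D f : A `<=` D ->
  (forall x, D x -> ~ A x -> f x = 0) -> \int[mu]_(x in D) f x = \int[mu]_(x in A) f x.
Proof.
move=> AD f0; rewrite Rintegral_mkcond [RHS]Rintegral_mkcond; congr Rintegral.
apply/funext => x; rewrite /patch; case: ifPn => xD; case: ifPn => xA //.
- by apply: f0; [rewrite -inE|move=> xA'; rewrite mem_set in xA].
- by move: xD; rewrite notin_setE; rewrite inE in xA => /(_ (AD _ xA)).
Qed.

Lemma integrable_support A D f : measurable A -> measurable D -> A `<=` D ->
  (forall x, D x -> ~ A x -> f x = 0) ->
  mu.-integrable A (EFin \o f) -> mu.-integrable D (EFin \o f).
Proof.
move=> mA mD AD f0; rewrite integrable_mkcond// [X in _ -> X]integrable_mkcond//.
rewrite (_ : (EFin \o f) \_ D = (EFin \o f) \_ A)//.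
apply/funext => x; rewrite /patch; case: ifPn => xD; case: ifPn => xA //=.
- by rewrite f0//; [rewrite -inE|move=> xA'; rewrite mem_set in xA].
- by move: xD; rewrite notin_setE; rewrite inE in xA => /(_ (AD _ xA)).
Qed.

Lemma Rintegral_ae_eq D f g : measurable D -> measurable_fun D f -> measurable_fun D g ->
  {ae mu, forall x, D x -> f x = g x} -> \int[mu]_(x in D) f x = \int[mu]_(x in D) g x.
Proof.
move=> mD mf mg fg; rewrite /Rintegral; congr fine.
apply: ae_eq_integral => //; [exact/measurable_EFinP|exact/measurable_EFinP|].
by apply: filterS fg => x h Dx /=; rewrite h.
Qed.

Lemma le_integrable_real D f g : measurable D -> measurable_fun D f ->
  (forall x, D x -> `|f x| <= g x) -> mu.-integrable D (EFin \o g) ->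
  mu.-integrable D (EFin \o f).
Proof.
move=> mD mf fg; apply: le_integrable => //; first exact/measurable_EFinP.
by move=> x Dx /=; rewrite lee_fin (le_trans (fg _ Dx))// ler_norm.
Qed.

Lemma integrable_addfun D f g : measurable D -> mu.-integrable D (EFin \o f) ->
  mu.-integrable D (EFin \o g) -> mu.-integrable D (EFin \o (fun x => f x + g x)).
Proof. by move=> mD jf jg; have := integrableD mD jf jg; exact: eq_integrable. Qed.

Lemma integrable_subfun D f g : measurable D -> mu.-integrable D (EFin \o f) ->
  mu.-integrable D (EFin \o g) -> mu.-integrable D (EFin \o (fun x => f x - g x)).
Proof. by move=> mD jf jg; have := integrableB mD jf jg; exact: eq_integrable. Qed.

Lemma integrable_scalefun D f (c : R) : measurable D -> mu.-integrable D (EFin \o f) ->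
  mu.-integrable D (EFin \o (fun x => c * f x)).
Proof. by move=> mD jf; have := integrableZl mD c jf; exact: eq_integrable. Qed.

Lemma Rintegral_dominated_convergence D (f_ : nat -> T -> R) f g : measurable D ->
  (forall n, measurable_fun D (f_ n)) -> measurable_fun D f ->
  {ae mu, forall x, D x -> f_ n x @[n --> \oo] --> f x} ->
  mu.-integrable D (EFin \o g) -> (forall n x, D x -> `|f_ n x| <= g x) ->
  mu.-integrable D (EFin \o f) /\
  \int[mu]_(x in D) f_ n x @[n --> \oo] --> \int[mu]_(x in D) f x.
Proof.
move=> mD mf_ mf f_f ig f_g.
have if_ n : mu.-integrable D (EFin \o f_ n) by apply: le_integrable_real ig => //; exact: f_g.
have [] := @dominated_convergence _ _ _ mu D mD (fun n => EFin \o f_ n) (EFin \o f) (EFin \o g).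
- by move=> n; exact/measurable_EFinP.
- exact/measurable_EFinP.
- by apply: filterS f_f => x h Dx; apply: cvg_EFin; [exact: nearW|exact: h].
- exact: ig.
- by apply: aeW => x n Dx /=; rewrite lee_fin f_g.
move=> intf _ h; split=> //.
have /fine_cvgP[_] : (\int[mu]_(x in D) (f_ n x)%:E)%E @[n --> \oo] -->
    (\int[mu]_(x in D) f x)%:E.
  by rewrite /Rintegral fineK//; exact: integrable_fin_num.
exact.
Qed.

End RealIntegrals.

Section WeakDerivative.
Context {R : realType}.
Local Notation mu := (@lebesgue_measure R).

Lemma eq_ler (x y : R) : x = y -> x <= y.
Proof. by move=> ->. Qed.

Lemma eq_lee (x y : \bar R) : x = y -> (x <= y)%E.
Proof. by move=> ->. Qed.

Lemma measurable_sgr : measurable_fun setT (@Num.sg R).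
Proof.
apply: nondecreasing_measurable => // x y xy.
have [x0|x0|x0] := ltgtP x 0; [rewrite (ltr0_sg x0)|rewrite (gtr0_sg x0)|rewrite x0 sgr0];
have [y0|y0|y0] := ltgtP y 0; rewrite ?(ltr0_sg y0) ?(gtr0_sg y0) ?y0 ?sgr0; lra.
Qed.

Lemma measurable_halfline : measurable (halfline : set R).
Proof. exact: measurable_itv. Qed.
Hint Resolve measurable_halfline : core.

Lemma halflineE (x : R) : halfline x = (0 < x) :> Prop.
Proof. by rewrite /halfline/= in_itv/= andbT. Qed.

Lemma continuous_halfline_measurable (f : R -> R) :
  (forall x, 0 < x -> {for x, continuous f}) -> measurable_fun halfline f.
Proof.
move=> cf; apply: open_continuous_measurable_fun; first exact: interval_open.
by move=> x; rewrite inE halflineE; exact: cf.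
Qed.

Lemma continuous_within_itv (f : R -> R) (a b : R) : 0 < a ->
  (forall x, 0 < x -> {for x, continuous f}) -> {within `[a, b], continuous f}.
Proof.
move=> a0 cf; apply: continuous_in_subspaceT => x.
by rewrite inE/= in_itv/= => /andP[ax _]; apply: cf; exact: lt_le_trans ax.
Qed.

Lemma continuous_itv_integrable (f : R -> R) (a b : R) : 0 < a ->
  (forall x, 0 < x -> {for x, continuous f}) -> mu.-integrable `[a, b] (EFin \o f).
Proof.
move=> a0 cf; apply: continuous_compact_integrable; first exact: segment_compact.
exact: continuous_within_itv.
Qed.

Lemma C1_continuous (f : R -> R) : C1 f -> forall x, 0 < x -> {for x, continuous f}.
Proof.
by move=> Cf x /Cf[df _]; exact: derivable_continuous.
Qed.

Lemma C1_FTC (f : R -> R) (a b : R) : C1 f -> 0 < a -> a <= b ->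
  \int[mu]_(x in `[a, b]) derive1 f x = f b - f a.
Proof.
move=> Cf a0; rewrite le_eqVlt => /predU1P[<-|ab].
  by rewrite set_itv1 Rintegral_set1 subrr.
have pos x : a <= x -> 0 < x by exact: lt_le_trans.
rewrite /Rintegral (@continuous_FTC2 _ _ f a b ab)//.
  by apply: continuous_within_itv => // x x0; exact: (Cf x x0).2.
split.
- move=> x; rewrite in_itv/= => /andP[/ltW ax _]; exact: (Cf _ (pos _ ax)).1.
- by apply: cvg_at_right_filter; exact: C1_continuous.
- by apply: cvg_at_left_filter; apply: C1_continuous; rewrite ?pos// ltW.
Qed.

(* Testing with smooth approximations of the indicator function of [a, b] *)
Lemma weak_derivative_FTC (u k v : R -> R) : weak_derivative u k -> eq_ae u v ->
  (forall x : R, 0 < x -> {for x, continuous v}) ->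
  forall a b : R, 0 < a -> a <= b -> \int[mu]_(x in `[a, b]) k x = v b - v a.
Proof.
move=> [lu lk wk] uv cv a b a0; rewrite le_eqVlt => /predU1P[<-|ab].
  by rewrite set_itv1 Rintegral_set1 subrr.
have [S [Ssmooth S0 S1 dS0 S01]] := @smooth_step R.
have b0 := lt_trans a0 ab.
have dS (x : R) : derivable S x 1 by exact: (Ssmooth 0%N x).
have cS : continuous S.
  by move=> x; exact: derivable_continuous.
have cdS : continuous (derive1 S).
  by move=> x; apply: derivable_continuous; exact: (Ssmooth 1%N).
have dS_out (x : R) : x < 0 \/ 1 < x -> derive1 S x = 0.
  move=> hx; rewrite derive1E; case: hx => hx.
    rewrite (@near_eq_derive _ _ _ S (cst 0)) ?derive_cst//.
    by near=> y; rewrite S0//; apply/ltW; near: y; exact: lt_nbhsl.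
  rewrite (@near_eq_derive _ _ _ S (cst 1)) ?derive_cst//.
  by near=> y; rewrite S1//; apply/ltW; near: y; exact: lt_nbhsr.
(* [T n c] rises smoothly from 0 at [c] to 1 at $c+1/(n+1)$; its derivative [dTn n c] is an
   approximate identity that concentrates at [c] from the right. *)
pose T (n : nat) (c x : R) := S (n.+1%:R * x + - (n.+1%:R * c)).
pose dTn (n : nat) (c x : R) := derive1 S (n.+1%:R * x + - (n.+1%:R * c)) * n.+1%:R.
have dT (n : nat) (c x : R) : is_derive x 1 (T n c) (dTn n c x).
  apply: (is_derive_compfun (f := S) (g := fun y => n.+1%:R * y + - (n.+1%:R * c))).
    exact: is_derive_derive1.
  exact: is_derive_affine.
have dTE n c : derive1 (T n c) = dTn n c.
  by apply/funext => x; rewrite derive1E; have [_ ->] := dT n c x.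
have argE (n : nat) (c x : R) : n.+1%:R * x + - (n.+1%:R * c) = n.+1%:R * (x - c).
  by rewrite mulrBr.
have caff (n : nat) (c : R) : continuous (fun x : R => n.+1%:R * x + - (n.+1%:R * c)).
  move=> x; apply: cvgD; last exact: cvg_cst.
  by apply: cvgM; [exact: cvg_cst|exact: cvg_id].
have cT n c : continuous (T n c).
  by move=> x; apply: (continuous_comp (caff n c x)); exact: cS.
have cdT n c : continuous (dTn n c).
  move=> x; apply: cvgM; last exact: cvg_cst.
  by apply: (continuous_comp (caff n c x)); exact: cdS.
have dTge0 n c x : 0 <= dTn n c x by rewrite mulr_ge0.
have dT_out (n : nat) (c x : R) : ~ `[c, c + n.+1%:R^-1]%classic x -> dTn n c x = 0.
  rewrite /= in_itv/= => /negP; rewrite negb_and -!ltNge /dTn argE => h.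
  rewrite dS_out ?mul0r//; case/orP: h => h; [left|right].
    by rewrite pmulr_rlt0// subr_lt0.
  by rewrite -ltr_pdivrMl// mulr1 ltrBrDl.
pose chi n x := T n a x + (-1) * T n b x.
have chi_out n x : ~ `[a, b + 1]%classic x -> chi n x = 0.
  rewrite /= in_itv/= => /negP; rewrite negb_and -!ltNge.
  move=> /orP[xa|xb]; rewrite /chi /T !argE.
    by rewrite !S0 ?mulr0 ?addr0// pmulr_rle0// subr_le0 ltW// (lt_trans xa).
  have bx : 1 <= n.+1%:R * (x - b).
    by rewrite -[leLHS]mulr1 ler_pM// ?ler1n// lerBrDl ltW.
  by rewrite !S1 ?mulr1 ?subrr// (le_trans bx)// ler_wpM2l// lerD2l lerN2 ltW.
have chi_test n : test_function (chi n).
  split.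
    apply/derivable_uptoP => m; apply: derivable_uptoD.
      by apply: derivable_upto_affine; exact: (derivable_uptoP _).1.
    apply: derivable_uptoM; first exact: derivable_upto_cst.
    by apply: derivable_upto_affine; exact: (derivable_uptoP _).1.
  exists a, (b + 1); split=> // x; apply: contraR => h; apply/eqP.
  by apply: chi_out => /=; rewrite in_itv/=; exact/negP.
have chi_derive (n : nat) (x : R) : derive1 (chi n) x = dTn n a x - dTn n b x.
  have h := is_derive_mulfun (is_derive_cst (-1 : R) x 1) (dT n b x).
  have [_ +] := is_derive_addfun (dT n a x) h.
  by rewrite derive1E => ->; rewrite mulr0 addr0 mulN1r.
have mk : measurable_fun halfline k by case: lk.
have itv_half c e : 0 < c -> `[c, e]%classic `<=` (halfline : set R).
  by move=> c0 x; rewrite halflineE/= in_itv/= => /andP[+ _]; exact: lt_le_trans.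
have limit_k : \int[mu]_(x in halfline) (k x * chi n x) @[n --> \oo] -->
    \int[mu]_(x in `[a, b]) k x.
  have ik : mu.-integrable `[a, b + 1] (EFin \o k).
    apply/integrableP; split.
      by apply/measurable_EFinP; apply: measurable_funS mk => //; exact: itv_half.
    by case: lk => _ _ h; apply: h; [exact: itv_half|exact: segment_compact].
  have E n : \int[mu]_(x in halfline) (k x * chi n x) =
      \int[mu]_(x in `[a, b + 1]) (k x * chi n x).
    by apply: Rintegral_support; [exact: itv_half|move=> x _ /chi_out ->; rewrite mulr0].
  rewrite (eq_cvg _ _ E).
  (* The half-open interval is the exact pointwise limit: [chi n] vanishes at [a] and tends to 1 at
     [b]. *)
  have -> : \int[mu]_(x in `[a, b]) k x =
      \int[mu]_(x in `[a, b + 1]) (k x * \1_(`]a, b]%classic : set R) x).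
    rewrite -Rintegral_itv_obnd_cbnd; last first.
      apply: integrableS ik => //; apply: subset_itv; rewrite bnd_simp//.
      by rewrite lerDl.
    rewrite [RHS](@Rintegral_support _ _ _ mu `]a, b]%classic).
    - by apply: eq_Rintegral => x xab; rewrite indicE xab mulr1.
    - by apply: subset_itv; rewrite bnd_simp// lerDl.
    - by move=> x _ h; rewrite indicE memNset ?mulr0.
  apply: (@Rintegral_dominated_convergence _ _ _ mu _ _ _ (fun x => `|k x|) _ _ _ _ _ _).2 => //.
  - move=> n; apply: measurable_funM; first by apply: measurable_funS mk => //; exact: itv_half.
    apply: measurable_funTS; apply: continuous_measurable_fun => x.
    apply: cvgD; first exact: cT.
    by apply: cvgM; [exact: cvg_cst|exact: cT].
  - apply: measurable_funM; first by apply: measurable_funS mk => //; exact: itv_half.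
    by apply: measurable_indic.
  - apply: aeW => x /= _.
    apply: cvgM; first exact: cvg_cst.
    have cvgT1 c : c < x -> T n c x @[n --> \oo] --> (1 : R).
      move=> cx; apply/cvgrPdist_le => e e0; near=> n.
      rewrite /T argE S1; first by rewrite subrr normr0 ltW.
      rewrite -ler_pdivrMr ?subr_gt0// div1r.
      rewrite (@le_trans _ _ n%:R) ?ler_nat//.
      by near: n; exact: nbhs_infty_ger.
    have T0 n c : x <= c -> T n c x = 0.
      by move=> xc; rewrite /T argE S0// pmulr_rle0// subr_le0.
    have [xa|ax] := leP x a.
      rewrite indicE memNset; last by rewrite /= in_itv/= ltNge xa.
      rewrite (_ : (fun n => chi n x) = fun=> 0); first exact: cvg_cst.
      by apply/funext => n; rewrite /chi !T0 ?mulr0 ?addr0// (le_trans xa)// ltW.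
    have [xb|bx] := leP x b.
      rewrite indicE mem_set; last by rewrite /= in_itv/= ax xb.
      rewrite (_ : (fun n => chi n x) = fun n => T n a x); first exact: cvgT1.
      by apply/funext => n; rewrite /chi (T0 _ b)// mulr0 addr0.
    rewrite indicE memNset; last by rewrite /= in_itv/= ax/= leNgt bx.
    rewrite (_ : _%:R = 1 + -1 * 1 :> R); last by rewrite /=; ring.
    apply: cvgD; first exact: cvgT1.
    by apply: cvgM; [exact: cvg_cst|exact: cvgT1].
  - by have := integrable_norm ik.
  - move=> n x _; rewrite normrM ler_piMr// /chi mulN1r ler_norml.
    have /andP[A0 A1] := S01 (n.+1%:R * x + - (n.+1%:R * a)).
    have /andP[B0 B1] := S01 (n.+1%:R * x + - (n.+1%:R * b)).
    by rewrite /T; apply/andP; split; lra.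
have ivT (n : nat) (c e : R) : 0 < c -> mu.-integrable `[c, e] (EFin \o (fun x => v x * dTn n c x)).
  move=> c0; apply: continuous_itv_integrable => // x x0.
  by apply: cvgM; [exact: cv|exact: cdT].
have idT (n : nat) (c e : R) : 0 < c -> mu.-integrable `[c, e] (EFin \o dTn n c).
  by move=> c0; apply: continuous_itv_integrable => // x x0; exact: cdT.
have ivTh (n : nat) (c : R) : 0 < c -> mu.-integrable halfline (EFin \o (fun x => v x * dTn n c x)).
  move=> c0; apply: (@integrable_support _ _ _ mu `[c, c + n.+1%:R^-1]%classic) => //.
  - exact: itv_half.
  - by move=> x _ /dT_out ->; rewrite mulr0.
  - exact: ivT.
(* [dTn n c] is nonnegative, supported in $[c,c+1/(n+1)]$ and of integral 1, so this is a weighted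
   mean of [v] close to [c]. *)
have limit_v (c : R) : 0 < c -> \int[mu]_(x in halfline) (v x * dTn n c x) @[n --> \oo] --> v c.
  move=> c0; apply/cvgrPdist_le => e e0.
  have /cvgrPdist_le /(_ _ e0) /nbhs_ballP[r /= r0 hr] := cv _ c0.
  near=> n.
  have nr : n.+1%:R^-1 < r.
    rewrite invf_plt ?posrE//; apply: (@lt_le_trans _ _ n%:R); last by rewrite ler_nat.
    by near: n; exact: nbhs_infty_gtr.
  rewrite (@Rintegral_support _ _ _ mu `[c, c + n.+1%:R^-1]%classic); last 2 first.
  - exact: itv_half.
  - by move=> x _ /dT_out ->; rewrite mulr0.
  have one : \int[mu]_(x in `[c, c + n.+1%:R^-1]) dTn n c x = 1.
    rewrite -dTE C1_FTC ?lerDl ?invr_ge0//.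
      rewrite /T !argE subrr mulr0 [X in _ - X]S0// subr0 addrC addKr S1//.
      by rewrite divff// pnatr_eq0.
    by move=> x _; split; [have [] := dT n c x|rewrite dTE; exact: cdT].
  have Zone (w : R) : \int[mu]_(x in `[c, c + n.+1%:R^-1]) (w * dTn n c x) = w.
    by rewrite RintegralZl// ?one ?mulr1//; exact: idT.
  rewrite -{1}(Zone (v c)) -RintegralB//; last 2 first.
  - by apply: continuous_itv_integrable => // x x0; apply: cvgM; [exact: cvg_cst|exact: cdT].
  - exact: ivT.
  have near_c (x : R) : c <= x -> x <= c + n.+1%:R^-1 -> `|v c - v x| <= e.
    move=> cx xn; apply: hr => /=; rewrite /ball/= ltr_distlC; apply/andP; split.
      by rewrite ltrBlDr (le_lt_trans cx)// ltrDl.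
    by rewrite (le_lt_trans xn)// ltrD2l.
  have ii : mu.-integrable `[c, c + n.+1%:R^-1] (EFin \o (fun x => v c * dTn n c x - v x * dTn n c x)).
    apply: continuous_itv_integrable => // x x0.
    apply: cvgB; first by apply: cvgM; [exact: cvg_cst|exact: cdT].
    by apply: cvgM; [exact: cv|exact: cdT].
  apply: (le_trans (le_normr_Rintegral _ ii)) => //.
  rewrite -[leRHS](Zone e); apply: le_Rintegral => //.
  - by have := integrable_norm ii.
  - by apply: continuous_itv_integrable => // x x0; apply: cvgM; [exact: cvg_cst|exact: cdT].
  - move=> x /=; rewrite in_itv/= => /andP[cx xn].
    rewrite -mulrBl normrM (ger0_norm (dTge0 _ _ _)) ler_wpM2r//.
    exact: near_c.
(* The weak formulation tested with [chi n], [u] being replaced by its continuous representative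
   [v]. *)
have key n : \int[mu]_(x in halfline) (v x * dTn n a x) -
    \int[mu]_(x in halfline) (v x * dTn n b x) = - \int[mu]_(x in halfline) (k x * chi n x).
  rewrite -RintegralB//; [|exact: ivTh|exact: ivTh].
  rewrite -wk//; apply: Rintegral_ae_eq => //.
  - apply: measurable_funB; apply: measurable_funM.
    + exact: continuous_halfline_measurable.
    + by apply: measurable_funTS; exact: continuous_measurable_fun.
    + exact: continuous_halfline_measurable.
    + by apply: measurable_funTS; exact: continuous_measurable_fun.
  - apply: measurable_funM; first by case: lu.
    rewrite (_ : derive1 (chi n) = fun x => dTn n a x - dTn n b x); last first.
      by apply/funext => x; exact: chi_derive.
    by apply: measurable_funTS; apply: continuous_measurable_fun => x; apply: cvgB; exact: cdT.
  - by apply: aeS uv => x h Dx; rewrite h// chi_derive mulrBr.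
have L1 : \int[mu]_(x in halfline) (v x * dTn n a x) -
    \int[mu]_(x in halfline) (v x * dTn n b x) @[n --> \oo] --> v a - v b.
  by apply: cvgB; exact: limit_v.
have L2 : \int[mu]_(x in halfline) (v x * dTn n a x) -
    \int[mu]_(x in halfline) (v x * dTn n b x) @[n --> \oo] --> - \int[mu]_(x in `[a, b]) k x.
  by rewrite (eq_cvg _ _ key); apply: cvgN; exact: limit_k.
have E := cvg_lim (@Rhausdorff R) L1; rewrite (cvg_lim (@Rhausdorff R) L2) in E.
by rewrite -[LHS]opprK E opprB.
Unshelve. all: by end_near. Qed.
End WeakDerivative.

(** * Kato's inequality *)

Section Kato.
Context {R : realType}.
Local Notation mu := (@lebesgue_measure R).

(* A continuity induction: no partition of [a, b] is needed to sum up the local estimates. *)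
Lemma local_le0 (a b : R) (Phi : R -> R -> R) : a <= b ->
  (forall x y z, a <= x -> x <= y -> y <= z -> z <= b -> Phi x z = Phi x y + Phi y z) ->
  (forall x, a <= x <= b -> exists2 d, 0 < d & forall u w,
     a <= u -> u <= x -> x <= w -> w <= b -> x - d < u -> w < x + d -> Phi u w <= 0) ->
  Phi a b <= 0.
Proof.
move=> ab PhiD loc; pose S := [set w | a <= w <= b /\ Phi a w <= 0].
have aS : S a.
  split; first by rewrite lexx.
  have [|d d0] := loc a; first by rewrite lexx.
  by apply; rewrite ?lexx// ?gtrBl// ltrDl.
have hS : has_sup S.
  by split; [exists a|exists b => w [/andP[]]].
have as_ : a <= sup S by apply: ub_le_sup; case: hS.
have sb : sup S <= b by apply: ge_sup; [exists a|move=> w [/andP[]]].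
have [|d d0 hd] := loc (sup S); first by rewrite as_ sb.
have [w [/andP[aw wb] Pw] sw] := sup_adherent d0 hS.
have ws : w <= sup S by apply: ub_le_sup; [case: hS|split=> //; rewrite aw wb].
have Ps : Phi a (sup S) <= 0.
  rewrite (PhiD a w (sup S))// -[leRHS]addr0 lerD// hd// ltrDl//.
have [->//|sNb] := eqVneq b (sup S).
have sltb : sup S < b by rewrite lt_neqAle eq_sym sNb.
pose w' := Num.min b (sup S + d / 2).
have sw' : sup S < w' by rewrite lt_min sltb ltrDl divr_gt0.
have w'b : w' <= b by rewrite ge_min lexx.
have : S w'.
  split; first by rewrite w'b (le_trans as_)// ltW.
  rewrite (PhiD a (sup S) w')//; last exact: ltW.
  rewrite -[leRHS]addr0 lerD// hd//; [exact: ltW|by rewrite gtrBl|].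
  by rewrite gt_min ltrD2l ltr_pdivrMr// ltr_pMr// ltr1n orbT.
by move=> /(ub_le_sup hS.2); rewrite leNgt sw'.
Qed.

(** $\sqrt{w^2+e^2}-e$ is convex, vanishes at 0 and lies at most $e$ below $|w|$; [smooth_sg] is its
    derivative. *)
Definition smooth_abs (e w : R) : R := Num.sqrt (w ^+ 2 + e ^+ 2) - e.
Definition smooth_sg (e w : R) : R := w / Num.sqrt (w ^+ 2 + e ^+ 2).

Section smooth_abs.
Variables (e : R).
Hypothesis e0 : 0 < e.
Let s (w : R) := Num.sqrt (w ^+ 2 + e ^+ 2).

Let s2 w : s w ^+ 2 = w ^+ 2 + e ^+ 2.
Proof. by rewrite sqr_sqrtr// addr_ge0// sqr_ge0. Qed.

Let s_gt0 w : 0 < s w.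
Proof. by rewrite sqrtr_gt0 ltr_wpDl ?sqr_ge0// exprn_gt0. Qed.

Let s_ge w : `|w| <= s w.
Proof. by rewrite -sqrtr_sqr ler_wsqrtr// lerDl sqr_ge0. Qed.

Let s_le w : s w <= `|w| + e.
Proof.
rewrite -[leRHS]ger0_norm ?addr_ge0 ?(ltW e0)// -sqrtr_sqr ler_wsqrtr//.
rewrite sqrrD real_normK ?num_real// -addrA lerD2l lerDr.
by rewrite mulrn_wge0// mulr_ge0// ltW.
Qed.

Lemma smooth_abs_ge0 w : 0 <= smooth_abs e w.
Proof.
rewrite subr_ge0 -[leLHS]ger0_norm ?(ltW e0)// -sqrtr_sqr ler_wsqrtr//.
by rewrite lerDr sqr_ge0.
Qed.

Lemma smooth_abs_le w : smooth_abs e w <= `|w|.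
Proof. by rewrite lerBlDr s_le. Qed.

Lemma smooth_abs_dist w : `| `|w| - smooth_abs e w| <= e.
Proof.
rewrite ger0_norm ?subr_ge0 ?smooth_abs_le//.
rewrite /smooth_abs -/(s w); have := s_ge w; lra.
Qed.

Lemma smooth_sg_le1 w : `|smooth_sg e w| <= 1.
Proof. by rewrite normrM normfV (gtr0_norm (s_gt0 w)) ler_pdivrMr// mul1r s_ge. Qed.

Lemma smooth_sg_dist w : w != 0 -> `|Num.sg w - smooth_sg e w| <= e / `|w|.
Proof.
move=> w0; have w_gt0 : 0 < `|w| by rewrite normr_gt0.
rewrite ler_pdivlMr// -normrM mulrBl.
have -> : Num.sg w * w = `|w| by rewrite -normrEsg.
rewrite /smooth_sg -/(s w) mulrAC -expr2 -[w ^+ 2]real_normK ?num_real//.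
rewrite -{1}(mulfK (lt0r_neq0 (s_gt0 w)) `|w|) -mulrBl normrM normfV (gtr0_norm (s_gt0 w)).
rewrite ler_pdivrMr// expr2 -mulrBr normrM normr_id ger0_norm ?subr_ge0 ?s_ge//.
rewrite [leRHS]mulrC ler_pM// ?subr_ge0 ?s_ge// lerBlDl; exact: s_le.
Qed.

(** Convexity, with the tangent taken at [w2]; it reduces to the Cauchy-Schwarz inequality
    $w_1w_2+e^2\le\sqrt{w_1^2+e^2}\sqrt{w_2^2+e^2}$. *)
Lemma smooth_abs_tangent w1 w2 :
  smooth_abs e w2 - smooth_abs e w1 <= smooth_sg e w2 * (w2 - w1).
Proof.
rewrite /smooth_abs /smooth_sg -/(s w1) -/(s w2) opprB addrA subrK mulrAC.
rewrite ler_pdivlMr// mulrBl -expr2 s2.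
have : w1 * w2 + e ^+ 2 <= s w1 * s w2.
  rewrite (le_trans (ler_norm _))// -sqrtr_sqr -[leRHS]ger0_norm ?mulr_ge0 ?(ltW (s_gt0 _))//.
  rewrite -sqrtr_sqr ler_wsqrtr// exprMn !s2 -subr_ge0.
  rewrite (_ : _ - _ = (e * (w1 - w2)) ^+ 2) ?sqr_ge0//; ring.
by rewrite mulrBr -expr2; lra.
Qed.

Lemma smooth_abs_continuous : continuous (smooth_abs e).
Proof.
move=> w; apply: cvgB; last exact: cvg_cst.
apply: (@continuous_comp _ _ _ (fun w : R => w ^+ 2 + e ^+ 2) Num.sqrt).
  by apply: cvgD; [exact: exprn_continuous|exact: cvg_cst].
exact: sqrt_continuous.
Qed.

Lemma smooth_sg_continuous : continuous (smooth_sg e).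
Proof.
move=> w; apply: cvgM; first exact: cvg_id.
apply: cvgV; first by rewrite gt_eqF// s_gt0.
apply: (@continuous_comp _ _ _ (fun w : R => w ^+ 2 + e ^+ 2) Num.sqrt).
  by apply: cvgD; [exact: exprn_continuous|exact: cvg_cst].
exact: sqrt_continuous.
Qed.

End smooth_abs.

Lemma Rintegral_itv_split (k : R -> R) (a b x y z : R) : mu.-integrable `[a, b] (EFin \o k) ->
  a <= x -> x <= y -> y <= z -> z <= b ->
  \int[mu]_(t in `[x, z]) k t = \int[mu]_(t in `[x, y]) k t + \int[mu]_(t in `[y, z]) k t.
Proof.
move=> ik ax xy yz zb.
have ixz : mu.-integrable `[x, z] (EFin \o k).
  by apply: integrableS ik => //; apply: subset_itv; rewrite bnd_simp.
have := @Rintegral_itvB _ k (BLeft x) (BRight z) y ixz.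
rewrite !bnd_simp => /(_ xy yz); rewrite Rintegral_itv_obnd_cbnd.
  by move=> <-; rewrite addrC subrK.
by apply: integrableS ixz => //; apply: subset_itv; rewrite bnd_simp.
Qed.

Lemma integrable_continuousM (h k : R -> R) (a b : R) : 0 < a ->
  (forall x : R, 0 < x -> {for x, continuous h}) ->
  mu.-integrable `[a, b] (EFin \o k) -> mu.-integrable `[a, b] (EFin \o (fun x => h x * k x)).
Proof.
move=> a0 ch ik; have [ab|ba] := leP a b; last first.
  by rewrite set_itv_ge -?ltNge ?bnd_simp//; exact: integrable_set0.
have cnh : {within `[a, b], continuous (fun x => `|h x|)}.
  apply: continuous_within_itv => // x x0.
  by apply: (@continuous_comp _ _ _ h (fun x : R => `|x|)); [exact: ch|exact: norm_continuous].
have [c _ hc] := EVT_max ab cnh.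
apply: (@le_integrable_real _ _ _ mu _ _ (fun x => `|h c| * `|k x|)) => //.
- apply: measurable_funM.
    by have /(measurable_int mu)/measurable_EFinP := continuous_itv_integrable b a0 ch.
  by have /(measurable_int mu)/measurable_EFinP := ik.
- by move=> x xab; rewrite normrM ler_wpM2r// hc.
- by apply: integrable_scalefun => //; exact: (integrable_norm ik).
Qed.

(** As [v] is only a primitive of the integrable [k], no chain rule is at hand. On a short interval
    the tangent inequality replaces it, with an error of at most $\eta\int(|k|+|\psi'|)$; the local
    estimates add up by [local_le0], and $\eta\to0$. *)
Lemma kato_itv (v k psi : R -> R) (a b e : R) : 0 < e -> 0 < a -> a <= b ->
  (forall x : R, 0 < x -> {for x, continuous v}) -> C1 psi ->
  (forall x, 0 < x -> 0 <= psi x) -> mu.-integrable `[a, b] (EFin \o k) ->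
  (forall x y, a <= x -> x <= y -> \int[mu]_(t in `[x, y]) k t = v y - v x) ->
  smooth_abs e (v b) * psi b - smooth_abs e (v a) * psi a <=
  \int[mu]_(x in `[a, b]) (psi x * smooth_sg e (v x) * k x + smooth_abs e (v x) * derive1 psi x).
Proof.
move=> e0 a0 ab cv Cpsi psi0 ik kv.
pose A x := psi x * smooth_sg e (v x); pose J x := smooth_abs e (v x).
have cpsi := C1_continuous Cpsi.
have cdpsi (x : R) : 0 < x -> {for x, continuous (derive1 psi)} by move=> /Cpsi[].
have cJ (x : R) : 0 < x -> {for x, continuous J}.
  by move=> x0; apply: (@continuous_comp _ _ _ v (smooth_abs e)); [exact: cv|exact: smooth_abs_continuous].
have cA (x : R) : 0 < x -> {for x, continuous A}.
  move=> x0; apply: cvgM; first exact: cpsi.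
  by apply: (@continuous_comp _ _ _ v (smooth_sg e)); [exact: cv|exact: smooth_sg_continuous].
have idpsi : mu.-integrable `[a, b] (EFin \o derive1 psi) by exact: continuous_itv_integrable.
pose g x := A x * k x + J x * derive1 psi x.
pose n x := `|k x| + `|derive1 psi x|.
have iAk : mu.-integrable `[a, b] (EFin \o (fun x => A x * k x)) by exact: integrable_continuousM.
have iJp : mu.-integrable `[a, b] (EFin \o (fun x => J x * derive1 psi x)).
  exact: integrable_continuousM.
have ig : mu.-integrable `[a, b] (EFin \o g).
  exact: integrable_addfun.
have in_ : mu.-integrable `[a, b] (EFin \o n).
  by apply: integrable_addfun => //; [exact: (integrable_norm ik)|exact: (integrable_norm idpsi)].
(* An additive function of the interval, as [local_le0] requires; the $\eta$ term pays for freezing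
   [A] and [J] at the endpoints. *)
pose Phi (eta x y : R) := J y * psi y - J x * psi x - \int[mu]_(t in `[x, y]) g t -
  eta * \int[mu]_(t in `[x, y]) n t.
have n0 : 0 <= \int[mu]_(t in `[a, b]) n t.
  by apply: Rintegral_ge0 => x _; rewrite addr_ge0.
suff H eta : 0 < eta -> Phi eta a b <= 0.
  apply/ler_addgt0Pr => eps eps0.
  have : Phi (eps / (\int[mu]_(t in `[a, b]) n t + 1)) a b <= 0.
    by apply: H; rewrite divr_gt0// ltr_wpDl.
  rewrite /Phi -/g; set In := \int[mu]_(t in `[a, b]) n t.
  have : eps / (In + 1) * In <= eps.
    rewrite mulrAC ler_pdivrMr ?ltr_wpDl// ler_wpM2l ?(ltW eps0)// lerDl//.
  rewrite -/(J b) -/(J a); set Ig := \int[mu]_(t in `[a, b]) g t.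
  by lra.
move=> eta0; apply: local_le0 => //.
  move=> x y z ax xy yz zb; rewrite /Phi.
  rewrite (Rintegral_itv_split ig ax xy yz zb) (Rintegral_itv_split in_ ax xy yz zb).
  by ring.
move=> x /andP[ax xb]; have x0 := lt_le_trans a0 ax.
have eta2 : 0 < eta / 2 by rewrite divr_gt0.
have /cvgrPdist_le /(_ _ eta2) /nbhs_ballP[r1 /= r10 hr1] := cA _ x0.
have /cvgrPdist_le /(_ _ eta2) /nbhs_ballP[r2 /= r20 hr2] := cJ _ x0.
exists (Num.min r1 r2); first by rewrite lt_min r10 r20.
move=> u w au ux xw wb; rewrite ltrBlDr -ltrBlDl lt_min => /andP[u1 u2].
rewrite -ltrBlDl lt_min => /andP[w1 w2].
have uw := le_trans ux xw.
have iS h : mu.-integrable `[a, b] (EFin \o h) -> mu.-integrable `[u, w] (EFin \o h).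
  by apply: integrableS => //; apply: subset_itv; rewrite bnd_simp.
have osc (y : R) : u <= y <= w -> `|x - y| < r1 /\ `|x - y| < r2.
  move=> /andP[uy yw]; clear -uy yw ux xw u1 u2 w1 w2.
  by split; rewrite ltr_norml; apply/andP; split; lra.
have oA y y' : u <= y <= w -> u <= y' <= w -> `|A y - A y'| <= eta.
  move=> /osc[y1 _] /osc[y1' _].
  have := hr1 _ y1; have := hr1 _ y1' => /= h1 h2.
  rewrite (_ : A y - A y' = (A x - A y') - (A x - A y)); last by ring.
  by rewrite (le_trans (ler_normB _ _))// [leRHS](splitr eta) lerD.
have oJ y y' : u <= y <= w -> u <= y' <= w -> `|J y - J y'| <= eta.
  move=> /osc[_ y1] /osc[_ y1'].
  have := hr2 _ y1; have := hr2 _ y1' => /= h1 h2.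
  rewrite (_ : J y - J y' = (J x - J y') - (J x - J y)); last by ring.
  by rewrite (le_trans (ler_normB _ _))// [leRHS](splitr eta) lerD.
have u0 := lt_le_trans a0 au.
have w0 := lt_le_trans u0 uw.
(* Discrete product rule: $\psi(w)$ times the variation of $J$, which the tangent at $w$ bounds,
   plus $J(u)$ times the variation of $\psi$. *)
have S1 : J w * psi w - J u * psi u <=
    A w * \int[mu]_(t in `[u, w]) k t + J u * \int[mu]_(t in `[u, w]) derive1 psi t.
  rewrite kv// C1_FTC//.
  have := smooth_abs_tangent e0 (v u) (v w); rewrite -/(J w) -/(J u) => h.
  have := ler_wpM2l (psi0 _ w0) h; rewrite /A.
  by lra.
rewrite /Phi subr_le0 lerBlDr (le_trans S1)//.
rewrite -!RintegralZl//; [|exact: iS|exact: iS|exact: iS].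
have iZ h c : mu.-integrable `[u, w] (EFin \o h) -> mu.-integrable `[u, w] (EFin \o (fun x => c * h x)).
  exact: integrable_scalefun.
have iD h1 h2 : mu.-integrable `[u, w] (EFin \o h1) -> mu.-integrable `[u, w] (EFin \o h2) ->
    mu.-integrable `[u, w] (EFin \o (fun x => h1 x + h2 x)).
  exact: integrable_addfun.
have iu1 := iZ _ (A w) (iS _ ik); have iu2 := iZ _ (J u) (iS _ idpsi).
have iu3 := iZ _ eta (iS _ in_); have iu4 := iS _ ig.
rewrite -!RintegralD//; apply: le_Rintegral => //; [exact: iD|exact: iD|].
move=> y /=; rewrite in_itv/= => yuw.
have h1 : `|(A w - A y) * k y| <= eta * `|k y|.
  by rewrite normrM ler_wpM2r// oA// uw lexx.
have h2 : `|(J u - J y) * derive1 psi y| <= eta * `|derive1 psi y|.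
  by rewrite normrM ler_wpM2r// oJ// uw lexx.
have := le_trans (ler_norm _) h1; have := le_trans (ler_norm _) h2.
by rewrite /g /n !mulrBl mulrDr; clear; lra.
Qed.

(** Limit of [kato_itv] on $[e_n,1/e_n]$ with smoothing parameter $e_n=1/(n+1)$. The boundary term
    at $1/e_n$ is nonnegative; the one at $e_n$ tends to 0 because [v] does and [psi] is bounded on
    $(0,1]$. *)
Lemma kato (v k psi : R -> R) (M : R) :
  (forall x : R, 0 < x -> {for x, continuous v}) -> v x @[x --> 0^'+] --> (0 : R) ->
  (forall a b, 0 < a -> a <= b -> mu.-integrable `[a, b] (EFin \o k)) ->
  (forall a b, 0 < a -> a <= b -> \int[mu]_(t in `[a, b]) k t = v b - v a) ->
  measurable_fun halfline k -> C1 psi -> (forall x, 0 < x -> 0 <= psi x) ->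
  (forall x, 0 < x <= 1 -> psi x <= M) ->
  mu.-integrable halfline (EFin \o (fun x => psi x * k x)) ->
  mu.-integrable halfline (EFin \o (fun x => v x * derive1 psi x)) ->
  0 <= \int[mu]_(x in halfline) (psi x * Num.sg (v x) * k x + `|v x| * derive1 psi x).
Proof.
move=> cv v0 ik kv mk Cpsi psi0 psiM ipk ivp.
pose e (n : nat) : R := n.+1%:R^-1.
have e0 n : 0 < e n by rewrite invr_gt0.
pose I (n : nat) := `[e n, n.+1%:R]%classic : set R.
pose g n x := psi x * smooth_sg (e n) (v x) * k x + smooth_abs (e n) (v x) * derive1 psi x.
pose f n x := g n x * \1_(I n) x.
have eI n : e n <= n.+1%:R by rewrite (@le_trans _ _ 1)// ?ler1n// invf_le1// ler1n.
have IH n : I n `<=` halfline.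
  by move=> x; rewrite halflineE /I/= in_itv/= => /andP[+ _]; exact: lt_le_trans.
have mv : measurable_fun halfline v by exact: continuous_halfline_measurable.
have mpsi : measurable_fun halfline psi.
  by apply: continuous_halfline_measurable; exact: C1_continuous.
have mdpsi : measurable_fun halfline (derive1 psi).
  by apply: continuous_halfline_measurable => x /Cpsi[].
have mg n : measurable_fun halfline (g n).
  apply: measurable_funD; apply: measurable_funM => //; first apply: measurable_funM => //.
    apply: continuous_halfline_measurable => x x0.
    by apply: (@continuous_comp _ _ _ v (smooth_sg (e n))); [exact: cv|exact: smooth_sg_continuous].
  apply: continuous_halfline_measurable => x x0.
  by apply: (@continuous_comp _ _ _ v (smooth_abs (e n))); [exact: cv|exact: smooth_abs_continuous].
have mf n : measurable_fun halfline (f n).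
  by apply: measurable_funM => //; apply: measurable_indic; exact: measurable_itv.
have [] := @Rintegral_dominated_convergence _ _ _ mu halfline f
  (fun x => psi x * Num.sg (v x) * k x + `|v x| * derive1 psi x)
  (fun x => `|psi x * k x| + `|v x * derive1 psi x|) measurable_halfline mf.
- apply: measurable_funD; apply: measurable_funM => //.
    by apply: measurable_funM => //; exact: measurableT_comp measurable_sgr mv.
  exact: measurableT_comp.
- apply: aeW => x; rewrite halflineE => x0.
  have e_cvg : e n @[n --> \oo] --> (0 : R) by exact: cvg_harmonic.
  have indic1 : \forall n \near \oo, \1_(I n) x = 1 :> R.
    near=> n; rewrite indicE mem_set// /I/= in_itv/=; apply/andP; split.
      by near: n; apply: (cvgr_le 0 e_cvg).
    rewrite (@le_trans _ _ n%:R) ?ler_nat//.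
    by near: n; exact: nbhs_infty_ger.
  have gl : g n x @[n --> \oo] --> psi x * Num.sg (v x) * k x + `|v x| * derive1 psi x.
    apply: cvgD; apply: cvgM; [|exact: cvg_cst| |exact: cvg_cst].
      apply: cvgM; first exact: cvg_cst.
      have [->|vx] := eqVneq (v x) 0.
        rewrite sgr0 (_ : (fun n => _) = fun=> 0); first exact: cvg_cst.
        by apply/funext => n; rewrite /smooth_sg mul0r.
      apply/cvgrPdist_le => eps eps0; near=> n.
      apply: (le_trans (smooth_sg_dist (e0 n) vx)).
      rewrite ler_pdivrMr ?normr_gt0//.
      by near: n; apply: (cvgr_le 0 e_cvg); rewrite mulr_gt0// normr_gt0.
    apply/cvgrPdist_le => eps eps0; near=> n.
    apply: (le_trans (smooth_abs_dist (e0 n) _)).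
    by near: n; exact: (cvgr_le 0 e_cvg).
  apply: cvg_trans gl; apply: near_eq_cvg; near=> n.
  rewrite /f [X in _ * X](_ : _ = 1) ?mulr1//.
  by near: n.
- by apply: integrable_addfun; [exact: measurable_halfline|exact: (integrable_norm ipk)|
    exact: (integrable_norm ivp)].
- move=> n x; rewrite halflineE => x0; rewrite /f normrM (@le_trans _ _ `|g n x|)//.
    by rewrite ler_piMr// indicE; case: (x \in I n); rewrite ?normr1 ?normr0.
  rewrite /g (le_trans (ler_normD _ _))// lerD//.
    by rewrite mulrAC (normrM (psi x * k x)) ler_piMr// smooth_sg_le1.
  rewrite (normrM (smooth_abs _ _)) (normrM (v x)) ler_wpM2r//.
  by rewrite ger0_norm ?smooth_abs_ge0// smooth_abs_le.
move=> _ lim_f.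
have low n : - (`|v (e n)| * M) <= \int[mu]_(x in halfline) f n x.
  have -> : \int[mu]_(x in halfline) f n x = \int[mu]_(x in I n) g n x.
    rewrite (@Rintegral_support _ _ _ mu (I n) halfline (f n) (IH n)); last first.
      by move=> x _ xI; rewrite /f indicE memNset ?mulr0.
    by apply: eq_Rintegral => x xI; rewrite /f indicE xI mulr1.
  apply: le_trans (kato_itv (e0 n) (e0 n) (eI n) cv Cpsi psi0 _ _); last 2 first.
  - exact: ik.
  - by move=> x y ex xy; rewrite kv// (lt_le_trans (e0 n)).
  have h1 : 0 <= smooth_abs (e n) (v n.+1%:R) * psi n.+1%:R.
    by rewrite mulr_ge0 ?smooth_abs_ge0// psi0.
  have h2 : smooth_abs (e n) (v (e n)) * psi (e n) <= `|v (e n)| * M.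
    rewrite ler_pM ?smooth_abs_ge0 ?smooth_abs_le ?psi0 ?psiM//.
    by rewrite e0 invf_le1 ?ler1n.
  by lra.
have lim0 : - (`|v (e n)| * M) @[n --> \oo] --> (0 : R).
  rewrite -[X in _ --> X]oppr0; apply: cvgN; rewrite -(mul0r M) -(@normr0 R R).
  apply: cvgM; last exact: cvg_cst.
  apply: (@cvg_comp _ _ _ (fun n => v (e n)) (fun x => `|x|)); last exact: norm_continuous.
  have /cvg_at_rightP := v0; apply.
  by split=> //; exact: cvg_harmonic.
apply: ler_cvg_to lim0 lim_f _.
by apply: nearW.
Unshelve. all: by end_near. Qed.

End Kato.

(** * The fragmentation operator *)

Section Scaling.
Context {R : realType}.
Local Notation mu := (@lebesgue_measure R).
Local Open Scope ereal_scope.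

(** The image of Lebesgue measure under $y\mapsto zy$ that appears here, once rescaled by $z$,
    agrees with Lebesgue measure on half-open intervals, hence everywhere. *)
Lemma ge0_integral_scale (f : R -> \bar R) (z : R) : (0 < z)%R ->
  measurable_fun setT f -> (forall x, 0 <= f x) ->
  \int[mu]_x f x = z%:E * \int[mu]_y f (z * y)%R.
Proof.
move=> z0 mf f0.
have mz : measurable_fun setT (fun y : measurableTypeR R => (z * y)%R : measurableTypeR R).
  exact: mulrl_measurable.
pose h : {mfun (measurableTypeR R) >-> (measurableTypeR R)} :=
  HB.pack (fun y : measurableTypeR R => (z * y)%R : measurableTypeR R)
    (isMeasurableFun.Build _ _ _ _ _ mz).
pose nu : {measure set (measurableTypeR R) -> \bar R} := pushforward mu h.
pose nu' : {measure set (measurableTypeR R) -> \bar R} := mscale (NngNum (ltW z0)) (nu mz).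
rewrite (eq_measure_integral nu'); last first.
  move=> A mA _; apply: lebesgue_measure_unique => // _ [[a b]] _ <-.
  change (mu `]a, b]%classic = z%:E * mu ((fun y : R => z * y)%R @^-1` `]a, b]%classic)).
  rewrite (_ : _ @^-1` _ = `](a / z)%R, (b / z)%R]%classic); last first.
    apply/seteqP; split => x/=; rewrite !in_itv/=.
      by rewrite ltr_pdivrMr// ler_pdivlMr// !(mulrC x).
    by rewrite ltr_pdivrMr// ler_pdivlMr// !(mulrC x).
  rewrite !lebesgue_measure_itv/= !lte_fin ltr_pM2r ?invr_gt0//.
  case: ifPn => _; last by rewrite mule0.
  by rewrite -!EFinD -EFinM -mulrBl mulrC divfK// gt_eqF.
rewrite ge0_integral_mscale//=; congr (_ * _).
by rewrite ge0_integral_pushforward.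
Qed.

End Scaling.

(** * The integral formula for $\mathcal F_+$ and its dual action on weights *)

Section Fragmentation.
Context {R : realType} (B : R -> R)
  (wp : {finite_measure set (measurableTypeR R) -> \bar R}).
Local Notation mu := (@lebesgue_measure R).
Implicit Types (f psi : R -> R) (x y z : R).
Hypothesis B_ge0 : forall x : R, 0 < x -> 0 <= B x.
Hypothesis B_cont : forall x : R, 0 < x -> {for x, continuous B}.

Let U : set R := `]0, 1[%classic.
Let mU : measurable U. Proof. exact: measurable_itv. Qed.

Let measurable_B : measurable_fun halfline B.
Proof. exact: continuous_halfline_measurable. Qed.

(** Multiplied by $B(y)$ this is $\mathcal F_+^*\psi(y)$. Extended real values allow nonnegative
    weights whose integral is not yet known to be finite. *)
Definition pushed_weight (psi : R -> R) (y : R) : \bar R :=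
  (\int[wp]_(z in U) (psi (z * y))%:E)%E.

(* The integrand of [Fplus_Cc] extended by 0 to the whole plane, in view of Fubini's theorem;
   [p.2 `^ (-1)] is a form of [p.2^-1] whose measurability is known. *)
Definition fragment_kernel (f : R -> R) (p : R * R) : R :=
  ((fun x => B x * f x) \_ halfline) (p.1 * p.2 `^ (-1)) * (p.2 `^ (-1) * \1_U p.2).

Lemma measurable_fragment_kernel f : measurable_fun halfline f ->
  measurable_fun setT (fragment_kernel f).
Proof.
move=> mf; apply: measurable_funM.
  apply: measurableT_comp.
    apply/(measurable_restrictT _ measurable_halfline).
    exact: measurable_funM.
  apply: measurable_funM; first exact: measurable_fst.
  apply: (measurableT_comp (measurable_powR (-1))); exact: measurable_snd.
apply: measurable_funM.
  apply: (measurableT_comp (measurable_powR (-1))); exact: measurable_snd.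
apply: (measurableT_comp (f := \1_U : R -> R)); [exact: measurable_indic|exact: measurable_snd].
Qed.

Lemma fragment_kernelE f x z : 0 < x -> U z -> fragment_kernel f (x, z) = B (x / z) * f (x / z) / z.
Proof.
move=> x0 Uz; rewrite /fragment_kernel /= indicE mem_set// mulr1.
have z0 : 0 < z by move: Uz; rewrite /U/= in_itv/= => /andP[].
rewrite powR_inv1 ?(ltW z0)// patchE mem_set// halflineE divr_gt0//.
Qed.

Lemma Fplus_CcE f x : 0 < x -> Fplus_Cc B wp f x = \int[wp]_z fragment_kernel f (x, z).
Proof.
move=> x0; rewrite /Fplus_Cc -/U [RHS](@Rintegral_support _ _ _ wp U setT)//.
  by apply: eq_Rintegral => z; rewrite inE => Uz; rewrite fragment_kernelE.
by move=> z _ Uz; rewrite /fragment_kernel /= indicE memNset// mulr0 mulr0.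
Qed.

(** Parametric integrals are measurable by Tonelli's theorem, applied to the positive and the
    negative part of the kernel. *)
Lemma measurable_Fplus_Cc f : measurable_fun halfline f ->
  measurable_fun halfline (Fplus_Cc B wp f).
Proof.
move=> mf.
have mK : measurable_fun setT (EFin \o fragment_kernel f).
  by apply/measurable_EFinP; exact: measurable_fragment_kernel.
apply: (@eq_measurable_fun _ _ _ _ _ (fun x => fine (\int[wp]_z (fragment_kernel f (x, z))%:E)%E)).
  by move=> x; rewrite inE halflineE => x0; rewrite Fplus_CcE.
apply: measurable_funTS; apply: measurableT_comp; first exact: fine_measurable.
rewrite (_ : (fun x => _) = fun x => fubini_F wp ((EFin \o fragment_kernel f)^\+)%E x -
   fubini_F wp ((EFin \o fragment_kernel f)^\-)%E x)%E; last first.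
  apply/funext => x; rewrite /fubini_F [LHS]integralE /=.
  by congr (_ - _)%E; apply: eq_integral => z _; [rewrite !funeposE|rewrite !funenegE].
apply: emeasurable_funB.
  by apply: measurable_fun_fubini_tonelli_F => //; exact: measurable_funepos.
by apply: measurable_fun_fubini_tonelli_F => //; exact: measurable_funeneg.
Qed.

Lemma measurable_scaled (psi : R -> R) y : 0 < y -> measurable_fun halfline psi ->
  measurable_fun U (fun z => psi (z * y)).
Proof.
move=> y0 mpsi; apply: (@eq_measurable_fun _ _ _ _ _ (fun z : R => (psi \_ halfline) (z * y))).
  move=> z; rewrite inE /U/= in_itv/= => /andP[z0 _].
  by rewrite patchE mem_set// halflineE mulr_gt0.
apply: measurable_funTS.
apply: (measurableT_comp (f := psi \_ halfline)); last exact: mulrr_measurable.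
exact/(measurable_restrictT _ measurable_halfline).
Qed.

Lemma measurable_pushed_weight psi : measurable_fun halfline psi ->
  (forall x, 0 < x -> 0 <= psi x) -> measurable_fun halfline (pushed_weight psi).
Proof.
move=> mpsi psi0.
pose L (p : R * R) := ((psi \_ halfline) (p.2 * p.1) * \1_U p.2)%:E.
have mL : measurable_fun setT L.
  apply/measurable_EFinP; apply: measurable_funM.
    apply: measurableT_comp.
      exact/(measurable_restrictT _ measurable_halfline).
    by apply: measurable_funM; [exact: measurable_snd|exact: measurable_fst].
  by apply: (measurableT_comp (f := \1_U : R -> R)); [exact: measurable_indic|exact: measurable_snd].
have L0 p : (0 <= L p)%E.
  rewrite lee_fin mulr_ge0// patchE; case: ifPn => //.
  by rewrite inE halflineE; exact: psi0.
apply: (@eq_measurable_fun _ _ _ _ _ (fubini_F wp L)); last first.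
  by apply: measurable_funTS; exact: measurable_fun_fubini_tonelli_F.
move=> y; rewrite inE halflineE => y0.
rewrite /fubini_F /pushed_weight [RHS]integral_mkcond; apply: eq_integral => z _.
rewrite /L /= [in RHS]patchE; case: ifPn => zU.
  rewrite indicE zU mulr1 patchE mem_set// halflineE mulr_gt0//.
  by move: zU; rewrite inE /U/= in_itv/= => /andP[].
by rewrite indicE (negbTE zU) mulr0.
Qed.

(** Duality $\int|\mathcal F_+f|\psi\le\int|f|\,\mathcal F_+^*\psi$: Tonelli's theorem, then the
    substitution $x=zy$ at fixed $z$, whose Jacobian cancels the factor $1/z$ of the kernel. *)
Lemma Fplus_Cc_weight_le f psi : measurable_fun halfline f ->
  measurable_fun halfline psi -> (forall x, 0 < x -> 0 <= psi x) ->
  (\int[mu]_(x in halfline) (`|Fplus_Cc B wp f x| * psi x)%:E <=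
   \int[mu]_(y in halfline) ((`|f y| * B y)%:E * pushed_weight psi y))%E.
Proof.
move=> mf mpsi psi0.
have mK := measurable_fragment_kernel mf.
have KU x z : ~ U z -> fragment_kernel f (x, z) = 0.
  by move=> Uz; rewrite /fragment_kernel /= indicE memNset// mulr0 mulr0.
have mKx x : measurable_fun setT (fun z => fragment_kernel f (x, z)).
  exact: (measurableT_comp mK (pair1_measurable x)).
have mpsiT : measurable_fun setT (psi \_ halfline).
  exact/(measurable_restrictT _ measurable_halfline).
have psiT0 x : 0 <= (psi \_ halfline) x.
  by rewrite patchE; case: ifPn => //; rewrite inE halflineE; exact: psi0.
pose K (p : R * R) : \bar R := (`|fragment_kernel f p| * (psi \_ halfline) p.1)%:E.
have mK' : measurable_fun setT K.
  apply/measurable_EFinP; apply: measurable_funM; first exact: measurableT_comp.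
  by apply: measurableT_comp => //; exact: measurable_fst.
have K0 p : (0 <= K p)%E by rewrite lee_fin mulr_ge0.
have step1 : (\int[mu]_(x in halfline) (`|Fplus_Cc B wp f x| * psi x)%:E <=
    \int[mu]_(x in halfline) \int[wp]_z K (x, z))%E.
  apply: ge0_le_integral => //.
  - exact: measurable_halfline.
  - by move=> x; rewrite halflineE => x0; rewrite lee_fin mulr_ge0// psi0.
  - apply/measurable_EFinP; apply: measurable_funM => //.
    by apply: measurableT_comp => //; exact: measurable_Fplus_Cc.
  - by apply: measurable_funTS; exact: (measurable_fun_fubini_tonelli_F (m2 := wp) K mK' K0).
  - move=> x; rewrite halflineE => x0.
    rewrite /K /= patchE mem_set ?halflineE//.
    under eq_integral do rewrite mulrC EFinM.
    rewrite ge0_integralZl_EFin//; last 2 first.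
    + by apply/measurable_EFinP; apply: measurableT_comp => //; exact: mKx.
    + exact: psi0.
    rewrite mulrC EFinM lee_wpmul2l ?lee_fin ?psi0// Fplus_CcE//.
    apply: (@le_trans _ _ `|\int[wp]_z (fragment_kernel f (x, z))%:E|%E); last first.
      apply: (@le_abse_integral _ _ _ wp _ (fun z => (fragment_kernel f (x, z))%:E)) => //.
      by apply/measurable_EFinP; exact: mKx.
    (* [fine] sends an infinite integral to 0, and the bound is then trivial. *)
    rewrite /Rintegral; case: (\int[wp]_z (fragment_kernel f (x, z))%:E)%E => [r||]//=.
      by rewrite normr0 leey.
    by rewrite normr0 leey.
apply: (le_trans step1).
rewrite (_ : (\int[mu]_(x in halfline) \int[wp]_z K (x, z) = \int[mu]_x \int[wp]_z K (x, z))%E); last first.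
  rewrite integral_mkcond; apply: eq_integral => x _; rewrite patchE.
  case: ifPn => // xH; rewrite integral0_eq// => z _.
  by rewrite /K /= patchE (negbTE xH) mulr0.
rewrite (fubini_tonelli (m1 := mu) (m2 := wp) K mK' K0).
pose L (p : R * R) : \bar R := (`|((fun x => B x * f x) \_ halfline) p.1| *
  (psi \_ halfline) (p.2 * p.1) * \1_U p.2)%:E.
have mL : measurable_fun setT L.
  apply/measurable_EFinP; apply: measurable_funM; last first.
    by apply: (measurableT_comp (f := \1_U : R -> R)); [exact: measurable_indic|exact: measurable_snd].
  apply: measurable_funM.
    apply: measurableT_comp => //.
    apply: measurableT_comp; last exact: measurable_fst.
    by apply/(measurable_restrictT _ measurable_halfline); exact: measurable_funM.
  by apply: measurableT_comp => //; apply: measurable_funM; [exact: measurable_snd|exact: measurable_fst].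
have L0 p : (0 <= L p)%E by rewrite lee_fin !mulr_ge0.
rewrite (_ : (\int[wp]_z \int[mu]_x K (x, z) = \int[wp]_z \int[mu]_x L (x, z))%E); last first.
  apply: eq_integral => z _; have [zU|zU] := boolP (z \in U); last first.
    rewrite !integral0_eq// => x _.
      by rewrite /L /= indicE (negbTE zU) mulr0.
    by rewrite /K /= KU ?normr0 ?mul0r//; move=> Uz; rewrite mem_set in zU.
  have z0 : 0 < z by move: zU; rewrite inE /U/= in_itv/= => /andP[].
  rewrite (ge0_integral_scale z0); last 2 first.
  - exact: (measurableT_comp mK' (pair2_measurable z)).
  - by [].
  rewrite -ge0_integralZl_EFin//; last 2 first.
  - apply: (measurableT_comp (measurableT_comp mK' (pair2_measurable z))).
    exact: mulrl_measurable.
  - exact: ltW.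
  apply: eq_integral => y _.
  rewrite /K /L /= /fragment_kernel /= indicE zU mulr1 powR_inv1 ?(ltW z0)//.
  rewrite [z * y]mulrC mulfK ?gt_eqF// normrM mulr1 -EFinM; congr EFin.
  rewrite (@ger0_norm _ z^-1) ?invr_ge0 ?(ltW z0)//.
  by rewrite mulrA [z * (_ / _)]mulrC divfK ?gt_eqF.
rewrite -(fubini_tonelli (m1 := mu) (m2 := wp) L mL L0).
rewrite [leRHS]integral_mkcond le_eqVlt; apply/orP; left; apply/eqP.
apply: eq_integral => y _; rewrite patchE; case: ifPn => yH; last first.
  rewrite integral0_eq// => z _.
  by rewrite /L /= patchE (negbTE yH) normr0 !mul0r.
have y0 : 0 < y by rewrite -halflineE -inE.
rewrite /pushed_weight [X in (_ * X)%E]integral_mkcond.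
rewrite -ge0_integralZl_EFin//; last 3 first.
- by move=> z _; rewrite erestrict_ge0// => {}z; rewrite /U/= in_itv/= => /andP[z0 _]; rewrite lee_fin psi0// mulr_gt0.
- by apply/(measurable_restrictT _ mU)/measurable_EFinP; exact: measurable_scaled.
- by rewrite mulr_ge0// B_ge0.
apply: eq_integral => z _; rewrite /L /= [X in (_ * X)%E]patchE.
have [zU|zU] := boolP (z \in U); last by rewrite indicE (negbTE zU) mulr0 mule0.
have z0 : 0 < z by move: zU; rewrite inE /U/= in_itv/= => /andP[].
rewrite !patchE yH mem_set ?halflineE ?mulr_gt0// indicE zU mulr1 -EFinM.
by rewrite normrM (ger0_norm (B_ge0 y0)) [B y * _]mulrC.
Qed.

End Fragmentation.

(** * Weighted bounds for the extension of $\mathcal F_+$ *)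

Section FplusBound.
Context {R : realType} (B : R -> R)
  (wp : {finite_measure set (measurableTypeR R) -> \bar R}).
Local Notation mu := (@lebesgue_measure R).
Implicit Types (f g psi q : R -> R) (x y z : R).
Hypothesis B_ge0 : forall x : R, 0 < x -> 0 <= B x.
Hypothesis B_cont : forall x : R, 0 < x -> {for x, continuous B}.

Let U : set R := `]0, 1[%classic.
Let mU : measurable U. Proof. exact: measurable_itv. Qed.
Let mH := @measurable_halfline R.

Let mabsM f g : measurable_fun halfline f -> measurable_fun halfline g ->
  measurable_fun halfline (fun x => (`|f x| * g x)%:E).
Proof.
by move=> mf mg; apply/measurable_EFinP; apply: measurable_funM => //; exact: measurableT_comp.
Qed.

Lemma ge0_integral_halfline_le (h : R -> \bar R) (C : \bar R) : measurable_fun halfline h ->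
  (forall x, 0 < x -> (0 <= h x)%E) ->
  (forall n : nat, (\int[mu]_(x in (`]0%R, n%:R] : set R)) h x <= C)%E) ->
  (\int[mu]_(x in halfline) h x <= C)%E.
Proof.
move=> mh h0 hC.
have FE : (halfline : set R) = \bigcup_n `]0, n%:R]%classic.
  apply/seteqP; split => x.
    rewrite halflineE => x0; exists (Num.truncn x).+1 => //=.
    by rewrite in_itv/= x0/= ltW// truncnS_gt.
  by move=> [n _]; rewrite halflineE/= in_itv/= => /andP[].
have FH n : `]0, n%:R]%classic `<=` (halfline : set R).
  by move=> x; rewrite halflineE/= in_itv/= => /andP[].
have cvgh : (\int[mu]_(x in `]0%R, n%:R]) h x @[n --> \oo] --> \int[mu]_(x in halfline) h x)%E.
  rewrite FE; apply: ge0_nondecreasing_set_cvg_integral.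
  - apply/nondecreasing_seqP => n; rewrite subsetEset; apply: subset_itv => //.
    by rewrite bnd_simp ler_nat.
  - by move=> n; exact: measurable_itv.
  - by move=> n; apply: measurable_funS mh.
  - by move=> n x /FH; rewrite halflineE; exact: h0.
apply: (cvge_to_le cvgh).
by apply: nearW => n; exact: hC.
Qed.

Lemma weight_gt0 (a x : R) : 0 < x -> 0 < weight a x.
Proof. by move=> x0; rewrite powR_gt0// ltr_wpDl. Qed.

Lemma measurable_weight (a : R) : measurable_fun halfline (weight a).
Proof.
apply: measurable_funTS; apply: (measurableT_comp (measurable_powR a)).
by apply: measurable_funD.
Qed.

(** For $a\ge0$ the weight is nondecreasing; for $a<0$ one uses $1+zx\ge z(1+x)$. Both signs occur,
    since $\underline\alpha$ may be negative. *)
Lemma weight_scale_le (a z x : R) : 0 < z < 1 -> 0 < x ->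
  weight a (z * x) <= (1 + z `^ a) * weight a x.
Proof.
move=> /andP[z0 z1] x0; rewrite /weight mulrDl mul1r.
have zx0 : 0 < z * x by rewrite mulr_gt0.
have [a0|a0] := leP 0 a.
  rewrite (@le_trans _ _ ((1 + x) `^ a))//; last by rewrite lerDl mulr_ge0 ?powR_ge0.
  rewrite ge0_ler_powR ?nnegrE ?addr_ge0 ?(ltW x0) ?(ltW zx0)//.
  by rewrite lerD2l ler_piMl ?(ltW x0)// ltW.
rewrite (@le_trans _ _ (z `^ a * (1 + x) `^ a))//; last by rewrite lerDr powR_ge0.
rewrite -powRM ?(ltW z0) ?addr_ge0 ?(ltW x0)//.
rewrite -[a]opprK [leLHS]powRN [leRHS]powRN lef_pV2 ?posrE ?powR_gt0//; last 2 first.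
- by rewrite ltr_wpDl.
- by rewrite mulr_gt0// ltr_wpDl.
rewrite ge0_ler_powR ?nnegrE ?oppr_ge0 ?(ltW a0)//.
- by rewrite mulr_ge0 ?(ltW z0)// addr_ge0// ltW.
- by rewrite addr_ge0// ltW.
- by rewrite mulrDr mulr1 lerD2r ltW.
Qed.

Lemma powR_le1_anti (z a b : R) : 0 < z -> z < 1 -> b < a -> z `^ a <= z `^ b.
Proof.
move=> z0 z1 ba; rewrite -[a](subrK b) powRD; last by rewrite (gt_eqF z0) implybT.
rewrite ler_piMl ?powR_ge0// (@le_trans _ _ (1 `^ (a - b)))//; last by rewrite powR1.
by rewrite ge0_ler_powR ?nnegrE ?subr_ge0 ?(ltW ba) ?(ltW z0) ?(ltW z1).
Qed.

Lemma wp_moment_fin (a : R) : (alpha_inf wp < a%:E)%E -> (wp_moment wp a < +oo)%E.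
Proof.
move=> /ereal_inf_lt[_ [b /= hb <-]]; rewrite lte_fin => ba.
apply: le_lt_trans hb; apply: ge0_le_integral => //.
- by move=> z _; rewrite lee_fin powR_ge0.
- by apply/measurable_EFinP; apply: measurable_funTS; exact: measurable_powR.
- by apply/measurable_EFinP; apply: measurable_funTS; exact: measurable_powR.
- move=> z /=; rewrite in_itv/= => /andP[z0 z1]; rewrite lee_fin.
  exact: powR_le1_anti.
Qed.

Lemma pushed_weight_le (a C : R) psi : (alpha_inf wp < a%:E)%E -> 0 <= C ->
  measurable_fun halfline psi ->
  (forall x, 0 < x -> 0 <= psi x <= C * weight a x) ->
  exists2 K : R, 0 <= K & forall y, 0 < y -> (pushed_weight wp psi y <= (K * weight a y)%:E)%E.
Proof.
move=> ha C0 mpsi psiC.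
have mf := wp_moment_fin ha.
have [m m0 hm] : exists2 m : R, 0 <= m & wp_moment wp a = m%:E.
  exists (fine (wp_moment wp a)).
    by apply: fine_ge0; apply: integral_ge0 => z _; rewrite lee_fin powR_ge0.
  rewrite fineK// ge0_fin_numE//.
  by apply: integral_ge0 => z _; rewrite lee_fin powR_ge0.
have [w w0 hw] : exists2 w : R, 0 <= w & wp U = w%:E.
  by exists (fine (wp U)); [exact: fine_ge0|rewrite fineK// fin_num_measure].
exists (C * (w + m)); first by rewrite mulr_ge0// addr_ge0.
move=> y y0.
have Cw0 : 0 <= C * weight a y by rewrite mulr_ge0// ltW// weight_gt0.
apply: (@le_trans _ _ (\int[wp]_(z in U) ((C * weight a y)%:E * (1%:E + (z `^ a)%:E)))%E).
  apply: ge0_le_integral => //.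
  - move=> z; rewrite /U/= in_itv/= => /andP[z0 z1]; rewrite lee_fin.
    by have /andP[] := psiC _ (mulr_gt0 z0 y0).
  - by apply/measurable_EFinP; exact: measurable_scaled.
  - apply/measurable_EFinP; apply: measurable_funM => //.
    by apply: measurable_funD => //; apply: measurable_funTS; exact: measurable_powR.
  - move=> z; rewrite /U/= in_itv/= => zU; have /andP[z0 z1] := zU.
    rewrite -EFinD -EFinM lee_fin; have /andP[_ h] := psiC _ (mulr_gt0 z0 y0).
    rewrite (le_trans h)// -mulrA ler_wpM2l//; have := @weight_scale_le a z y zU y0.
    by rewrite [_ * weight a y]mulrC.
rewrite ge0_integralZl_EFin//; last 2 first.
- by move=> z _; rewrite -EFinD lee_fin addr_ge0// powR_ge0.
- apply/measurable_EFinP.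
  by apply: measurable_funD => //; apply: measurable_funTS; exact: measurable_powR.
rewrite ge0_integralD//; last 2 first.
- by move=> z _; rewrite lee_fin powR_ge0.
- by apply/measurable_EFinP; apply: measurable_funTS; exact: measurable_powR.
rewrite integral_cst// mul1e.
rewrite [X in (_ + X)%E](_ : _ = m%:E) ?[X in (X + _)%E](_ : _ = w%:E)//.
by rewrite -EFinD -EFinM lee_fin mulrAC.
Qed.

Lemma L1_measurable (w f : R -> R) : measurable_fun halfline w ->
  (forall x, 0 < x -> 0 < w x) -> L1 w f -> measurable_fun halfline f.
Proof.
move=> mw w0 /(measurable_int mu)/measurable_EFinP mfw.
apply: (@eq_measurable_fun _ _ _ _ _ (fun x => f x * w x * w x `^ (-1))).
  move=> x; rewrite inE halflineE => x0.
  by rewrite powR_inv1 ?mulfK ?gt_eqF ?w0// ltW ?w0.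
by apply: measurable_funM => //; apply: (measurableT_comp (measurable_powR (-1))).
Qed.

Lemma Cc_measurable f : Cc f -> measurable_fun halfline f.
Proof. by move=> [cf _]; exact: continuous_halfline_measurable. Qed.

Lemma pushed_weight_mono psi1 psi2 y : 0 < y -> measurable_fun halfline psi1 ->
  measurable_fun halfline psi2 -> (forall x, 0 < x -> 0 <= psi1 x <= psi2 x) ->
  (pushed_weight wp psi1 y <= pushed_weight wp psi2 y)%E.
Proof.
move=> y0 m1 m2 h12.
have mp psi : measurable_fun halfline psi -> measurable_fun U (fun z => (psi (z * y))%:E).
  by move=> mpsi; apply/measurable_EFinP; exact: measurable_scaled.
apply: ge0_le_integral => //; [|exact: mp|exact: mp|].
- move=> z; rewrite /U/= in_itv/= => /andP[z0 _]; rewrite lee_fin.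
  by have /andP[] := h12 _ (mulr_gt0 z0 y0).
- move=> z; rewrite /U/= in_itv/= => /andP[z0 _]; rewrite lee_fin.
  by have /andP[] := h12 _ (mulr_gt0 z0 y0).
Qed.

(** On $(0,m]$ linear growth is dominated by any power weight; the term $(1+m)^{-a}$ takes care of
    negative exponents. *)
Lemma cut_weight_le (a A m x : R) : 0 <= A -> 0 < x -> x <= m ->
  A * (1 + x) <= A * ((1 + m) * (1 + (1 + m) `^ (- a))) * weight a x.
Proof.
move=> A0 x0 xm; rewrite -mulrA ler_wpM2l//.
have m0 := lt_le_trans x0 xm.
have x1 : 0 < 1 + x by rewrite ltr_wpDl.
have m1 : 0 < 1 + m by rewrite ltr_wpDl.
suff h : 1 <= (1 + (1 + m) `^ (- a)) * weight a x.
  rewrite -mulrA (@le_trans _ _ ((1 + m) * 1))//; first by rewrite mulr1 lerD2l.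
  by rewrite ler_wpM2l// ltW.
rewrite mulrDl mul1r /weight; have [a0|a0] := leP 0 a.
  rewrite (@le_trans _ _ ((1 + x) `^ a))//; last by rewrite lerDl mulr_ge0 ?powR_ge0.
  by rewrite -[leLHS](powRr0 (1 + x)) ler_powR// lerDl ltW.
rewrite (@le_trans _ _ ((1 + m) `^ (- a) * (1 + x) `^ a))//; last by rewrite lerDr powR_ge0.
rewrite -[X in _ * _ `^ X]opprK [X in _ * X]powRN ler_pdivlMr ?powR_gt0// mul1r.
by rewrite ge0_ler_powR ?nnegrE ?oppr_ge0 ?(ltW a0) ?(ltW x1) ?(ltW m1)// lerD2l.
Qed.

(* The approximating sequence of [Fplus] only converges in a possibly weaker weight, which
   dominates [psi] on bounded sets; hence the cut-off at [m]. *)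
Lemma Fplus_weight_le f g psi q (A : R) : Fplus B wp f g -> 0 <= A ->
  measurable_fun halfline psi -> (forall x, 0 < x -> 0 <= psi x <= A * (1 + x)) ->
  measurable_fun halfline q -> (forall x, 0 < x -> 0 <= q x) ->
  (forall y, 0 < y -> ((B y)%:E * pushed_weight wp psi y <= (q y)%:E)%E) ->
  (\int[mu]_(x in halfline) (`|g x| * psi x)%:E <=
   \int[mu]_(x in halfline) (`|f x| * q x)%:E)%E.
Proof.
move=> [a [ha fL gL [f_ [fC cvf cvg_]]]] A0 mpsi psiA mq q0 hq.
have mB : measurable_fun halfline B by exact: continuous_halfline_measurable.
have mwa := measurable_weight a.
have wa0 x : 0 < x -> 0 < weight a x by exact: weight_gt0.
have mFw : measurable_fun halfline (Fplus_weight B a).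
  by apply: measurable_funM => //; exact: measurable_funD.
have Fw0 x : 0 < x -> 0 < Fplus_weight B a x.
  by move=> x0; rewrite mulr_gt0 ?wa0// ltr_wpDr// B_ge0.
have mf := L1_measurable mFw Fw0 fL.
have mg := L1_measurable mwa wa0 gL.
have mf_ n := Cc_measurable (fC n).
have mF_ n := measurable_Fplus_Cc wp B_cont (mf_ n).
set X := (\int[mu]_(x in halfline) (`|f x| * q x)%:E)%E.
have X0 : (0 <= X)%E.
  by apply: integral_ge0 => x; rewrite halflineE => x0; rewrite lee_fin mulr_ge0// q0.
apply: ge0_integral_halfline_le.
- by exact: mabsM.
- by move=> x x0; rewrite lee_fin mulr_ge0//; case/andP: (psiA _ x0).
move=> m; have [->|Xy] := eqVneq X +oo%E; first by rewrite leey.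
pose D : set R := `]0, m%:R]%classic.
have DH : D `<=` halfline by move=> x; rewrite halflineE /D/= in_itv/= => /andP[].
have mD : measurable D by exact: measurable_itv.
pose psim x := psi x * \1_D x.
have mpsim : measurable_fun halfline psim.
  by apply: measurable_funM => //; exact: measurable_indic.
have psim_le x : 0 < x -> 0 <= psim x <= psi x.
  move=> x0; have /andP[p0 _] := psiA _ x0.
  by rewrite /psim indicE; case: (x \in D); rewrite ?mulr1 ?mulr0 ?lexx p0.
have [C C0 psimC] : exists2 C : R, 0 <= C & forall x, 0 < x -> 0 <= psim x <= C * weight a x.
  exists (A * ((1 + m%:R) * (1 + (1 + m%:R) `^ (- a)))).
    by rewrite !mulr_ge0// addr_ge0// powR_ge0.
  move=> x x0; have /andP[-> /= _] := psim_le x x0; have /andP[p0 pA] := psiA _ x0.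
  rewrite /psim indicE; have [xD|xD] := boolP (x \in D); last first.
    by rewrite mulr0 !mulr_ge0 ?addr_ge0 ?powR_ge0.
  rewrite mulr1 (le_trans pA)// cut_weight_le//.
  by move: xD; rewrite inE /D/= in_itv/= => /andP[].
have [K K0 hK] := pushed_weight_le ha C0 mpsim psimC.
pose E1 n := L1norm (Fplus_weight B a) (f_ n \- f).
pose E2 n := L1norm (weight a) (Fplus_Cc B wp (f_ n) \- g).
(* Two bounds on the pushed cut-off weight are used: [q] along [f], which does not depend on the
   cut-off, and [K * weight a] along the error [f_ n - f], which tends to 0 in the corresponding
   norm. *)
have main n : (\int[mu]_(x in D) (`|g x| * psi x)%:E <= X + (K%:E * E1 n + C%:E * E2 n))%E.
  have mE1 : measurable_fun halfline (fun x => `|((f_ n \- f) x * Fplus_weight B a x)%:E|%E).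
    apply: measurableT_comp => //; apply/measurable_EFinP; apply: measurable_funM => //.
    exact: measurable_funB.
  have mE2 : measurable_fun halfline
      (fun x => `|((Fplus_Cc B wp (f_ n) \- g) x * weight a x)%:E|%E).
    apply: measurableT_comp => //; apply/measurable_EFinP; apply: measurable_funM => //.
    exact: measurable_funB.
  apply: (@le_trans _ _ (\int[mu]_(x in halfline) (`|g x| * psim x)%:E)%E).
    have -> : (\int[mu]_(x in D) (`|g x| * psi x)%:E = \int[mu]_(x in D) (`|g x| * psim x)%:E)%E.
      by apply: eq_integral => x xD; rewrite /psim indicE xD mulr1.
    apply: ge0_subset_integral => //.
      exact: mabsM.
    by move=> x; rewrite halflineE => x0; rewrite lee_fin mulr_ge0//; case/andP: (psim_le _ x0).
  apply: (@le_trans _ _ (\int[mu]_(x in halfline) ((`|Fplus_Cc B wp (f_ n) x| * psim x)%:E +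
      C%:E * `|((Fplus_Cc B wp (f_ n) \- g) x * weight a x)%:E|))%E).
    apply: ge0_le_integral; [exact: mH| | | |].
    - by move=> x; rewrite halflineE => x0; rewrite lee_fin mulr_ge0//; case/andP: (psim_le _ x0).
    - by exact: mabsM.
    - apply: emeasurable_funD; last exact: measurable_funeM.
      by exact: mabsM.
    - move=> x; rewrite halflineE => x0; rewrite /= -EFinM -EFinD lee_fin.
      have /andP[p0 pC] := psimC _ x0; set F := Fplus_Cc B wp (f_ n) x.
      have tri : `|g x| <= `|F| + `|F - g x|.
        by rewrite -{1}[g x](subKr F) (le_trans (ler_normB _ _)).
      rewrite (le_trans (ler_wpM2r p0 tri))// mulrDl lerD2l normrM.
      rewrite (gtr0_norm (wa0 _ x0)) [leRHS]mulrCA; exact: ler_wpM2l.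
  rewrite ge0_integralD; [|exact: mH| | | |]; last 4 first.
  - by move=> x; rewrite halflineE => x0; rewrite lee_fin mulr_ge0//; case/andP: (psim_le _ x0).
  - by exact: mabsM.
  - by move=> x _; rewrite mule_ge0// ?lee_fin.
  - exact: measurable_funeM.
  rewrite ge0_integralZl_EFin//.
  rewrite addeA leeD2r//.
  apply: (le_trans (Fplus_Cc_weight_le wp B_ge0 B_cont (mf_ n) mpsim _)).
    by move=> x x0; case/andP: (psim_le _ x0).
  apply: (@le_trans _ _ (\int[mu]_(x in halfline) ((`|f x| * q x)%:E +
      K%:E * `|((f_ n \- f) x * Fplus_weight B a x)%:E|))%E).
    apply: ge0_le_integral; [exact: mH| | | |].
    - move=> x; rewrite halflineE => x0; apply: mule_ge0; first by rewrite lee_fin mulr_ge0// B_ge0.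
      apply: integral_ge0 => z; rewrite /= in_itv/= => /andP[z0 _]; rewrite lee_fin.
      by case/andP: (psim_le _ (mulr_gt0 z0 x0)).
    - apply: emeasurable_funM.
        exact: mabsM.
      by apply: measurable_pushed_weight => // x x0; case/andP: (psim_le _ x0).
    - apply: emeasurable_funD; last exact: measurable_funeM.
      by exact: mabsM.
    - move=> x; rewrite halflineE => x0.
      have P0 : (0 <= pushed_weight wp psim x)%E.
        apply: integral_ge0 => z; rewrite /= in_itv/= => /andP[z0 _]; rewrite lee_fin.
        by case/andP: (psim_le _ (mulr_gt0 z0 x0)).
      have PK := hK _ x0.
      have Pq : ((B x)%:E * pushed_weight wp psim x <= (q x)%:E)%E.
        apply: le_trans (hq _ x0); rewrite lee_wpmul2l ?lee_fin ?B_ge0//.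
        exact: pushed_weight_mono.
      have Pfin : pushed_weight wp psim x \is a fin_num.
        by rewrite ge0_fin_numE// (le_lt_trans PK)// ltry.
      move: P0 PK Pq; rewrite -(fineK Pfin); set P := fine _.
      rewrite -!EFinM -EFinD !lee_fin => P0 PK Pq.
      rewrite normrM (gtr0_norm (Fw0 _ x0)) /Fplus_weight.
      have B0 := B_ge0 x0.
      have tri : `|f_ n x| <= `|f x| + `|f_ n x - f x|.
        by rewrite -{1}[f_ n x](subrK (f x)) addrC (le_trans (ler_normD _ _)).
      rewrite -mulrA (le_trans (ler_wpM2r (mulr_ge0 B0 P0) tri))// mulrDl lerD//.
        by rewrite ler_wpM2l.
      rewrite [leRHS]mulrCA; apply: ler_wpM2l => //.
      rewrite (@le_trans _ _ (B x * (K * weight a x)))//; first exact: ler_wpM2l.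
      rewrite mulrCA ler_wpM2l// ler_wpM2r//; last by rewrite lerDr.
      by rewrite ltW// wa0.
  rewrite ge0_integralD; [|exact: mH| | | |]; last 4 first.
  - by move=> x; rewrite halflineE => x0; rewrite lee_fin mulr_ge0// q0.
  - by exact: mabsM.
  - by move=> x _; rewrite mule_ge0// ?lee_fin.
  - exact: measurable_funeM.
  by rewrite ge0_integralZl_EFin//; exact: mH.
have cvgX : (X + (K%:E * E1 n + C%:E * E2 n) @[n --> \oo] --> X)%E.
  rewrite -[X in _ --> X]adde0; apply: cvgeD => //; [|exact: cvg_cst|].
    by rewrite fin_num_adde_defl.
  rewrite -[X in _ --> X]adde0; apply: cvgeD => //.
    by rewrite -(mule0 K%:E); apply: cvgeZl.
  by rewrite -(mule0 C%:E); apply: cvgeZl.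
apply: (cvge_to_ge cvgX); exact: nearW.
Qed.

End FplusBound.

(** * Truncated powers *)

Section TruncatedPower.
Context {R : realType}.
Implicit Types (N p x y z : R).
Local Notation mu := (@lebesgue_measure R).

(* [trunc_power N p] increases to [x `^ (1 + p)] as N grows, but is at most linear in x, hence
   integrable against any f in L^1(phi). *)
Definition trunc_id N x : R := x / (1 + x / N).
Definition trunc_power N p x : R := x * trunc_id N x `^ p.

Section fixed_N.
Variables (N p : R).
Hypotheses (N0 : 0 < N) (p0 : 0 < p).

Let den_gt0 x : 0 < x -> 0 < 1 + x / N.
Proof. by move=> x0; rewrite ltr_wpDr// ltW// divr_gt0. Qed.

Lemma trunc_id_gt0 x : 0 < x -> 0 < trunc_id N x.
Proof. by move=> x0; rewrite divr_gt0// den_gt0. Qed.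

Lemma trunc_id_le x : 0 < x -> trunc_id N x <= x.
Proof.
move=> x0; rewrite ler_pdivrMr ?den_gt0// ler_peMr ?(ltW x0)//.
by rewrite lerDl ltW// divr_gt0.
Qed.

Lemma trunc_id_leN x : 0 < x -> trunc_id N x <= N.
Proof.
move=> x0; rewrite ler_pdivrMr ?den_gt0// mulrDr mulr1 mulrCA divff ?gt_eqF// mulr1.
by rewrite lerDr ltW.
Qed.

Lemma trunc_id_ge_half x : 0 < x -> x <= N -> x / 2 <= trunc_id N x.
Proof.
move=> x0 xN; rewrite ler_pM2l// lef_pV2 ?posrE ?den_gt0//.
have : x / N <= 1 by rewrite ler_pdivrMr// mul1r.
by lra.
Qed.

Lemma trunc_id_ge_halfN x : N <= x -> N / 2 <= trunc_id N x.
Proof.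
move=> Nx; have x0 := lt_le_trans N0 Nx.
rewrite ler_pdivlMr ?den_gt0// mulrDr mulr1.
have -> : N / 2 * (x / N) = x / 2 by field; rewrite gt_eqF.
by lra.
Qed.

Lemma trunc_id_homo x y : 0 < x -> x <= y -> trunc_id N x <= trunc_id N y.
Proof.
move=> x0 xy; have y0 := lt_le_trans x0 xy.
rewrite ler_pdivlMr ?den_gt0// mulrAC ler_pdivrMr ?den_gt0//.
by rewrite !mulrDr !mulr1 [y * (x / N)]mulrCA lerD2r.
Qed.

(** With $s=x/N$, the ratio of [trunc_id] at $zx$ and at $x$ is $z(1+s)/(1+zs)$, which increases
    with $s$; the condition $x\le N$ means $s\le1$, and $s=1$ gives the constant. *)
Lemma trunc_id_scale z x : 0 < z < 1 -> 0 < x -> x <= N ->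
  trunc_id N (z * x) <= 2 * z / (1 + z) * trunc_id N x.
Proof.
move=> /andP[z0 z1] x0 xN; have zx0 := mulr_gt0 z0 x0.
have s0 : 0 < x / N by rewrite divr_gt0.
have s1 : x / N <= 1 by rewrite ler_pdivrMr// mul1r.
rewrite /trunc_id -(mulrA z x N^-1) -(mulrA z x (_^-1)) mulrA; set s := x / N.
have d1 : 0 < 1 + z * s by rewrite ltr_wpDr// mulr_ge0 ?ltW.
have d2 : 0 < 1 + s by rewrite ltr_wpDr// ltW.
have d3 : 0 < 1 + z by rewrite ltr_wpDr// ltW.
rewrite -subr_ge0.
have -> : 2 * z / (1 + z) * (x / (1 + s)) - z * x / (1 + z * s) =
   z * x * ((1 - s) * (1 - z)) / ((1 + z) * (1 + s) * (1 + z * s)).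
  by field; rewrite !gt_eqF.
have d4 : 0 <= 1 - s by rewrite subr_ge0.
have d5 : 0 <= 1 - z by rewrite subr_ge0 ltW.
apply: divr_ge0; first by rewrite mulr_ge0 ?mulr_ge0// ltW.
by rewrite ltW// !mulr_gt0.
Qed.

Lemma trunc_power_ge0 x : 0 < x -> 0 <= trunc_power N p x.
Proof. by move=> x0; rewrite mulr_ge0 ?powR_ge0// ltW. Qed.

Lemma trunc_power_leN x : 0 < x -> trunc_power N p x <= N `^ p * x.
Proof.
move=> x0; rewrite [leRHS]mulrC ler_wpM2l ?(ltW x0)//.
have r0 := ltW (trunc_id_gt0 x0).
by rewrite ge0_ler_powR ?nnegrE ?(ltW p0) ?(ltW N0)//; exact: trunc_id_leN.
Qed.

Lemma trunc_power_le x : 0 < x -> trunc_power N p x <= x `^ (1 + p).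
Proof.
move=> x0; rewrite powRD ?(gt_eqF x0) ?implybT// powRr1 ?(ltW x0)// ler_wpM2l ?(ltW x0)//.
have r0 := ltW (trunc_id_gt0 x0).
by rewrite ge0_ler_powR ?nnegrE ?(ltW p0) ?(ltW x0)//; exact: trunc_id_le.
Qed.

Lemma is_derive_trunc_power x : 0 < x ->
  is_derive x 1 (trunc_power N p) (trunc_id N x `^ p * (1 + p / (1 + x / N))).
Proof.
move=> x0; have d0 := den_gt0 x0.
have dden : is_derive x 1 (fun y : R => 1 + y / N) N^-1.
  have := is_derive_affine N^-1 1 x; rewrite (_ : (fun y : R => N^-1 * y + 1) = fun y : R => 1 + y / N)//.
  by apply/funext => y; rewrite addrC mulrC.
have dinv : is_derive x 1 (fun y : R => (1 + y / N)^-1) (- (1 + x / N) ^- 2 * N^-1).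
  by apply: (@is_deriveV R (fun y : R => 1 + y / N)); rewrite ?gt_eqF.
have did : is_derive x 1 (trunc_id N) ((1 + x / N) ^- 2).
  apply: (is_derive_eq (is_derive_mulfun (is_derive_id x 1) dinv)); field.
  by rewrite !gt_eqF ?addr_gt0.
have dpow : is_derive x 1 (fun y => trunc_id N y `^ p)
   (p * trunc_id N x `^ (p - 1) * (1 + x / N) ^- 2).
  apply: (is_derive_compfun (f := fun y : R => y `^ p) (g := trunc_id N)) => //.
  by apply: is_derive1_powR; exact: trunc_id_gt0.
apply: (is_derive_eq (is_derive_mulfun (is_derive_id x 1) dpow)) => /=.
have r0 := trunc_id_gt0 x0.
rewrite powRB ?(gt_eqF r0) ?implybT// powRr1 ?(ltW r0)//.
set P := trunc_id N x `^ p; rewrite /trunc_id; field.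
by rewrite !gt_eqF ?addr_gt0.
Qed.

Lemma derive1_trunc_power x : 0 < x ->
  derive1 (trunc_power N p) x = trunc_id N x `^ p * (1 + p / (1 + x / N)).
Proof. by move=> x0; rewrite derive1E; have [_ ->] := is_derive_trunc_power x0. Qed.

Lemma C1_trunc_power : C1 (trunc_power N p).
Proof.
move=> x x0; split; first by have [] := is_derive_trunc_power x0.
have cden (y : R) : {for y, continuous (fun y : R => 1 + y / N)}.
  by apply: cvgD; [exact: cvg_cst|apply: cvgM; [exact: cvg_id|exact: cvg_cst]].
have cid : {for x, continuous (trunc_id N)}.
  apply: cvgM; first exact: cvg_id.
  by apply: cvgV; [rewrite gt_eqF// den_gt0|exact: cden].
have cpow : {for x, continuous (fun y => trunc_id N y `^ p)}.
  apply: (@continuous_comp _ _ _ (trunc_id N) (fun y : R => y `^ p)) => //.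
  by apply: derivable_continuous; have [] := is_derive1_powR p (trunc_id_gt0 x0).
have c : {for x, continuous (fun x => trunc_id N x `^ p * (1 + p / (1 + x / N)))}.
  apply: cvgM => //; apply: cvgD; first exact: cvg_cst.
  apply: cvgM; first exact: cvg_cst.
  by apply: cvgV; [rewrite gt_eqF// den_gt0|exact: cden].
rewrite /prop_for /continuous_at derive1_trunc_power//.
apply: cvg_trans c; apply: near_eq_cvg; near=> y.
by rewrite derive1_trunc_power//; near: y; exact: lt_nbhsr.
Unshelve. all: by end_near. Qed.

(** The logarithmic derivative of [trunc_id] is $1/(x(1+x/N))\le1/x$, whence a factor $1+p$
    independent of $N$. *)
Lemma derive1_trunc_power_bound x : 0 < x ->
  0 <= derive1 (trunc_power N p) x <= (1 + p) * trunc_id N x `^ p.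
Proof.
move=> x0; rewrite derive1_trunc_power//; have d0 := den_gt0 x0.
rewrite mulr_ge0 ?powR_ge0 ?addr_ge0 ?divr_ge0 ?(ltW p0) ?(ltW d0)//=.
rewrite mulrC ler_wpM2r ?powR_ge0// lerD2l ler_pdivrMr// ler_peMr ?(ltW p0)//.
by rewrite lerDl ltW// divr_gt0.
Qed.

End fixed_N.
End TruncatedPower.

(** * Weighted norms *)

Local Ltac integrable_tac :=
  repeat first [assumption | exact: measurable_halfline | apply: integrable_subfun | apply: integrable_addfun |
    apply: integrable_scalefun].

Section WeightedNorm.
Context {R : realType}.
Local Notation mu := (@lebesgue_measure R).
Implicit Types (f g w phi : R -> R) (x y t : R).
Let mH := @measurable_halfline R.

Lemma integrable_ae_eq (f g : R -> R) : measurable_fun halfline f -> measurable_fun halfline g ->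
  {ae mu, forall x, halfline x -> f x = g x} ->
  mu.-integrable halfline (EFin \o f) -> mu.-integrable halfline (EFin \o g).
Proof.
move=> mf mg fg /integrableP[_ fi]; apply/integrableP; split; first exact/measurable_EFinP.
rewrite (@ge0_ae_eq_integral _ _ _ mu halfline _ (fun x => `|(EFin \o f) x|%E))//.
- by apply: measurableT_comp => //; exact/measurable_EFinP.
- by apply: measurableT_comp => //; exact/measurable_EFinP.
- by apply: aeS fg => x h Hx /=; rewrite h.
Qed.

Lemma ler_sgM (a b : R) : Num.sg a * b <= `|b|.
Proof.
rewrite (le_trans (ler_norm _))// normrM normr_sg.
by case: (a == 0); rewrite ?mul0r ?mul1r.
Qed.

(** Real counterpart of [L1norm], convenient for linear arithmetic. A divergent integral gives 0 by
    default, so that its value is meaningful only together with integrability, as in [L1normE]. *)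
Definition wnorm (w f : R -> R) : R := \int[mu]_(x in halfline) (`|f x| * w x).

Lemma L1_integrable (w f : R -> R) (C : R) (psi : R -> R) : measurable_fun halfline psi ->
  measurable_fun halfline w -> (forall x, 0 < x -> 0 < w x) ->
  (forall x, 0 < x -> `|psi x| <= C * w x) -> L1 w f ->
  mu.-integrable halfline (EFin \o (fun x => f x * psi x)).
Proof.
move=> mpsi mw w0 psiC wf; have mf := L1_measurable mw w0 wf.
apply: (@le_integrable_real _ _ _ mu _ _ (fun x => C * `|f x * w x|)) => //.
- exact: measurable_funM.
- move=> x; rewrite halflineE => xgt0; rewrite !normrM mulrCA ler_wpM2l//.
  by rewrite (gtr0_norm (w0 _ xgt0)) psiC.
- by apply: integrable_scalefun => //; exact: (integrable_norm wf).
Qed.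

Lemma L1_integrable_norm (w f : R -> R) (C : R) (psi : R -> R) : measurable_fun halfline psi ->
  measurable_fun halfline w -> (forall x, 0 < x -> 0 < w x) ->
  (forall x, 0 < x -> `|psi x| <= C * w x) -> L1 w f ->
  mu.-integrable halfline (EFin \o (fun x => `|f x| * psi x)).
Proof.
move=> mpsi mw w0 psiC wf; have mf := L1_measurable mw w0 wf.
apply: (@le_integrable_real _ _ _ mu _ _ (fun x => C * `|f x * w x|)) => //.
- by apply: measurable_funM => //; exact: measurableT_comp.
- move=> x; rewrite halflineE => xgt0; rewrite !normrM normr_id mulrCA ler_wpM2l//.
  by rewrite (gtr0_norm (w0 _ xgt0)) psiC.
- by apply: integrable_scalefun => //; exact: (integrable_norm wf).
Qed.

Lemma L1normE (w f : R -> R) : (forall x, 0 < x -> 0 <= w x) -> L1 w f ->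
  L1norm w f = (wnorm w f)%:E.
Proof.
move=> w0 wf; rewrite /L1norm /wnorm /Rintegral fineK.
  apply: eq_integral => x; rewrite inE halflineE => xgt0.
  by rewrite /= normrM (ger0_norm (w0 _ xgt0)).
apply: integrable_fin_num; first exact: mH.
apply: eq_integrable (integrable_abse wf); first exact: mH.
move=> x; rewrite inE halflineE => xgt0.
by rewrite /= normrM (ger0_norm (w0 _ xgt0)).
Qed.

Lemma L1_add (w f g : R -> R) (c : R) : L1 w f -> L1 w g -> L1 w (fun x => c * f x + g x).
Proof.
move=> wf wg.
have : mu.-integrable halfline (EFin \o (fun x => c * (f x * w x) + g x * w x)).
  by integrable_tac.
by apply: eq_integrable => // x _ /=; rewrite mulrDl mulrA.
Qed.

Lemma wnorm_ge0 w f : (forall x, 0 < x -> 0 <= w x) -> 0 <= wnorm w f.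
Proof.
by move=> w0; apply: Rintegral_ge0 => x; rewrite halflineE => xgt0; rewrite mulr_ge0// w0.
Qed.

Lemma L1_sub phi f g : L1 phi f -> L1 phi g -> L1 phi (fun x => f x - g x).
Proof.
move=> Lf Lg; have := L1_add (-1) Lg Lf; congr (L1 _ _); apply/funext => x.
by rewrite mulN1r addrC.
Qed.

Section domination.
Variables (phi w : R -> R) (C : R).
Hypothesis mphi : measurable_fun halfline phi.
Hypothesis phi0 : forall x, 0 < x -> 0 < phi x.
Hypothesis mw : measurable_fun halfline w.
Hypothesis w0 : forall x, 0 < x -> 0 <= w x.
Hypothesis wC : forall x, 0 < x -> w x <= C * phi x.

Let nwC x : 0 < x -> `|w x| <= C * phi x.
Proof. by move=> x0; rewrite ger0_norm ?w0 ?wC. Qed.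

Lemma wnorm_integrable f : L1 phi f -> mu.-integrable halfline (EFin \o (fun x => `|f x| * w x)).
Proof. exact: (L1_integrable_norm mw mphi phi0 nwC). Qed.

Lemma wnorm_le2 f g h (a b : R) : L1 phi f -> L1 phi g -> L1 phi h -> 
  (forall x, `|h x| <= a * `|f x| + b * `|g x|) ->
  wnorm w h <= a * wnorm w f + b * wnorm w g.
Proof.
move=> Lf Lg Lh hab.
have If := wnorm_integrable Lf; have Ig := wnorm_integrable Lg.
rewrite /wnorm -RintegralZl// -RintegralZl// -RintegralD//; last 2 first.
- exact: integrable_scalefun.
- exact: integrable_scalefun.
apply: le_Rintegral => //.
- exact: wnorm_integrable.
- by apply: integrable_addfun => //; exact: integrable_scalefun.
- move=> x; rewrite halflineE => x0; rewrite (le_trans (ler_wpM2r (w0 x0) (hab x)))//.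
  by rewrite mulrDl -!mulrA.
Qed.

Lemma wnorm_ae f g : L1 phi f -> L1 phi g -> eq_ae f g -> wnorm w f = wnorm w g.
Proof.
move=> Lf Lg fg; have mf := L1_measurable mphi phi0 Lf; have mg := L1_measurable mphi phi0 Lg.
apply: Rintegral_ae_eq => //.
- by apply: measurable_funM => //; exact: measurableT_comp.
- by apply: measurable_funM => //; exact: measurableT_comp.
- by apply: aeS fg => x E Hx; rewrite (E Hx).
Qed.

Lemma wnorm_le_phi f : L1 phi f -> wnorm w f <= C * wnorm phi f.
Proof.
move=> Lf; have If : mu.-integrable halfline (EFin \o (fun x => `|f x| * phi x)).
  apply: (@L1_integrable_norm phi f 1) => // x x0.
  by rewrite mul1r gtr0_norm ?phi0.
rewrite /wnorm -RintegralZl//; apply: le_Rintegral => //.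
- exact: wnorm_integrable.
- exact: integrable_scalefun.
- by move=> x; rewrite halflineE => x0; rewrite mulrCA ler_wpM2l// wC.
Qed.

(** Continuity of the seminorm of weight [w] in the norm of $L^1(\phi)$: this is what allows limits
    and closures as soon as [phi] dominates the weight. *)
Lemma wnorm_lip f g : L1 phi f -> L1 phi g ->
  wnorm w f <= wnorm w g + C * wnorm phi (fun x => f x - g x).
Proof.
move=> Lf Lg; have Ld := L1_sub Lf Lg.
apply: (@le_trans _ _ (1 * wnorm w g + 1 * wnorm w (fun x => f x - g x))).
  apply: wnorm_le2 => // x; rewrite !mul1r.
  by rewrite -{1}[f x](subrK (g x)) addrC ler_normD.
by rewrite !mul1r lerD2l wnorm_le_phi.
Qed.

End domination.

Lemma ler_eps (x y K : R) : (forall e : R, 0 < e -> x <= y + K * e) -> x <= y.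
Proof.
move=> h; apply/ler_addgt0Pr => e e0.
have K1 : 0 < `|K| + 1 by rewrite ltr_pwDr.
apply: (le_trans (h (e / (`|K| + 1)) _)); first by rewrite divr_gt0.
rewrite lerD2l mulrA ler_pdivrMr// mulrC ler_wpM2l ?(ltW e0)//.
by rewrite (le_trans (ler_norm _))// lerDl.
Qed.

(* [W], [D] and [a] stand for the Lyapunov weight, the dissipated weight and the growth rate. *)
Lemma closure_dissipative (A : (R -> R) -> (R -> R) -> Prop) (phi W D : R -> R) (CW CD a h : R) f g :
  measurable_fun halfline phi -> (forall x, 0 < x -> 0 < phi x) ->
  measurable_fun halfline W -> (forall x, 0 < x -> 0 <= W x <= CW * phi x) ->
  measurable_fun halfline D -> (forall x, 0 < x -> 0 <= D x <= CD * phi x) ->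
  0 <= h -> h * a <= 1 ->
  (forall f' g', A f' g' -> [/\ L1 phi f', L1 phi g' &
    (1 - h * a) * wnorm W f' + h * wnorm D f' <= wnorm W (fun x => f' x - h * g' x)]) ->
  closure_operator phi A f g ->
  (1 - h * a) * wnorm W f + h * wnorm D f <= wnorm W (fun x => f x - h * g x).
Proof.
move=> mphi phi0 mW WC mD DC h0 ha hA [Lf Lg cl].
have W0 x : 0 < x -> 0 <= W x by move=> /WC/andP[].
have W1 x : 0 < x -> W x <= CW * phi x by move=> /WC/andP[].
have D0 x : 0 < x -> 0 <= D x by move=> /DC/andP[].
have D1 x : 0 < x -> D x <= CD * phi x by move=> /DC/andP[].
have CW0 : 0 <= CW.
  by have := le_trans (W0 _ ltr01) (W1 _ ltr01); rewrite pmulr_lge0// phi0.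
have CD0 : 0 <= CD.
  by have := le_trans (D0 _ ltr01) (D1 _ ltr01); rewrite pmulr_lge0// phi0.
have pge0 x : 0 < x -> 0 <= phi x by move=> x0; rewrite ltW// phi0.
(* Total coefficient of the approximation error $e$: the two norms on the left move by at most
   [CW * e] and [CD * e], the one on the right by [CW * (1 + h) * e]. *)
apply: (@ler_eps _ _ ((1 - h * a) * CW + h * CD + CW * (1 + h))) => e e0.
have [f' [g' [/hA[Lf' Lg' diss] fe ge]]] := cl e e0.
have Lff := L1_sub Lf' Lf; have Lgg := L1_sub Lg' Lg.
have Lff' := L1_sub Lf Lf'.
move: fe ge; rewrite !(L1normE pge0)// !lte_fin => fe ge.
have symm u v : wnorm phi (fun x => u x - v x) = wnorm phi (fun x => v x - u x).
  by apply: eq_Rintegral => x _; rewrite distrC.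
have bW := wnorm_lip mphi phi0 mW W0 W1 Lf Lf'.
have bD := wnorm_lip mphi phi0 mD D0 D1 Lf Lf'.
rewrite symm in bW bD.
have Lh u v : L1 phi u -> L1 phi v -> L1 phi (fun x => u x - h * v x).
  move=> Lu Lv; have := L1_add (- h) Lv Lu; congr (L1 _ _); apply/funext => x.
  by rewrite mulNr addrC.
have bS := wnorm_lip mphi phi0 mW W0 W1 (Lh _ _ Lf' Lg') (Lh _ _ Lf Lg).
have mphi0 x : 0 < x -> phi x <= 1 * phi x by rewrite mul1r.
have b2 : wnorm phi (fun x => f' x - h * g' x - (f x - h * g x)) <=
   1 * wnorm phi (f' \- f) + h * wnorm phi (g' \- g).
  apply: (wnorm_le2 mphi phi0 mphi pge0 mphi0) => //.
    exact: L1_sub (Lh _ _ Lf' Lg') (Lh _ _ Lf Lg).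
  move=> x; rewrite mul1r.
  have -> : f' x - h * g' x - (f x - h * g x) = (f' x - f x) - h * (g' x - g x) by ring.
  by rewrite (le_trans (ler_normB _ _))// normrM (ger0_norm h0).
have s0 : 0 <= 1 - h * a by rewrite subr_ge0.
have t1 := ler_wpM2l s0 (le_trans bW (lerD (lexx _) (ler_wpM2l CW0 (ltW fe)))).
have t2 := ler_wpM2l h0 (le_trans bD (lerD (lexx _) (ler_wpM2l CD0 (ltW fe)))).
have t4 : 1 * wnorm phi (f' \- f) + h * wnorm phi (g' \- g) <= (1 + h) * e.
  by rewrite mulrDl; apply: lerD; apply: ler_wpM2l => //; exact: ltW.
have t5 := ler_wpM2l CW0 (le_trans b2 t4).
have {}bS := le_trans bS (lerD (lexx _) t5).
rewrite (le_trans (lerD t1 t2))//.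
rewrite [leLHS](_ : _ = ((1 - h * a) * wnorm W f' + h * wnorm D f') + ((1 - h * a) * CW + h * CD) * e); last by ring.
rewrite (le_trans (lerD (le_trans diss bS) (lexx _)))//.
apply: eq_ler; ring.
Qed.

(** $(1-y)(1+2y)=1+y(1-2y)\ge1$ on $[0,1/2]$, and $1+2y\le\mathrm e^{2y}$. *)
Lemma inv_one_sub_le (y : R) : 0 <= y -> y <= 2^-1 -> (1 - y)^-1 <= expR (2 * y).
Proof.
move=> y0 y1; have h : 0 < 1 - y by lra.
rewrite (le_trans _ (expR_ge1Dx _))// -[leLHS]mul1r ler_pdivrMr//; nra.
Qed.

(** The factor $q=\mathrm e^{2ah}$ satisfies $q(1-ha)\ge1$, so that multiplying a step by $q$
    absorbs the coefficient of [H]; as $q\ge1$, the nonnegative dissipated terms are preserved. *)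
Lemma discrete_gronwall (a h E : R) (H D : nat -> R) (n : nat) : 0 <= a -> 0 < h -> a * h <= 2^-1 ->
  0 <= E -> (forall k, 0 <= H k) -> (forall k, 0 <= D k) ->
  (forall k, (1 - h * a) * H k.+1 + h * D k.+1 <= H k + h * E) ->
  H n + h * \sum_(k < n) D k.+1 <= expR (2 * (a * h) * n%:R) * (H 0%N + n%:R * h * E).
Proof.
move=> a0 h0 ah E0 H0 D0 rec.
have ah0 : 0 <= a * h by rewrite mulr_ge0// ltW.
pose q := expR (2 * (a * h)).
have q1 : 1 <= q by rewrite /q -[leLHS]expR0 ler_expR; lra.
have qi : 1 <= q * (1 - h * a).
  have := inv_one_sub_le ah0 ah; rewrite -/q => hq.
  have k0 : 0 < 1 - h * a by rewrite mulrC; lra.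
  by rewrite -ler_pdivrMr// div1r [h * a]mulrC.
have -> : expR (2 * (a * h) * n%:R) = q ^+ n by rewrite mulrC expRM_natl.
elim: n => [|n IH]; first by rewrite big_ord0 expr0 mul0r mul0r mul1r mulr0.
rewrite big_ord_recr /= exprS -[n.+1%:R]natr1.
set S := \sum_(i < n) D i.+1 in IH *.
have S0 : 0 <= S by apply: sumr_ge0.
have Hn := rec n; have q0 : 0 <= q by lra.
have hD := mulr_ge0 (ltW h0) (D0 n.+1).
have hS := mulr_ge0 (ltW h0) S0.
have hE := mulr_ge0 (ltW h0) E0.
have r1 := ler_wpM2l q0 Hn.
have r2 : H n.+1 <= q * (1 - h * a) * H n.+1 by rewrite ler_peMl.
have r3 : h * D n.+1 <= q * (h * D n.+1) by rewrite ler_peMl.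
have r4 : h * S <= q * (h * S) by rewrite ler_peMl.
have r5 := ler_wpM2l q0 IH.
have r6 : q * (h * E) <= q * (q ^+ n * (h * E)).
  by rewrite ler_wpM2l// ler_peMl// exprn_ege1.
set qn := q ^+ n in IH r5 r6 *; lra.
Qed.

End WeightedNorm.

(** * Implicit Euler scheme along a semigroup *)

Section Semigroup.
Context {R : realType} (phi : R -> R) (T : R -> (R -> R) -> R -> R).
Local Notation mu := (@lebesgue_measure R).
Implicit Types (f g : R -> R) (s t : R).
Let mH := @measurable_halfline R.
Hypothesis mphi : measurable_fun halfline phi.
Hypothesis phi0 : forall x : R, 0 < x -> 0 < phi x.
Hypothesis TC0 : C0_semigroup phi T.
Hypothesis T_norm : forall t f, 0 <= t -> L1 phi f -> ge0_ae f ->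
  L1norm phi (T t f) = L1norm phi f.

Let phi0W (x : R) : 0 < x -> 0 <= phi x.
Proof. by move=> x0; rewrite ltW// phi0. Qed.

Let phi1 (x : R) : 0 < x -> phi x <= 1 * phi x.
Proof. by rewrite mul1r. Qed.

Lemma T_L1 t f : 0 <= t -> L1 phi f -> L1 phi (T t f).
Proof. by move=> t0; have [h _ _] := semigroup_bounded TC0 t0; exact: h. Qed.

Lemma T_lin t (c : R) f g : 0 <= t -> L1 phi f -> L1 phi g ->
  eq_ae (T t (fun x => c * f x + g x)) (fun x => c * T t f x + T t g x).
Proof. by move=> t0; have [_ h _] := semigroup_bounded TC0 t0; exact: h. Qed.

Lemma T_lin3 t (a b : R) f g h : 0 <= t -> L1 phi f -> L1 phi g -> L1 phi h ->
  eq_ae (T t (fun x => a * f x + (b * g x + h x)))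
    (fun x => a * T t f x + (b * T t g x + T t h x)).
Proof.
move=> t0 Lf Lg Lh.
have e1 := T_lin b t0 Lg Lh; have e2 := T_lin a t0 Lf (L1_add b Lg Lh).
by apply: aeS2 e1 e2 => x E1 E2 Hx; rewrite (E2 Hx) (E1 Hx).
Qed.

(** Norm preservation on nonnegative functions is applied to $f^+$ and $f^-$ separately; the
    triangle inequality for $T_tf^+-T_tf^-$ and $|f|=f^++f^-$ conclude. *)
Lemma T_contraction t f : 0 <= t -> L1 phi f -> wnorm phi (T t f) <= wnorm phi f.
Proof.
move=> t0 Lf; pose fp x := Num.max (f x) 0; pose fn x := Num.max (- f x) 0.
have mf := L1_measurable mphi phi0 Lf.
have fE (x : R) : f x = fp x - fn x.
  by rewrite /fp /fn; case: (leP (f x) 0) => f0; case: (leP (- f x) 0); lra.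
have nfE (x : R) : `|f x| = 1 * fp x + 1 * fn x.
  rewrite /fp /fn; case: (leP (f x) 0) => f0; [rewrite ler0_norm//|rewrite gtr0_norm//];
  by case: (leP (- f x) 0); lra.
have fp0 (x : R) : 0 <= fp x by rewrite /fp le_max lexx orbT.
have fn0 (x : R) : 0 <= fn x by rewrite /fn le_max lexx orbT.
have mfp : measurable_fun halfline fp by exact: measurable_maxr.
have mfn : measurable_fun halfline fn by apply: measurable_maxr => //; exact: measurable_funN.
have Lp (u : R -> R) : measurable_fun halfline u -> (forall x, `|u x| <= `|f x|) -> L1 phi u.
  move=> mu_ uf; apply: (@le_integrable_real _ _ _ mu _ _ (fun x => `|f x * phi x|)) => //.
  - exact: measurable_funM.
  - by move=> x _; rewrite !normrM ler_wpM2r.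
  - exact: (integrable_norm Lf).
have Lfp : L1 phi fp.
  by apply: Lp => // x; rewrite ger0_norm// nfE !mul1r lerDl.
have Lfn : L1 phi fn.
  by apply: Lp => // x; rewrite ger0_norm// nfE !mul1r lerDr.
have Tf : eq_ae (T t f) (fun x => -1 * T t fn x + T t fp x).
  have := T_lin (-1) t0 Lfn Lfp; congr (eq_ae (T t _) _); apply/funext => x.
  by rewrite fE mulN1r addrC.
have LTp := T_L1 t0 Lfp; have LTn := T_L1 t0 Lfn.
rewrite (wnorm_ae mphi phi0 mphi (T_L1 t0 Lf) (L1_add (-1) LTn LTp) Tf).
apply: (@le_trans _ _ (1 * wnorm phi (T t fn) + 1 * wnorm phi (T t fp))).
  apply: (wnorm_le2 mphi phi0 mphi phi0W phi1) => //; first exact: L1_add.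
  by move=> x; rewrite !mul1r mulN1r (le_trans (ler_normD _ _))// normrN.
have Tn u : L1 phi u -> (forall x, 0 <= u x) -> wnorm phi (T t u) = wnorm phi u.
  move=> Lu u0; have u0' : ge0_ae u by apply: aeW => x _; exact: u0.
  have := T_norm t0 Lu u0'.
  by rewrite !(L1normE phi0W)//; [case|exact: T_L1].
rewrite !Tn// !mul1r /wnorm -RintegralD//; last 2 first.
- exact: (wnorm_integrable mphi phi0 mphi phi0W phi1).
- exact: (wnorm_integrable mphi phi0 mphi phi0W phi1).
apply: eq_ler; apply: eq_Rintegral => x _.
by rewrite nfE !ger0_norm// !mul1r mulrDl addrC.
Qed.

Lemma cvg0_right (F : R -> \bar R) (e : R) : F t @[t --> 0^'+] --> 0%E -> 0 < e ->
  exists2 d : R, 0 < d & forall t, 0 < t -> t < d -> (F t < e%:E)%E.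
Proof.
move=> Fc e0.
have : \forall t \near 0^'+, (F t < e%:E)%E.
  have nb : nbhs 0%E [set y : \bar R | (y < e%:E)%E].
    apply: open_nbhs_nbhs; split; last by rewrite /= lte_fin.
    exact: open_ereal_lt_ereal.
  exact: (Fc _ nb).
move=> [d /= d0 hd]; exists d => // t t0 td; apply: hd => //=.
by rewrite sub0r normrN gtr0_norm.
Qed.

(** Defect of one implicit step: the difference quotient is compared with $T_hg$, taken at the new
    time, and not with $g$. *)
Let defect h f g := wnorm phi (fun x => (T h f x - f x) / h - T h g x).

Lemma L1_quotient h f g : 0 <= h -> L1 phi f -> L1 phi g ->
  L1 phi (fun x => (T h f x - f x) / h - g x).
Proof.
move=> h0 Lf Lg; have := L1_add h^-1 (L1_sub (T_L1 h0 Lf) Lf) (L1_add (-1) Lg (L1_sub Lg Lg)).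
by congr (L1 _ _); apply/funext => x; rewrite subrr addr0 mulN1r mulrC.
Qed.

(** The generator compares the difference quotient with $g$; strong continuity replaces $g$ by
    $T_hg$. *)
Lemma generator_defect f g (e : R) : generator phi T f g -> 0 < e ->
  exists2 d : R, 0 < d & forall h, 0 < h -> h < d -> defect h f g < e.
Proof.
move=> [Lf Lg gc] e0.
have e20 : 0 < e / 2 by rewrite divr_gt0.
have [d1 d10 h1] := cvg0_right gc e20.
have [d2 d20 h2] := cvg0_right (semigroup_continuous TC0 Lg) e20.
exists (Num.min d1 d2); first by rewrite lt_min d10.
move=> h h0; rewrite lt_min => /andP[hd1 hd2].
have h0W := ltW h0.
have LTg := T_L1 h0W Lg.
have LQ := L1_quotient h0W Lf Lg.
have := h1 h h0 hd1; have := h2 h h0 hd2.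
rewrite (L1normE phi0W)//; last exact: L1_sub.
rewrite (L1normE phi0W)// !lte_fin => a1 a2.
apply: (@le_lt_trans _ _ (1 * wnorm phi (fun x => (T h f x - f x) / h - g x) +
    1 * wnorm phi (T h g \- g))).
  apply: (wnorm_le2 mphi phi0 mphi phi0W phi1) => //; [exact: L1_sub|exact: L1_quotient|].
  move=> x; rewrite !mul1r.
  rewrite (_ : _ - T h g x = ((T h f x - f x) / h - g x) - (T h g x - g x)); last by ring.
  by rewrite (le_trans (ler_normB _ _)).
by rewrite !mul1r; lra.
Qed.

(** $T_s$ commutes with the difference quotients and contracts $L^1(\phi)$, so their convergence
    persists along the trajectory. *)
Lemma generator_T s f g : 0 <= s -> generator phi T f g -> generator phi T (T s f) (T s g).
Proof.
move=> s0 [Lf Lg gc]; split; [exact: T_L1|exact: T_L1|].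
apply: (@squeeze_cvge _ _ _ _ (cst 0%E) _
  (fun t => L1norm phi (fun x => (T t f x - f x) / t - g x))) => //; last exact: cvg_cst.
near=> t.
have t0 : 0 < t by near: t; exact: nbhs_right_gt.
have t0W := ltW t0; have LTf := T_L1 s0 Lf; have LTg := T_L1 s0 Lg.
have LTtf := T_L1 t0W Lf.
rewrite integral_ge0//=.
rewrite (L1normE phi0W); last exact: L1_quotient.
rewrite (L1normE phi0W); last exact: L1_quotient.
rewrite lee_fin.
(* Up to sign, the remainder is written as a linear combination on which [T_lin3] acts; linearity
   and $T_sT_t=T_tT_s$ are available almost everywhere only, hence the chain of functions [u], [v],
   [w]. *)
pose u x := (- t^-1) * T t f x + (t^-1 * f x + g x).
have Lu : L1 phi u by apply: L1_add => //; exact: L1_add.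
have uE : wnorm phi (fun x => (T t f x - f x) / t - g x) = wnorm phi u.
  by apply: eq_Rintegral => x _; rewrite /u -normrN; congr (`|_| * _); ring.
rewrite uE; apply: le_trans (T_contraction s0 Lu).
apply: eq_ler.
pose v x := (- t^-1) * T s (T t f) x + (t^-1 * T s f x + T s g x).
have Lv : L1 phi v by apply: L1_add; [exact: T_L1|exact: L1_add].
have uv : eq_ae (T s u) v by exact: T_lin3.
rewrite (wnorm_ae mphi phi0 mphi (T_L1 s0 Lu) Lv uv).
pose w x := (- t^-1) * T t (T s f) x + (t^-1 * T s f x + T s g x).
have Lw : L1 phi w by apply: L1_add; [exact: T_L1|exact: L1_add].
have wv : eq_ae w v.
  have e1 := semigroup_D TC0 s0 t0W Lf; have e2 := semigroup_D TC0 t0W s0 Lf.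
  rewrite addrC in e2; apply: aeS2 e1 e2 => x E1 E2 Hx; rewrite /w /v.
  by rewrite -(E1 Hx) -(E2 Hx).
rewrite -(wnorm_ae mphi phi0 mphi Lw Lv wv).
by apply: eq_Rintegral => x _; rewrite /w -normrN; congr (`|_| * _); ring.
Unshelve. all: by end_near.
Qed.

Section euler.
Variables (W D : R -> R) (CW CD a : R).
Hypothesis a0 : 0 <= a.
Hypothesis mW : measurable_fun halfline W.
Hypothesis WC : forall x : R, 0 < x -> 0 <= W x <= CW * phi x.
Hypothesis DC : forall x : R, 0 < x -> 0 <= D x <= CD * phi x.
Hypothesis diss : forall f g (h : R), generator phi T f g -> 0 <= h -> h * a <= 1 ->
  (1 - h * a) * wnorm W f + h * wnorm D f <= wnorm W (fun x => f x - h * g x).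

Let W0 (x : R) : 0 < x -> 0 <= W x. Proof. by move=> /WC/andP[]. Qed.
Let W1 (x : R) : 0 < x -> W x <= CW * phi x. Proof. by move=> /WC/andP[]. Qed.
Let D0 (x : R) : 0 < x -> 0 <= D x. Proof. by move=> /DC/andP[]. Qed.

(* Implicit Euler scheme along the trajectory: [T (k.+1 * h) f - h * T (k.+1 * h) g] equals
   [T (k * h) f] up to an error controlled, uniformly in [k], by the defect on [0, h]. *)
Lemma euler_step (h : R) (k : nat) f g : 0 < h -> h * a <= 1 -> generator phi T f g ->
  (1 - h * a) * wnorm W (T (k.+1%:R * h) f) + h * wnorm D (T (k.+1%:R * h) f) <=
  wnorm W (T (k%:R * h) f) + h * (CW * defect h f g).
Proof.
move=> h0 ha gen; have [Lf Lg _] := gen.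
have h0W := ltW h0.
set t := k.+1%:R * h; set s := k%:R * h.
have t0 : 0 <= t by rewrite mulr_ge0.
have s0 : 0 <= s by rewrite mulr_ge0.
have tE : t = s + h by rewrite /t /s -natr1 mulrDl mul1r.
have CW0 : 0 <= CW.
  by have := le_trans (W0 ltr01) (W1 ltr01); rewrite pmulr_lge0// phi0.
apply: (le_trans (diss (generator_T t0 gen) h0W ha)).
have LTf := T_L1 t0 Lf; have LTg := T_L1 t0 Lg; have LSf := T_L1 s0 Lf.
have Lh : L1 phi (fun x => T t f x - h * T t g x).
  have := L1_add (- h) LTg LTf; congr (L1 _ _); apply/funext => x.
  by rewrite mulNr addrC.
apply: (le_trans (wnorm_lip mphi phi0 mW W0 W1 Lh LSf)).
rewrite lerD2l mulrCA ler_wpM2l//.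
pose u x := (- h) * T h g x + (-1 * f x + T h f x).
have Lhg := T_L1 h0W Lg; have Lhf := T_L1 h0W Lf.
have Lu : L1 phi u by apply: L1_add => //; exact: L1_add.
have uE : wnorm phi u = h * defect h f g.
  rewrite /defect /wnorm -RintegralZl//; last first.
    by apply: (wnorm_integrable mphi phi0 mphi phi0W phi1); exact: L1_quotient.
  apply: eq_Rintegral => x _; rewrite mulrA; congr (_ * _).
  rewrite (_ : u x = h * ((T h f x - f x) / h - T h g x)) ?normrM ?(gtr0_norm h0)//.
  by rewrite /u mulrBr mulrCA divff ?gt_eqF//; ring.
rewrite -uE; apply: le_trans (T_contraction s0 Lu).
apply: eq_ler.
apply: (wnorm_ae mphi phi0 mphi); [exact: L1_sub|exact: T_L1|].
have e0 := T_lin3 (- h) (-1) s0 Lhg Lf Lhf.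
have e1 := semigroup_D TC0 s0 h0W Lf; have e2 := semigroup_D TC0 s0 h0W Lg.
rewrite -tE in e1 e2.
apply: aeS2 e0 (aeS2 (fun x (p : _ -> _) (q : _ -> _) Hx => conj (p Hx) (q Hx)) e1 e2) => x E0 E12 Hx.
have [E1 E2] := E12 Hx.
rewrite /u (E0 Hx) -E1 -E2; ring.
Qed.

(** The step is $h=t/n$ with $n$ so large that the accumulated defect stays below $e$. The discrete
    Gronwall inequality bounds the Riemann sum of the [D]-norms over the grid, so that one of the
    grid points is a suitable time $s$. *)
Lemma euler_bound (t e : R) f g : 0 < t -> 0 < e -> generator phi T f g ->
  wnorm W (T t f) <= expR (2 * a * t) * (wnorm W f + e) /\
  exists2 s : R, 0 < s <= t & wnorm D (T s f) <= expR (2 * a * t) * (wnorm W f + e) / t.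
Proof.
move=> t0 e0 gen; have [Lf Lg _] := gen.
have CW0 : 0 <= CW.
  by have := le_trans (W0 ltr01) (W1 ltr01); rewrite pmulr_lge0// phi0.
have r0 : 0 < t * (CW + 1) by rewrite mulr_gt0// ltr_wpDl.
have [d d0 hd] := generator_defect gen (divr_gt0 e0 r0).
(* The bound $h<d$ keeps the total defect $t\,CW\,E$ below $e$; the other one gives $ah\le1/2$. *)
pose m := Num.min d (2 * a + 1)^-1.
have a1 : 0 < 2 * a + 1 by rewrite ltr_wpDl// mulr_ge0.
have m0 : 0 < m by rewrite lt_min d0 invr_gt0.
pose n := (Num.truncn (t / m)).+1.
have n0 : 0 < n%:R :> R by rewrite ltr0n.
pose h := t / n%:R.
have h0 : 0 < h by rewrite divr_gt0.
have hm : h < m.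
  by rewrite /h ltr_pdivrMr// mulrC -ltr_pdivrMr// truncnS_gt.
have nh : n%:R * h = t by rewrite /h mulrC divfK// gt_eqF.
have /andP[hd1 ha] : (h < d) && (h < (2 * a + 1)^-1) by move: hm; rewrite lt_min.
have hE := hd _ h0 hd1; set E := defect h f g in hE.
have E0 : 0 <= E by exact: wnorm_ge0.
have ah : a * h <= 2^-1.
  move: ha; rewrite -[X in _ < X]mul1r ltr_pdivlMr// => ha; lra.
have ha1 : h * a <= 1 by rewrite mulrC (le_trans ah)//; lra.
pose H k := wnorm W (T (k%:R * h) f); pose G k := wnorm D (T (k%:R * h) f).
have key := @discrete_gronwall R a h (CW * E) H G n a0 h0 ah (mulr_ge0 CW0 E0)
  (fun k => wnorm_ge0 _ W0) (fun k => wnorm_ge0 _ D0) (fun k => euler_step k h0 ha1 gen).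
have HW0 : H 0%N = wnorm W f.
  rewrite /H mul0r; apply: (wnorm_ae mphi phi0 mW) => //; first exact: T_L1.
  exact: (semigroup_0 TC0).
have S0 : 0 <= h * \sum_(k < n) G k.+1.
  by rewrite mulr_ge0 ?(ltW h0)//; apply: sumr_ge0 => k _; exact: wnorm_ge0.
have Hn0 : 0 <= H n by exact: wnorm_ge0.
have bound : expR (2 * (a * h) * n%:R) * (H 0%N + n%:R * h * (CW * E)) <=
    expR (2 * a * t) * (wnorm W f + e).
  rewrite (_ : 2 * (a * h) * n%:R = 2 * a * t); last by rewrite -nh; ring.
  rewrite ler_wpM2l ?expR_ge0// HW0 lerD2l nh.
  move: hE; rewrite ltr_pdivlMr// => hE.
  have tE : 0 <= t * E by rewrite mulr_ge0// ltW.
  rewrite (le_trans _ (ltW hE))// [leRHS](_ : _ = t * (CW * E) + t * E); last by ring.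
  by rewrite lerDl.
have {}key := le_trans key bound.
split; first by rewrite -nh -/(H n) nh (le_trans _ key)// lerDl.
(* Otherwise the [D]-norm exceeds the bound at every grid point $(k+1)h\le t$, and so does its
   mean. *)
apply/not_exists2P => hs.
have big k : (k < n)%N -> expR (2 * a * t) * (wnorm W f + e) / t < G k.+1.
  move=> kn; rewrite ltNge; apply/negP => le; case: (hs (k.+1%:R * h)) => //; apply.
  by rewrite mulr_gt0//= -nh ler_wpM2r ?(ltW h0)// ler_nat.
have : expR (2 * a * t) * (wnorm W f + e) < h * \sum_(k < n) G k.+1.
  apply: (@le_lt_trans _ _ (h * \sum_(k < n) (expR (2 * a * t) * (wnorm W f + e) / t))).
    by rewrite sumr_const card_ord -[X in h * X]mulr_natl mulrA [h * _]mulrC nh mulrCA divff ?gt_eqF// mulr1.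
  rewrite ltr_pM2l//; apply: ltr_sum => [|i _]; last exact: big.
  by apply/hasP; exists ord0 => //; rewrite mem_index_enum.
rewrite ltNge => /negP; apply; rewrite (le_trans _ key)// lerDr//.
Qed.

End euler.

End Semigroup.

(** * Functions with compact support *)

Section CompactSupport.
Context {R : realType}.
Local Notation mu := (@lebesgue_measure R).
Implicit Types (f g u V dV psi w : R -> R) (x y a b : R).
Let mH := @measurable_halfline R.

Lemma Cc_integrable u : Cc u -> mu.-integrable halfline (EFin \o u).
Proof.
move=> [cu [a [b [a0 supp]]]].
have sub : `[a, b]%classic `<=` (halfline : set R).
  by move=> x; rewrite halflineE/= in_itv/= => /andP[+ _]; exact: lt_le_trans.
apply: (@integrable_support _ _ _ mu `[a, b]%classic halfline u (measurable_itv _) mH sub).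
- move=> x; rewrite halflineE => x0 xab; apply: contrapT => /eqP ux.
  by apply: xab; rewrite /= in_itv/=; exact: supp.
- exact: continuous_itv_integrable.
Qed.

Lemma CcM u psi : Cc u -> (forall x, 0 < x -> {for x, continuous psi}) -> Cc (fun x => u x * psi x).
Proof.
move=> [cu [a [b [a0 supp]]]] cpsi; split.
  by move=> x x0; apply: (@continuousM _ _ u psi x); [exact: cu|exact: cpsi].
exists a, b; split=> // x x0; rewrite mulf_eq0 negb_or => /andP[+ _]; exact: supp.
Qed.

Lemma Cc_L1 u psi : Cc u -> (forall x, 0 < x -> {for x, continuous psi}) -> L1 psi u.
Proof. by move=> Cu cpsi; apply: Cc_integrable; exact: CcM. Qed.

(** Integration by parts on a compact interval at whose ends [V] vanishes. The separate [u] stands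
    for a product such as $\tau f$, which equals [V] on the half-line only. *)
Lemma Cc_weak_derivative u V dV : (forall x, 0 < x -> is_derive x 1 V (dV x)) -> Cc V -> Cc dV ->
  (forall x, 0 < x -> u x = V x) -> weak_derivative u dV.
Proof.
move=> VdV CV CdV uV; have iV := Cc_integrable CV; have idV := Cc_integrable CdV.
have iu : mu.-integrable halfline (EFin \o u).
  by apply: eq_integrable iV => // x; rewrite inE halflineE => x0; rewrite /= uV.
have oH : open (halfline : set R) by exact: interval_open.
split; [exact: open_integrable_locally|exact: open_integrable_locally|].
move=> chi [dchi _].
have dc x : derivable chi x 1 by exact: (dchi 0%N x).
have ddc x : derivable (derive1 chi) x 1 by exact: (dchi 1%N x).
have cchi x : 0 < x -> {for x, continuous chi}.
  by move=> _; exact: derivable_continuous.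
have cdchi x : 0 < x -> {for x, continuous (derive1 chi)}.
  by move=> _; exact: derivable_continuous.
have -> : \int[mu]_(x in halfline) (u x * derive1 chi x) =
    \int[mu]_(x in halfline) (V x * derive1 chi x).
  by apply: eq_Rintegral => x; rewrite inE halflineE => x0; rewrite uV.
have i1 := Cc_integrable (CcM CV cdchi); have i2 := Cc_integrable (CcM CdV cchi).
apply/eqP; rewrite -addr_eq0 -RintegralD//; apply/eqP.
have dP x : 0 < x -> is_derive x 1 (fun y => V y * chi y) (V x * derive1 chi x + chi x * dV x).
  by move=> x0; apply: is_derive_mulfun; [exact: VdV|exact: is_derive_derive1].
have dPE x : 0 < x -> derive1 (fun y => V y * chi y) x = V x * derive1 chi x + dV x * chi x.
  by move=> x0; rewrite derive1E (@derive_val _ _ _ _ _ _ _ (dP x x0)) [dV x * _]mulrC.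
have [cV [a [b [a0 supp]]]] := CV; have [cdV [a' [b' [a'0 supp']]]] := CdV.
(* [V] and [dV] come with unrelated support bounds; [l] and [r] lie strictly outside both, and the
   outer maximum ensures $l\le r$ whatever [b] and [b'] are. *)
pose l := Num.min (a / 2) (a' / 2); pose r := Num.max l (Num.max (b + 1) (b' + 1)).
have l0 : 0 < l by rewrite lt_min !divr_gt0.
have lr : l <= r by rewrite le_max lexx.
have out x : 0 < x -> ~ `[l, r]%classic x -> V x = 0 /\ dV x = 0.
  move=> x0 h; split; apply: contrapT => /eqP hn; apply: h; rewrite /= in_itv/=.
    have /andP[ax xb] := supp x x0 hn.
    rewrite ge_min le_max le_max; apply/andP; split; apply/orP; [left|right; apply/orP; left]; lra.
  have /andP[ax xb] := supp' x x0 hn.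
  rewrite ge_min le_max le_max; apply/andP; split; apply/orP; [right|right; apply/orP; right]; lra.
have Vl : V l = 0.
  apply: contrapT => /eqP hn; have /andP[al _] := supp l l0 hn.
  by have : l <= a / 2 by [rewrite ge_min lexx]; lra.
have Vr : V r = 0.
  apply: contrapT => /eqP hn; have /andP[_ rb] := supp r (lt_le_trans l0 lr) hn.
  by have : b + 1 <= r by [rewrite !le_max lexx orbT]; lra.
rewrite (@Rintegral_support _ _ _ mu `[l, r]%classic); last 2 first.
- by move=> x; rewrite halflineE/= in_itv/= => /andP[+ _]; exact: lt_le_trans.
- by move=> x; rewrite halflineE => x0 /(out x x0)[-> ->]; rewrite !mul0r addr0.
have CP : C1 (fun y => V y * chi y).
  move=> x x0; split; first by have [] := dP x x0.
  have cc : {for x, continuous (fun y => V y * derive1 chi y + dV y * chi y)}.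
    apply: (@continuousD _ _ _ (fun y => V y * derive1 chi y) (fun y => dV y * chi y) x).
      by apply: (@continuousM _ _ V (derive1 chi) x); [exact: cV|exact: cdchi].
    by apply: (@continuousM _ _ dV chi x); [exact: cdV|exact: cchi].
  change (derive1 (fun y => V y * chi y) y @[y --> x] --> derive1 (fun y => V y * chi y) x).
  rewrite dPE//; apply: cvg_trans cc; apply: near_eq_cvg.
  have nx : \forall y \near x, 0 < y by exact: lt_nbhsr.
  by apply: filterS nx => y y0; rewrite dPE.
have := C1_FTC CP l0 lr; rewrite Vl Vr !mul0r subrr => <-.
apply: eq_Rintegral => x; rewrite inE/= in_itv/= => /andP[lx _].
by rewrite dPE// (lt_le_trans l0).
Qed.

(* Mean values [(F (x + h) - F x) / h] of [K], with [F] a primitive of [K] *)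
Lemma mollification (K : R -> R) (a b : R) : 0 < a -> continuous K ->
  (forall x, K x != 0 -> a <= x <= b) ->
  exists (V dV : nat -> R -> R) (S : R),
  [/\ forall n, Cc (V n), forall n, Cc (dV n),
    forall n x, is_derive x 1 (V n) (dV n x),
    forall n x, `|V n x| <= S /\ (V n x != 0 -> a / 2 <= x <= b) &
    forall x, V n x @[n --> \oo] --> K x].
Proof.
move=> a0 cK supp.
have iK (D : set R) : measurable D -> mu.-integrable D (EFin \o K).
  move=> mD; apply: (integrableS measurableT) => //.
  apply: (@integrable_support _ _ _ mu `[a, b]%classic setT K (measurable_itv _) measurableT (@subsetT _ _)).
    by move=> x _ xab; apply: contrapT => /eqP /supp h; apply: xab; rewrite /= in_itv.
  apply: continuous_itv_integrable => // x _; exact: cK.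
pose F x := \int[mu]_(t in `]-oo, x]) K t.
have dF x : is_derive x 1 F (K x).
  have [dFx <-] : derivable F x 1 /\ derive1 F x = K x.
    have xx1 : x < x + 1 by rewrite ltrDl.
    have FTC := @continuous_FTC1 _ K -oo%O x (x + 1) xx1 (iK _ (measurable_itv _)).
    apply: (FTC _ (cK x)); by rewrite ltNyr.
  exact: is_derive_derive1.
have [S hS] : exists S : R, forall x, `|K x| <= S.
  have [ab|ba] := leP a b; last first.
    exists 0 => x; have [->|/supp/andP[h1 h2]] := eqVneq (K x) 0; first by rewrite normr0.
    by have := lt_le_trans ba (le_trans h1 h2); rewrite ltxx.
  have cN : {within `[a, b], continuous (fun x => `|K x|)}.
    by apply: continuous_subspaceT => x; apply: cvg_norm; exact: cK.
  have [c _ hc] := EVT_max ab cN.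
  exists `|K c| => x; have [->|] := eqVneq (K x) 0; first by rewrite normr0.
  by move=> /supp xab; apply: hc; rewrite in_itv.
(* The shift is at most $a/2$, which keeps the supports inside $[a/2,b]$. *)
pose h (n : nat) : R := a / 2 * n.+1%:R^-1.
have h0 n : 0 < h n by rewrite mulr_gt0 ?divr_gt0// invr_gt0.
have ha n : h n <= a / 2 by rewrite ler_piMr ?divr_ge0 ?(ltW a0)// invf_le1 ?ler1n ?ltr0n.
pose V n x := (F (x + h n) - F x) / h n.
pose dV n x := (K (x + h n) - K x) / h n.
(* By the mean value theorem [V n x] is a value of [K] at a point of $(x,x+h_n)$; the uniform bound,
   the support and the convergence all follow from this. *)
have mvt n x : exists2 c, x < c < x + h n & V n x = K c.
  have xh : x < x + h n by rewrite ltrDl.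
  have [|c cx E] := MVT xh (fun y _ => dF y).
  - by apply: continuous_subspaceT => y; apply: derivable_continuous; have [] := dF y.
  - exists c; first by move: cx; rewrite in_itv.
    by rewrite /V E addrAC subrr add0r mulfK// gt_eqF.
have dVn n x : is_derive x 1 (V n) (dV n x).
  have d1 : is_derive x 1 (fun y => F (1 * y + h n)) (K (1 * x + h n) * 1).
    exact: (@is_derive_compfun _ F (fun y => 1 * y + h n) x _ _ (dF _) (is_derive_affine 1 (h n) x)).
  have d2 := is_derive_addfun d1 (is_deriveN (dF x)).
  have d3 := is_derive_mulfun d2 (is_derive_cst (h n)^-1 x 1).
  rewrite /V /dV; move: d3; rewrite mulr0 add0r mulr1 mul1r.
  rewrite (_ : (fun y => _) = (fun y => (F (y + h n) - F y) / h n)); last first.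
    by apply/funext => y; rewrite mul1r.
  by rewrite mulrC.
have Vsupp n x : V n x != 0 -> a / 2 <= x <= b.
  have [c /andP[c1 c2] ->] := mvt n x => /supp/andP[c3 c4].
  by have := ha n => ha'; apply/andP; split; lra.
exists V, dV, S; split=> //.
- move=> n; split; first by move=> x _; apply: derivable_continuous; have [] := dVn n x.
  by exists (a / 2), b; split=> [|x _]; [rewrite divr_gt0|exact: Vsupp].
- move=> n; split.
    move=> x _; apply: (@continuousM _ _ (fun y => K (y + h n) - K y) (fun=> (h n)^-1) x); last exact: cst_continuous.
    apply: (@continuousB _ _ _ (fun y => K (y + h n)) K x); last exact: cK.
    apply: (@continuous_comp _ _ _ (fun y => y + h n) K x); last exact: cK.
    by apply: (@continuousD _ _ _ (fun y : R => y) (fun=> h n) x); [exact: cvg_id|exact: cst_continuous].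
  exists (a / 2), b; split=> [|x _]; first by rewrite divr_gt0.
  rewrite /dV; have [K0|] := eqVneq (K x) 0.
    rewrite K0 subr0 mulf_eq0 negb_or => /andP[/supp/andP[c1 c2] _].
    by have := ha n => ha'; have := h0 n => h0'; apply/andP; split; lra.
  by move=> /supp/andP[c1 c2] _; apply/andP; split => //; lra.
- by move=> n x; split; [have [c _ ->] := mvt n x; exact: hS|exact: Vsupp].
- move=> x; apply/cvgrPdist_lt => e e0.
  have /cvgrPdist_lt/(_ e e0)[d /= d0 hd] := cK x.
  have : \forall n \near \oo, h n < d.
    have : h n @[n --> \oo] --> 0.
      by rewrite -[X in _ --> X](mulr0 (a / 2)); apply: cvgMr; exact: cvg_harmonic.
    by move=> /cvgrPdist_lt/(_ d d0); apply: filterS => n; rewrite sub0r normrN gtr0_norm.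
  apply: filterS => n hn; have [c /andP[c1 c2] ->] := mvt n x.
  apply: hd; rewrite /= distrC gtr0_norm ?subr_gt0//; lra.
Qed.

(** Piecewise linear plateau: for $n\ge2$ it is 1 on $[2/(n+1),n]$, and it is 0 outside
    $[1/(n+1),n+1]$. *)
Definition cutoff (n : nat) x : R := Num.min 1 (Num.max 0 (Num.min (n.+1%:R * x - 1) (n.+1%:R - x))).

Lemma cutoff_continuous n : continuous (cutoff n).
Proof.
move=> x; apply: (@continuous_min _ _ (fun=> 1) _ x); first exact: cst_continuous.
apply: (@continuous_max _ _ (fun=> 0) _ x); first exact: cst_continuous.
apply: (@continuous_min _ _ (fun x => n.+1%:R * x - 1) (fun x => n.+1%:R - x) x).
  apply: (@continuousB _ _ _ (fun x => n.+1%:R * x) (fun=> 1) x); last exact: cst_continuous.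
  exact: mulrl_continuous.
by apply: cvgB; [exact: cvg_cst|exact: cvg_id].
Qed.

Lemma cutoff01 n x : 0 <= cutoff n x <= 1.
Proof. by rewrite /cutoff le_min ge_min !le_max !lexx !ler01. Qed.

Lemma cutoff_supp n x : cutoff n x != 0 -> n.+1%:R^-1 <= x <= n.+1%:R.
Proof.
move=> h; have n0 : 0 < n.+1%:R :> R by rewrite ltr0n.
apply/andP; split; rewrite leNgt; apply: contra h => h; rewrite /cutoff.
  have e : Num.min (n.+1%:R * x - 1) (n.+1%:R - x) <= 0.
    by rewrite ge_min; apply/orP; left; rewrite subr_le0 mulrC -ler_pdivlMr// div1r ltW.
  by rewrite (max_idPl e) min_r ?ler01.
have e : Num.min (n.+1%:R * x - 1) (n.+1%:R - x) <= 0.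
  by rewrite ge_min; apply/orP; right; rewrite subr_le0 ltW.
by rewrite (max_idPl e) min_r ?ler01.
Qed.

Lemma cutoff_cvg x : 0 < x -> cutoff n x @[n --> \oo] --> (1 : R).
Proof.
move=> x0; apply: cvg_near_cst.
pose m := Num.max (2 / x) (x + 1).
exists (Num.truncn m).+1 => // n /= mn.
have mn' : m < n.+1%:R by rewrite (lt_le_trans (truncnS_gt _))// ler_nat leqW.
have h1 : 2 < n.+1%:R * x by rewrite -ltr_pdivrMr// (le_lt_trans _ mn')// le_max lexx.
have h2 : x + 1 < n.+1%:R by rewrite (le_lt_trans _ mn')// le_max lexx orbT.
rewrite /cutoff min_l// le_max le_min; apply/orP; right; apply/andP; split; lra.
Qed.

(** On the compact support of a cut-off the weight lies between two positive constants, so that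
    plain $L^1$ approximation by continuous functions suffices; the approximant is multiplied by the
    cut-off again, to be supported away from 0. *)
Lemma Cc_dense w f (e : R) : (forall x, 0 < x -> {for x, continuous w}) ->
  (forall x, 0 < x -> 0 < w x) -> L1 w f -> 0 < e ->
  exists2 g, (continuous g /\ exists a b : R, 0 < a /\ forall x, g x != 0 -> a <= x <= b) &
    wnorm w (fun x => f x - g x) < e.
Proof.
move=> cw w0 Lf e0.
have mw : measurable_fun halfline w by exact: continuous_halfline_measurable.
have mf := L1_measurable mw w0 Lf.
have w1 x : 0 < x -> w x <= 1 * w x by rewrite mul1r.
have w0W x : 0 < x -> 0 <= w x by move=> /w0/ltW.
have mcut n : measurable_fun halfline (cutoff n).
  by apply: continuous_halfline_measurable => x _; exact: cutoff_continuous.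
have e20 : 0 < e / 2 by rewrite divr_gt0.
have pw (x : R) : 0 < x -> `|f x - cutoff n x * f x| * w x @[n --> \oo] --> (0 : R).
  move=> x0; have -> : 0 = `|f x - 1 * f x| * w x by rewrite mul1r subrr normr0 mul0r.
  apply: cvgMl; apply: cvg_norm; apply: cvgB; first exact: cvg_cst.
  by apply: cvgMl; exact: cutoff_cvg.
have [n hn] : exists n, \int[mu]_(x in halfline) (`|f x - cutoff n x * f x| * w x) < e / 2.
  have : \int[mu]_(x in halfline) (`|f x - cutoff n x * f x| * w x) @[n --> \oo] -->
      \int[mu]_(x in (halfline : set R)) (0 : R).
    apply: proj2; apply: (@Rintegral_dominated_convergence _ _ _ mu halfline
      (fun n x => `|f x - cutoff n x * f x| * w x) (fun=> 0) (fun x => `|f x * w x|) mH).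
    - move=> n; apply: measurable_funM => //; apply: measurableT_comp => //.
      by apply: measurable_funB => //; exact: measurable_funM (mcut n) mf.
    - exact: measurable_cst.
    - apply: aeW => x; rewrite halflineE; exact: pw.
    - exact: (integrable_norm Lf).
    - move=> n x _; have /andP[c0 c1] := cutoff01 n x.
      rewrite normrM normr_id normrM ler_wpM2r//.
      rewrite -{1}[f x]mul1r -mulrBl normrM ler_piMl// ger0_norm ?subr_ge0//; lra.
  rewrite Rintegral_cst// mul0r => /cvgrPdist_lt/(_ _ e20)[n _ hn].
  exists n; have := hn n (leqnn n); rewrite sub0r normrN ger0_norm//.
  by apply: Rintegral_ge0 => x; rewrite halflineE => xp; rewrite mulr_ge0// w0W.
have n0 : 0 < n.+1%:R :> R by rewrite ltr0n.
pose l : R := n.+1%:R^-1; pose r : R := n.+1%:R.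
have l0 : 0 < l by rewrite invr_gt0.
have lr : l <= r by rewrite (@le_trans _ _ 1)// ?invf_le1 ?ler1n.
have cwlr : {within `[l, r], continuous w} by exact: continuous_within_itv.
have [c1 cc1 max1] := EVT_max lr cwlr.
have [c2 cc2 min2] := EVT_min lr cwlr.
have pos y : y \in `[l, r]%R -> 0 < y by rewrite in_itv/= => /andP[+ _]; exact: lt_le_trans.
have wc1 := w0 _ (pos _ cc1); have wc2 := w0 _ (pos _ cc2).
have sub : `[l, r]%classic `<=` (halfline : set R).
  by move=> x; rewrite halflineE/=; exact: pos.
have iE : mu.-integrable `[l, r] (EFin \o f).
  apply: (@le_integrable_real _ _ _ mu _ _ (fun x => (w c2)^-1 * `|f x * w x|)).
  - exact: measurable_itv.
  - by apply: measurable_funS mf.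
  - move=> x xlr; rewrite normrM mulrCA ler_peMr// (gtr0_norm (w0 _ (pos _ xlr))).
    by rewrite ler_pdivlMl// mulr1 min2.
  - apply: integrable_scalefun; first exact: measurable_itv.
    apply: (@integrableS _ _ _ mu halfline `[l, r]%classic _ mH (measurable_itv _) sub).
    exact: (integrable_norm Lf).
have mulr_fin : (mu `[l, r]%classic < +oo)%E.
  by rewrite lebesgue_measure_itv/=; case: ifP => _; rewrite ?ltry.
have [g_ [cg ig cvg]] := approximation_continuous_integrable (measurable_itv `[l, r]) mulr_fin iE.
have e3 : 0 < e / 2 / w c1 by rewrite divr_gt0.
have i1 m : mu.-integrable `[l, r] (EFin \o (fun z => `|f z - g_ m z|)).
  apply: integrable_norm; apply: integrable_subfun => //; exact: measurable_itv.
have [m hm] : exists m, \int[mu]_(z in `[l, r]) `|f z - g_ m z| < e / 2 / w c1.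
  have nb : nbhs 0%E [set y : \bar R | (y < (e / 2 / w c1)%:E)%E].
    apply: open_nbhs_nbhs; split; last by rewrite /= lte_fin.
    exact: open_ereal_lt_ereal.
  have [m _ hm] := cvg _ nb; exists m; have := hm m (leqnn m) => /=.
  rewrite -lte_fin /Rintegral fineK//.
  apply: integrable_fin_num; first exact: measurable_itv.
  exact: i1.
exists (fun x => cutoff n x * g_ m x).
  split; first by move=> x; apply: (@continuousM _ _ (cutoff n) (g_ m) x); [exact: cutoff_continuous|exact: cg].
  exists l, r; split => // x; rewrite mulf_eq0 negb_or => /andP[+ _]; exact: cutoff_supp.
have Cg : Cc (fun x => cutoff n x * g_ m x).
  split; first by move=> x _; apply: (@continuousM _ _ (cutoff n) (g_ m) x); [exact: cutoff_continuous|exact: cg].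
  by exists l, r; split => // x _; rewrite mulf_eq0 negb_or => /andP[+ _]; exact: cutoff_supp.
have Lg := Cc_L1 Cg cw.
have Lcf : L1 w (fun x => cutoff n x * f x).
  apply: (@le_integrable_real _ _ _ mu _ _ (fun x => `|f x * w x|)) => //.
  - by apply: measurable_funM => //; exact: measurable_funM (mcut n) mf.
  - move=> x _; have /andP[c0 c1'] := cutoff01 n x.
    by rewrite -mulrA normrM ler_piMl// ger0_norm.
  - exact: (integrable_norm Lf).
apply: (@le_lt_trans _ _ (1 * wnorm w (fun x => f x - cutoff n x * f x) +
    1 * wnorm w (fun x => cutoff n x * f x - cutoff n x * g_ m x))).
  apply: (wnorm_le2 mw w0 mw w0W w1); [exact: L1_sub|exact: L1_sub|exact: L1_sub|].
  by move=> x; rewrite !mul1r (le_trans _ (ler_normD _ _))// addrA subrK.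
rewrite !mul1r [ltRHS]splitr ltr_leD//.
rewrite /wnorm (@Rintegral_support _ _ _ mu `[l, r]%classic)//; last first.
  move=> x xp xlr; have -> : cutoff n x = 0.
    by apply: contrapT => /eqP/cutoff_supp h; apply: xlr; rewrite /= in_itv.
  by rewrite !mul0r subrr normr0 mul0r.
apply: (@le_trans _ _ (w c1 * \int[mu]_(z in `[l, r]) `|f z - g_ m z|)); last first.
  by rewrite mulrC -ler_pdivlMr// ltW.
rewrite -RintegralZl//.
apply: le_Rintegral; first exact: measurable_itv.
- apply: (@integrableS _ _ _ mu halfline `[l, r]%classic _ mH (measurable_itv _) sub).
  exact: (wnorm_integrable mw w0 mw w0W w1 (L1_sub Lcf Lg)).
- by apply: (@integrable_scalefun _ _ _ mu) => //; exact: measurable_itv.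
- move=> x xlr; have /andP[c0 c1'] := cutoff01 n x.
  rewrite -mulrBr normrM (ger0_norm c0) mulrC ler_pM//.
  + by rewrite ltW// w0// pos.
  + by rewrite mulr_ge0.
  + exact: max1.
  + by rewrite ler_piMl.
Qed.

End CompactSupport.

(** * Dissipation by fragmentation *)

Section GrowthFragmentation.
Context {R : realType} (tau B : R -> R) (gamma0 : R)
  (wp : {finite_measure set (measurableTypeR R) -> \bar R})
  (lambda : R) (phi : R -> R) (tau1 B0 xB Cphi : R).
Local Notation mu := (@lebesgue_measure R).
Implicit Types (p N x y z c : R) (f g w psi : R -> R).
Hypothesis tau_gt0 : forall x : R, 0 < x -> 0 < tau x.
Hypothesis tau_C1 : C1 tau.
Hypothesis tau1_ge0 : 0 <= tau1.
Hypothesis tau_le : forall x : R, 0 < x -> tau x <= tau1 * Num.max 1 x.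
Hypothesis B_ge0 : forall x : R, 0 < x -> 0 <= B x.
Hypothesis B_cont : forall x : R, 0 < x -> {for x, continuous B}.
Hypotheses (B0_gt0 : 0 < B0) (xB_gt0 : 0 < xB) (gamma0_gt0 : 0 < gamma0).
Hypothesis B_ge : forall x : R, xB <= x -> B0 * x `^ gamma0 <= B x.
Hypothesis wp1 : (\int[wp]_(z in `]0%R, 1%R[) z%:E = 1)%E.
Hypothesis lambda_ge0 : 0 <= lambda.
Hypothesis phi_C1 : C1 phi.
Hypothesis phi_eq : forall x : R, 0 < x ->
  - tau x * derive1 phi x + lambda * phi x + B x * phi x = Fplus_adj B wp phi x.
Hypothesis Cphi_gt0 : 0 < Cphi.
Hypothesis phi_bounds : forall x : R, 0 < x -> Cphi^-1 * (1 + x) <= phi x <= Cphi * (1 + x).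

Let U : set R := `]0, 1[%classic.
Let mU : measurable U. Proof. exact: measurable_itv. Qed.
Let mH := @measurable_halfline R.

Lemma phi_gt0 x : 0 < x -> 0 < phi x.
Proof.
move=> xgt0; have /andP[+ _] := phi_bounds xgt0; apply: lt_le_trans.
by rewrite mulr_gt0 ?invr_gt0// ltr_wpDl.
Qed.

Lemma one_le_phi x : 0 < x -> 1 + x <= Cphi * phi x.
Proof.
by move=> xgt0; have /andP[+ _] := phi_bounds xgt0; rewrite mulrC ler_pdivrMr// mulrC.
Qed.

Lemma measurable_phi : measurable_fun halfline phi.
Proof. by apply: continuous_halfline_measurable; exact: C1_continuous. Qed.

Lemma pushed_phi x : 0 < x -> pushed_weight wp phi x = (\int[wp]_(z in U) phi (z * x))%:E.
Proof.
move=> xgt0; rewrite /pushed_weight /Rintegral fineK// -/U.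
apply: integrable_fin_num => //.
apply: (@le_integrable_real _ _ _ wp U _ (fun=> Cphi * (1 + x))) => //.
- exact: measurable_scaled measurable_phi.
- move=> z; rewrite /U/= in_itv/= => /andP[z0 z1]; have zx0 := mulr_gt0 z0 xgt0.
  rewrite ger0_norm ?(ltW (phi_gt0 _))//; have /andP[_ h] := phi_bounds zx0.
  rewrite (le_trans h)// ler_wpM2l ?(ltW Cphi_gt0)// lerD2l ler_piMl ?(ltW xgt0)// ltW//.
- exact: finite_measure_integrable_cst.
Qed.

(** Since $2z/(1+z)<1$ on $(0,1)$, the integrand is strictly below $z$. Equality of the integrals
    would make $(0,1)$ a null set of [wp], against $\int z\,\wp(dz)=1$. *)
Lemma fragment_gain_lt1 (p : R) : 0 < p ->
  (\int[wp]_(z in U) (z * (2 * z / (1 + z)) `^ p)%:E < 1)%E.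
Proof.
move=> p0.
have fr z : U z -> 0 < 2 * z / (1 + z) < 1.
  rewrite /U/= in_itv/= => /andP[z0 z1].
  have d : 0 < 1 + z by rewrite ltr_wpDl.
  by rewrite divr_gt0 ?mulr_gt0//= ltr_pdivrMr// mul1r; lra.
have zU z : U z -> 0 < z < 1 by rewrite /U/= in_itv.
have mfrac : measurable_fun U (fun z : R => (2 * z / (1 + z)) `^ p).
  apply: (measurableT_comp (measurable_powR p)).
  apply: (@eq_measurable_fun _ _ _ _ _ (fun z : R => 2 * z * (1 + z) `^ (-1))).
    move=> z; rewrite inE => /zU/andP[z0 _].
    by rewrite powR_inv1// addr_ge0// ltW.
  apply: measurable_funM; first by apply: measurable_funM.
  by apply: (measurableT_comp (measurable_powR (-1))); exact: measurable_funD.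
have mg : measurable_fun U (fun z : R => z * (2 * z / (1 + z)) `^ p) by exact: measurable_funM.
have le_g z : U z -> 0 <= z * (2 * z / (1 + z)) `^ p < z.
  move=> Uz; have /andP[z0 z1] := zU z Uz; have /andP[f0 f1] := fr z Uz.
  rewrite mulr_ge0 ?powR_ge0 ?(ltW z0)//= gtr_pMr//.
  have := @gt0_ltr_powR R p p0 (2 * z / (1 + z)) 1.
  by rewrite powR1; apply => //; rewrite nnegrE ltW.
have iz : wp.-integrable U (EFin \o (fun z : R => z)).
  apply/integrableP; split; first exact/measurable_EFinP.
  have -> : (\int[wp]_(z in U) `|(EFin \o id) z| = \int[wp]_(z in U) z%:E)%E.
    by apply: eq_integral => z; rewrite inE => /zU/andP[z0 _]; rewrite /= gtr0_norm.
  by rewrite wp1 ltry.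
have ig : wp.-integrable U (EFin \o (fun z : R => z * (2 * z / (1 + z)) `^ p)).
  apply: le_integrable_real iz => // z Uz; have /andP[g0 g1] := le_g z Uz.
  by rewrite ger0_norm// ltW.
rewrite lt_neqAle; apply/andP; split; last first.
  rewrite -wp1; apply: le_integral => //.
  by move=> z; rewrite inE => /le_g/andP[_ /ltW]; rewrite lee_fin.
apply/eqP => E.
have : (\int[wp]_(z in U) `|(z - z * (2 * z / (1 + z)) `^ p)%:E| = 0)%E.
  have -> : (\int[wp]_(z in U) `|(z - z * (2 * z / (1 + z)) `^ p)%:E| =
      \int[wp]_(z in U) (z%:E - (z * (2 * z / (1 + z)) `^ p)%:E))%E.
    by apply: eq_integral => z; rewrite inE => /le_g/andP[_ g1]; rewrite /= gtr0_norm ?subr_gt0.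
  by rewrite integralB_EFin// wp1 E subee.
move/(ae_eq_integral_abs wp mU) => /(_ _)[].
  by apply/measurable_EFinP; exact: measurable_funB.
move=> N [mN N0 sub].
have : (\int[wp]_(z in U) z%:E = 0)%E.
  apply: null_set_integral => //.
  apply: (@subset_measure0 _ _ _ wp U N) => //.
  move=> z Uz; apply: sub => /= /(_ Uz) [/eqP].
  by have /andP[_ g1] := le_g z Uz; rewrite subr_eq0 gt_eqF.
by rewrite wp1 => /eqP; rewrite eqe oner_eq0.
Qed.

(* The factor [2 `^ (- p)] comes from [trunc_id_ge_half], and [2 * z / (1 + z)] from
   [trunc_id_scale]. *)
Definition gain (p : R) : R := B0 * 2 `^ (- p) *
  (1 - fine (\int[wp]_(z in U) (z * (2 * z / (1 + z)) `^ p)%:E)%E).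

Lemma gain_gt0 p : 0 < p -> 0 < gain p.
Proof.
move=> p0; rewrite /gain !mulr_gt0 ?powR_gt0// subr_gt0.
have := fragment_gain_lt1 p0.
have h0 : (0 <= \int[wp]_(z in U) (z * (2 * z / (1 + z)) `^ p)%:E)%E.
  by apply: integral_ge0 => z; rewrite /U/= in_itv/= => /andP[z0 _]; rewrite lee_fin mulr_ge0 ?powR_ge0 ?ltW.
by move=> h; rewrite -lte_fin fineK// ge0_fin_numE// (lt_trans h)// ltry.
Qed.

(** Below [xB] the fragmentation rate may vanish, and beyond [N] the estimate [trunc_id_scale]
    fails: a deficit is claimed only in between. *)
Definition dissipation (p N x : R) : R :=
  gain p * x `^ (1 + p + gamma0) * \1_(`[xB, N]%classic) x.

(** As [trunc_id] is nondecreasing, $\int z\,\wp(dz)=1$ gives the bound without deficit at every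
    $x$. On $[x_B,N]$ the integral $k<1$ of [fragment_gain_lt1] replaces 1, and $1-k$ times
    [B x * trunc_power N p x] dominates the dissipation. *)
Lemma pushed_trunc_power_le (p N x : R) : 0 < p -> 0 < N -> 0 < x ->
  ((B x)%:E * pushed_weight wp (trunc_power N p) x <=
   (B x * trunc_power N p x - dissipation p N x)%:E)%E.
Proof.
move=> p0 N0 xgt0.
have zU z : U z -> 0 < z < 1 by rewrite /U/= in_itv.
have mT : measurable_fun halfline (trunc_power N p).
  by apply: continuous_halfline_measurable; apply: C1_continuous; exact: C1_trunc_power.
have mpush := measurable_scaled xgt0 mT.
have B0x := B_ge0 xgt0.
(* [c z] bounds the ratio of [trunc_id] at $zx$ and at $x$, raised to the power $p$; it is 1 outside
   $[x_B,N]$ and $(2z/(1+z))^p$ inside. *)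
have bound (c : R -> R) : measurable_fun U c -> (forall z, U z -> 0 <= c z) ->
    (forall z, U z -> trunc_id N (z * x) `^ p <= c z * trunc_id N x `^ p) ->
    (pushed_weight wp (trunc_power N p) x <=
     (trunc_power N p x)%:E * \int[wp]_(z in U) (z * c z)%:E)%E.
  move=> mc c0 hc; rewrite -ge0_integralZl_EFin//.
  - apply: ge0_le_integral => //.
    + move=> z /zU/andP[z0 z1]; rewrite lee_fin trunc_power_ge0//.
      exact: mulr_gt0.
    + exact/measurable_EFinP.
    + by apply: measurable_funeM; apply/measurable_EFinP; exact: measurable_funM.
    + move=> z Uz; have /andP[z0 z1] := zU z Uz.
      rewrite -EFinM lee_fin /trunc_power.
      rewrite (_ : x * trunc_id N x `^ p * (z * c z) = z * x * (c z * trunc_id N x `^ p)).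
        by rewrite ler_wpM2l ?hc// ltW// mulr_gt0.
      by ring.
  - by move=> z Uz; have /andP[z0 z1] := zU z Uz; rewrite lee_fin mulr_ge0 ?c0// ltW.
  - by apply/measurable_EFinP; exact: measurable_funM.
  - exact: trunc_power_ge0.
have [xI|xI] := boolP (x \in `[xB, N]%classic); last first.
  rewrite /dissipation indicE (negbTE xI) mulr0 subr0.
  rewrite EFinM lee_wpmul2l ?lee_fin//.
  apply: (le_trans (bound (fun=> 1) _ _ _)) => //.
    move=> z /zU/andP[z0 z1]; rewrite mul1r ge0_ler_powR ?nnegrE ?(ltW p0)//.
    - by rewrite ltW// trunc_id_gt0// mulr_gt0.
    - by rewrite ltW// trunc_id_gt0.
    - by rewrite trunc_id_homo ?mulr_gt0// ler_piMl ?(ltW z1) ?(ltW xgt0).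
  by under eq_integral do rewrite mulr1; rewrite wp1 mule1.
have /andP[x0x xN] : xB <= x <= N by move: xI; rewrite inE/= in_itv.
rewrite /dissipation indicE xI mulr1.
set k := (\int[wp]_(z in U) (z * (2 * z / (1 + z)) `^ p)%:E)%E.
have k0 : (0 <= k)%E.
  by apply: integral_ge0 => z; rewrite /U/= in_itv/= => /andP[z0 _]; rewrite lee_fin mulr_ge0 ?powR_ge0 ?ltW.
have k1 : (k < 1)%E by exact: fragment_gain_lt1.
have kfin : k \is a fin_num by rewrite ge0_fin_numE// (lt_trans k1)// ltry.
have fr z : U z -> 0 < 2 * z / (1 + z).
  by move=> /zU/andP[z0 z1]; rewrite divr_gt0 ?mulr_gt0// ltr_wpDl.
have pk : (pushed_weight wp (trunc_power N p) x <= (trunc_power N p x)%:E * k)%E.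
  apply: bound => [|z _|z Uz]; rewrite ?powR_ge0//.
    apply: (measurableT_comp (measurable_powR p)).
    apply: (@eq_measurable_fun _ _ _ _ _ (fun z : R => 2 * z * (1 + z) `^ (-1))).
      move=> z; rewrite inE => /zU/andP[z0 _].
      by rewrite powR_inv1// addr_ge0// ltW.
    apply: measurable_funM; first by apply: measurable_funM.
    by apply: (measurableT_comp (measurable_powR (-1))); exact: measurable_funD.
  have r0 := trunc_id_gt0 N0 xgt0.
  rewrite -powRM ?(ltW r0) ?(ltW (fr _ Uz))//.
  have t0 : 0 <= trunc_id N (z * x).
    by have /andP[z0 _] := zU z Uz; rewrite ltW// trunc_id_gt0// mulr_gt0.
  have m0 : 0 <= 2 * z / (1 + z) * trunc_id N x by rewrite ltW// mulr_gt0// fr.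
  rewrite ge0_ler_powR ?nnegrE ?(ltW p0)//.
  exact: (trunc_id_scale N0 (zU z Uz) xgt0 xN).
apply: (le_trans (lee_wpmul2l _ pk)); first by rewrite lee_fin.
move: k1; rewrite -(fineK kfin); set kf := fine k; rewrite lte_fin => kf1.
rewrite -!EFinM lee_fin /gain -/k -/kf lerBrDl.
have low : 2 `^ (- p) * x `^ (1 + p) <= trunc_power N p x.
  rewrite powRN powRD ?(gt_eqF xgt0) ?implybT// powRr1 ?(ltW xgt0)//.
  rewrite mulrCA ler_wpM2l ?(ltW xgt0)// mulrC -powRN.
  have -> : 2 `^ (- p) = 2^-1 `^ p :> R.
    by rewrite powRN -powR_inv1// -powRrM mulrC powRrM powR_inv1 ?powR_ge0.
  have t0 : 0 <= trunc_id N x by rewrite ltW// trunc_id_gt0.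
  have h0 : 0 <= x * 2^-1 by rewrite mulr_ge0// ltW.
  rewrite -powRM ?(ltW xgt0)// ge0_ler_powR ?nnegrE ?(ltW p0)//.
  exact: trunc_id_ge_half.
have e : x `^ (1 + p + gamma0) = x `^ (1 + p) * x `^ gamma0.
  by rewrite powRD ?(gt_eqF xgt0) ?implybT.
have main : B0 * x `^ gamma0 * (2 `^ (- p) * x `^ (1 + p)) <= B x * trunc_power N p x.
  by rewrite ler_pM ?B_ge ?mulr_ge0 ?powR_ge0 ?(ltW B0_gt0).
have := ler_wpM2r (ltW (_ : 0 < 1 - kf)) main; rewrite subr_gt0 => /(_ kf1).
rewrite e; set P := 2 `^ (- p); set X := x `^ (1 + p); set Y := x `^ gamma0.
set T := trunc_power N p x => h.
have -> : B0 * P * (1 - kf) * (X * Y) = B0 * Y * (P * X) * (1 - kf) by ring.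
rewrite -lerBrDr (le_trans h)//; lra.
Qed.

(** The factor [Cphi] makes the weight at least $1+x$, in particular at least 1 near the origin. *)
Definition trunc_weight (p N x : R) : R := Cphi * phi x + trunc_power N p x.

(** Upper bound for $\mathcal F_+^*$ of [trunc_weight]. The first bracket is $\mathcal F_+^*\phi$
    rewritten by the eigenvalue equation, so that it cancels exactly against transport and loss; the
    second one comes from [pushed_trunc_power_le]. *)
Definition gain_weight (p N x : R) : R :=
  Cphi * (lambda * phi x + B x * phi x - tau x * derive1 phi x) +
  (B x * trunc_power N p x - dissipation p N x).

Lemma dissipation_ge0 p N x : 0 < p -> 0 <= dissipation p N x.
Proof.
move=> p0; have g0 := ltW (gain_gt0 p0).
by apply: mulr_ge0 => //; apply: mulr_ge0 => //; exact: powR_ge0.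
Qed.

Lemma measurable_dissipation p N : measurable_fun halfline (dissipation p N).
Proof.
apply: measurable_funM; last by apply: measurable_indic; exact: measurable_itv.
by apply: measurable_funM => //; apply: measurable_funTS; exact: measurable_powR.
Qed.

Lemma dissipation_le p N x : 0 < p -> 0 < x ->
  dissipation p N x <= gain p * N `^ (1 + p + gamma0) * Cphi * phi x.
Proof.
move=> p0 xgt0; have g0 := ltW (gain_gt0 p0); have := one_le_phi xgt0 => h.
rewrite -(mulrA _ Cphi) (@le_trans _ _ (gain p * N `^ (1 + p + gamma0)))//; last first.
  rewrite ler_peMr//; first by apply: mulr_ge0 => //; exact: powR_ge0.
  by apply: le_trans h; rewrite lerDl ltW.
rewrite /dissipation -mulrA ler_wpM2l// indicE.
have [xI|xI] := boolP (x \in `[xB, N]%classic); last by rewrite mulr0 powR_ge0.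
have /andP[x0x xN] : xB <= x <= N by move: xI; rewrite inE/= in_itv.
have e0 : 0 <= 1 + p + gamma0 by rewrite !addr_ge0 ?ltW.
by rewrite mulr1 ge0_ler_powR ?nnegrE ?(ltW xgt0) ?(le_trans (ltW xgt0) xN).
Qed.

(** The eigenvalue equation expresses $\tau\phi'$ through $\lambda\phi$, $B\phi$ and $\mathcal
    F_+^*\phi$; the last is at most a constant times $B\phi$, since [wp] is finite and $\phi$ is
    comparable to $1+x$. *)
Lemma drift_phi_le : exists2 C : R, 0 <= C &
  forall x, 0 < x -> `|tau x * derive1 phi x| <= C * ((1 + B x) * phi x).
Proof.
have [w w0 hw] : exists2 w : R, 0 <= w & wp U = w%:E.
  by exists (fine (wp U)); [exact: fine_ge0|rewrite fineK// fin_num_measure].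
exists (lambda + 1 + Cphi ^+ 2 * w).
  by rewrite !addr_ge0// mulr_ge0// sqr_ge0.
move=> x xgt0; have ph0 := phi_gt0 xgt0; have B0x := B_ge0 xgt0.
have -> : tau x * derive1 phi x = lambda * phi x + B x * phi x - Fplus_adj B wp phi x.
  by rewrite -(phi_eq xgt0); ring.
have adj0 : 0 <= \int[wp]_(z in U) phi (z * x).
  by apply: Rintegral_ge0 => z; rewrite /U/= in_itv/= => /andP[z0 _]; rewrite ltW// phi_gt0// mulr_gt0.
have adjle : \int[wp]_(z in U) phi (z * x) <= Cphi ^+ 2 * w * phi x.
  have hb z : U z -> phi (z * x) <= Cphi ^+ 2 * phi x.
    rewrite /U/= in_itv/= => /andP[z0 z1]; have zx0 := mulr_gt0 z0 xgt0.
    have /andP[_ h] := phi_bounds zx0; rewrite (le_trans h)// expr2 -mulrA.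
    rewrite ler_wpM2l ?(ltW Cphi_gt0)// (le_trans _ (one_le_phi xgt0))// lerD2l.
    by rewrite ler_piMl ?(ltW xgt0) ?(ltW z1).
  have <- : \int[wp]_(z in U) (Cphi ^+ 2 * phi x) = Cphi ^+ 2 * w * phi x.
    rewrite Rintegral_cst//; have -> : fine (wp U) = w by rewrite hw.
    by rewrite mulrAC.
  apply: le_Rintegral => //; last exact: finite_measure_integrable_cst.
  apply: (@le_integrable_real _ _ _ wp U _ (fun=> Cphi ^+ 2 * phi x)) => //.
  - exact: measurable_scaled measurable_phi.
  - move=> z Uz; rewrite ger0_norm ?hb//.
    by move: Uz; rewrite /U/= in_itv/= => /andP[z0 _]; rewrite ltW// phi_gt0// mulr_gt0.
  - exact: finite_measure_integrable_cst.
rewrite /Fplus_adj -/U; set A := (\int[wp]_(z in U) phi (z * x)) in adj0 adjle *.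
have BA : B x * A <= B x * (Cphi ^+ 2 * w * phi x) by rewrite ler_wpM2l.
have BA0 : 0 <= B x * A by rewrite mulr_ge0.
have k0 : 0 <= Cphi ^+ 2 * w * phi x by apply: mulr_ge0; [apply: mulr_ge0 => //; exact: sqr_ge0|exact: ltW].
have lp : 0 <= lambda * phi x by apply: mulr_ge0 => //; exact: ltW.
have Bp : 0 <= B x * phi x by apply: mulr_ge0 => //; exact: ltW.
have lBp : 0 <= lambda * (B x * phi x) by rewrite mulr_ge0.
rewrite ler_norml; apply/andP; split; nra.
Qed.

Section weights.
Variables (p N : R).
Hypotheses (p0 : 0 < p) (N0 : 0 < N).

Lemma C1_trunc_weight : C1 (trunc_weight p N).
Proof.
have dtw x : 0 < x -> is_derive x 1 (trunc_weight p N)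
    (Cphi * derive1 phi x + derive1 (trunc_power N p) x).
  move=> xgt0; apply: is_derive_addfun.
    have := is_derive_mulfun (is_derive_cst Cphi x 1) (is_derive_derive1 (phi_C1 xgt0).1).
    by rewrite mulr0 addr0.
  by apply: is_derive_derive1; exact: (@C1_trunc_power _ N p N0 x xgt0).1.
move=> x xgt0; split; first by have [] := dtw x xgt0.
have E y : 0 < y -> derive1 (trunc_weight p N) y = Cphi * derive1 phi y + derive1 (trunc_power N p) y.
  by move=> y0; rewrite derive1E; have [_ ->] := dtw y y0.
have c : {for x, continuous (fun y => Cphi * derive1 phi y + derive1 (trunc_power N p) y)}.
  apply: cvgD; last exact: (@C1_trunc_power _ N p N0 x xgt0).2.
  by apply: cvgM; [exact: cvg_cst|exact: (phi_C1 xgt0).2].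
rewrite /prop_for /continuous_at E//.
apply: cvg_trans c; apply: near_eq_cvg; near=> y.
by rewrite E//; near: y; exact: lt_nbhsr.
Unshelve. all: by end_near. Qed.

Lemma derive1_trunc_weight x : 0 < x ->
  derive1 (trunc_weight p N) x = Cphi * derive1 phi x + derive1 (trunc_power N p) x.
Proof.
move=> xgt0; rewrite derive1E.
have := is_derive_mulfun (is_derive_cst Cphi x 1) (is_derive_derive1 (phi_C1 xgt0).1).
rewrite mulr0 addr0 => h.
by have [_ ->] := is_derive_addfun h (is_derive_derive1 (@C1_trunc_power _ N p N0 x xgt0).1).
Qed.

Lemma measurable_trunc_power : measurable_fun halfline (trunc_power N p).
Proof.
by apply: continuous_halfline_measurable; apply: C1_continuous; exact: C1_trunc_power.
Qed.

Lemma measurable_trunc_weight : measurable_fun halfline (trunc_weight p N).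
Proof. by apply: continuous_halfline_measurable; apply: C1_continuous; exact: C1_trunc_weight. Qed.

Lemma trunc_weight_ge x : 0 < x -> 1 + x <= trunc_weight p N x.
Proof. by move=> xgt0; rewrite (le_trans (one_le_phi xgt0))// lerDl trunc_power_ge0. Qed.

Lemma trunc_weight_gt0 x : 0 < x -> 0 < trunc_weight p N x.
Proof. by move=> xgt0; apply: lt_le_trans (trunc_weight_ge xgt0); rewrite ltr_wpDl. Qed.

Lemma trunc_weight_le x : 0 < x -> trunc_weight p N x <= Cphi * (1 + N `^ p) * phi x.
Proof.
move=> xgt0; rewrite mulrDr mulr1 mulrDl lerD2l (le_trans (trunc_power_leN N0 p0 xgt0))//.
rewrite -mulrA mulrCA ler_wpM2l ?powR_ge0// (le_trans _ (one_le_phi xgt0))//.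
by rewrite lerDr.
Qed.

(** Origin of the rate $\tau_1(1+p)$, uniform in $N$: for $x\ge1$ the bound $\tau\le\tau_1x$
    restores [trunc_power]; for $x<1$ the power of [trunc_id] is at most 1, hence at most the
    weight. *)
Lemma drift_trunc_power_le x : 0 < x ->
  0 <= tau x * derive1 (trunc_power N p) x <= tau1 * (1 + p) * trunc_weight p N x.
Proof.
move=> xgt0; have t0 := ltW (tau_gt0 xgt0).
have /andP[d0 d1] := derive1_trunc_power_bound N0 p0 xgt0.
rewrite mulr_ge0//=.
apply: (le_trans (ler_pM t0 d0 (tau_le xgt0) d1)).
rewrite mulrACA.
have p1 : 0 <= 1 + p by rewrite addr_ge0// ltW.
rewrite ler_wpM2l ?mulr_ge0//.
have r0 := trunc_id_gt0 N0 xgt0.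
have [x1|x1] := leP 1 x.
  by rewrite -/(trunc_power N p x) lerDr mulr_ge0 ?ltW ?phi_gt0.
rewrite mul1r (@le_trans _ _ (1 `^ p))//.
  rewrite ge0_ler_powR ?nnegrE ?(ltW p0) ?(ltW r0)//.
  by rewrite (le_trans (trunc_id_le N0 xgt0))// ltW.
by rewrite powR1 (le_trans _ (trunc_weight_ge xgt0))// lerDl ltW.
Qed.

Lemma gain_weight_ge0 x : 0 < x -> 0 <= gain_weight p N x.
Proof.
move=> xgt0; rewrite addr_ge0//.
  rewrite mulr_ge0 ?(ltW Cphi_gt0)//.
  have -> : lambda * phi x + B x * phi x - tau x * derive1 phi x = Fplus_adj B wp phi x.
    by rewrite -(phi_eq xgt0); ring.
  rewrite mulr_ge0 ?B_ge0// Rintegral_ge0// => z; rewrite /U/= in_itv/= => /andP[z0 _].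
  by rewrite ltW// phi_gt0// mulr_gt0.
rewrite -lee_fin; apply: le_trans (pushed_trunc_power_le p0 N0 xgt0).
apply: mule_ge0; first by rewrite lee_fin B_ge0.
apply: integral_ge0 => z; rewrite /U/= in_itv/= => /andP[z0 _].
by rewrite lee_fin trunc_power_ge0// mulr_gt0.
Qed.

Lemma pushed_trunc_weight_le x : 0 < x ->
  ((B x)%:E * pushed_weight wp (trunc_weight p N) x <= (gain_weight p N x)%:E)%E.
Proof.
move=> xgt0.
have zx z : U z -> 0 < z * x by rewrite /U/= in_itv/= => /andP[z0 _]; rewrite mulr_gt0.
have -> : pushed_weight wp (trunc_weight p N) x =
    (Cphi%:E * pushed_weight wp phi x + pushed_weight wp (trunc_power N p) x)%E.
  rewrite /pushed_weight -/U -ge0_integralZl_EFin//; last 3 first.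
  - by move=> z /zx/phi_gt0/ltW; rewrite lee_fin.
  - by apply/measurable_EFinP; exact: measurable_scaled measurable_phi.
  - exact: ltW.
  rewrite -ge0_integralD//.
  - by move=> z /zx/phi_gt0/ltW h; rewrite -EFinM lee_fin mulr_ge0// ltW.
  - by apply: measurable_funeM; apply/measurable_EFinP; exact: measurable_scaled measurable_phi.
  - by move=> z /zx h; rewrite lee_fin trunc_power_ge0.
  - by apply/measurable_EFinP; exact: measurable_scaled measurable_trunc_power.
rewrite ge0_muleDr; last 2 first.
- rewrite pushed_phi// -EFinM lee_fin mulr_ge0 ?(ltW Cphi_gt0)//.
  by apply: Rintegral_ge0 => z /zx/phi_gt0/ltW.
- by apply: integral_ge0 => z /zx h; rewrite lee_fin trunc_power_ge0.
rewrite /gain_weight EFinD leeD//; last exact: pushed_trunc_power_le.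
rewrite pushed_phi// -!EFinM lee_fin mulrCA ler_wpM2l ?(ltW Cphi_gt0)//.
have := phi_eq xgt0; rewrite /Fplus_adj -/U => <-; lra.
Qed.

End weights.

(** On $D(\mathcal A_0)$ the functions $f$, $Bf$ and $(\tau f)'$ lie in $L^1(\phi)$; hence each term
    of the balance is separately integrable against the weight, and the estimate is a rearrangement
    of integrals. *)
Lemma A0_dissipative (p N h : R) (f g : R -> R) : 0 < p -> 0 < N -> 0 <= h ->
  A0_plus_Fplus tau B wp lambda phi f g ->
  (1 - h * (tau1 * (1 + p))) * wnorm (trunc_weight p N) f + h * wnorm (dissipation p N) f <=
  wnorm (trunc_weight p N) (fun x => f x - h * g x).
Proof.
move=> p0 N0 h0 [tf' [Ff [[fL BfL] [wd tL] [v [fv cv v0]] FF [gL geq]]]].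
pose W := trunc_weight p N.
have CW := C1_trunc_weight p N0.
have mW : measurable_fun halfline W := measurable_trunc_weight p N0.
have mphi := measurable_phi.
have pgt0 := phi_gt0.
have mB : measurable_fun halfline B by exact: continuous_halfline_measurable.
have mtau : measurable_fun halfline tau.
  by apply: continuous_halfline_measurable; exact: C1_continuous.
have mf := L1_measurable mphi pgt0 fL.
have mt := L1_measurable mphi pgt0 tL.
have mg := L1_measurable mphi pgt0 gL.
have [a [_ _ FfL _]] := FF.
have mF := L1_measurable (measurable_weight a) (@weight_gt0 R a) FfL.
have mv : measurable_fun halfline v by exact: continuous_halfline_measurable.
have mdW : measurable_fun halfline (derive1 W).
  by apply: continuous_halfline_measurable => x xgt0; exact: (CW x xgt0).2.
have mas (u : R -> R) : measurable_fun halfline u -> measurable_fun halfline (fun x => `|u x|).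
  by move=> mu_; exact: measurableT_comp.
have msg (u : R -> R) : measurable_fun halfline u -> measurable_fun halfline (fun x => Num.sg (u x)).
  by move=> mu_; exact: measurableT_comp measurable_sgr mu_.
pose C := Cphi * (1 + N `^ p).
have WC x : 0 < x -> `|W x| <= C * phi x.
  by move=> xgt0; rewrite gtr0_norm ?trunc_weight_gt0// trunc_weight_le.
have W0 x : 0 < x -> 0 < W x by move=> xgt0; exact: trunc_weight_gt0.
have md := measurable_dissipation p N.
have i1 : mu.-integrable halfline (EFin \o (fun x => `|f x| * W x)).
  exact: L1_integrable_norm mW mphi pgt0 WC fL.
have i2 : mu.-integrable halfline (EFin \o (fun x => `|(B \* f) x| * W x)).
  exact: L1_integrable_norm mW mphi pgt0 WC BfL.
have i3' : mu.-integrable halfline (EFin \o (fun x => tf' x * W x)).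
  exact: L1_integrable mW mphi pgt0 WC tL.
have i3 : mu.-integrable halfline (EFin \o (fun x => W x * Num.sg (f x) * tf' x)).
  apply: (@le_integrable_real _ _ _ mu _ _ (fun x => `|tf' x * W x|)) => //.
  - by apply: measurable_funM => //; apply: measurable_funM => //; exact: msg.
  - move=> x _; rewrite !normrM mulrAC mulrC normr_sg [leRHS]mulrC.
    by case: (f x == 0); rewrite /= ?mul0r ?mul1r ?mulr_ge0.
  - exact: (integrable_norm i3').
have i7 : mu.-integrable halfline (EFin \o (fun x => `|f x| * dissipation p N x)).
  apply: L1_integrable_norm md mphi pgt0 _ fL => x xgt0.
  by rewrite ger0_norm ?dissipation_ge0//; exact: dissipation_le.
have [D D0 hD] := drift_phi_le.
(* The [phi] part of the weight is handled by [drift_phi_le], at the price of $Bf\in L^1(\phi)$, and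
   the power part by [drift_trunc_power_le]. *)
have i5 : mu.-integrable halfline (EFin \o (fun x => tau x * `|f x| * derive1 W x)).
  have idom : mu.-integrable halfline (EFin \o (fun x =>
      Cphi * D * (`|f x * phi x| + `|(B \* f) x * phi x|) + tau1 * (1 + p) * (`|f x| * W x))).
    by integrable_tac; [exact: (integrable_norm fL)|exact: (integrable_norm BfL)].
  apply: (@le_integrable_real _ _ _ mu _ _ _ _ _ _ idom) => //.
    by apply: measurable_funM => //; apply: measurable_funM => //; exact: mas.
  move=> x; rewrite halflineE => xgt0.
  rewrite derive1_trunc_weight// mulrDr (le_trans (ler_normD _ _))// lerD//.
    rewrite (_ : tau x * `|f x| * (Cphi * derive1 phi x) =
      Cphi * (`|f x| * (tau x * derive1 phi x))); last by ring.
    rewrite normrM (gtr0_norm Cphi_gt0) -mulrA ler_wpM2l ?(ltW Cphi_gt0)//.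
    rewrite normrM normr_id (le_trans (ler_wpM2l (normr_ge0 _) (hD _ xgt0)))//.
    rewrite /= (normrM (f x)) (normrM (B x * f x)) (normrM (B x)).
    rewrite (ger0_norm (B_ge0 xgt0)) (gtr0_norm (pgt0 _ xgt0)).
    by rewrite (_ : `|f x| * (D * ((1 + B x) * phi x)) =
      D * (`|f x| * phi x + B x * `|f x| * phi x))//; ring.
  have /andP[d0 d1] := drift_trunc_power_le p0 N0 xgt0.
  rewrite mulrAC mulrC normrM normr_id (ger0_norm d0).
  by rewrite [leRHS]mulrCA ler_wpM2l.
have ivW : mu.-integrable halfline (EFin \o (fun x => `|v x| * derive1 W x)).
  apply: integrable_ae_eq i5.
  - by apply: measurable_funM => //; apply: measurable_funM => //; exact: mas.
  - by apply: measurable_funM => //; exact: mas.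
  - apply: aeS fv => x E Hx; rewrite -(E Hx).
    by rewrite /= normrM gtr0_norm// tau_gt0// -halflineE.
have kv (a' b : R) : 0 < a' -> a' <= b -> \int[mu]_(t in `[a', b]) tf' t = v b - v a'.
  have E := weak_derivative_FTC wd fv cv. move=> a'0 ab; exact: (E a' b a'0 ab).
have ik (a' b : R) : 0 < a' -> a' <= b -> mu.-integrable `[a', b] (EFin \o tf').
  move=> a'0 ab; case: wd => _ [mk _ hk] _.
  have sub : `[a', b]%classic `<=` (halfline : set R).
    by move=> x; rewrite halflineE/= in_itv/= => /andP[+ _]; exact: lt_le_trans.
  apply/integrableP; split.
    by apply/measurable_EFinP; apply: measurable_funS mk.
  by apply: hk; [exact: sub|exact: segment_compact].
have WM x : 0 < x <= 1 -> W x <= C * (Cphi * 2).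
  move=> /andP[xgt0 x1]; rewrite (le_trans (trunc_weight_le p0 N0 xgt0))//.
  have C0 : 0 <= C by rewrite mulr_ge0 ?(ltW Cphi_gt0)// addr_ge0// powR_ge0.
  rewrite ler_wpM2l//; have /andP[_ h'] := phi_bounds xgt0; rewrite (le_trans h')//.
  by rewrite ler_wpM2l ?(ltW Cphi_gt0)//; lra.
have iWk : mu.-integrable halfline (EFin \o (fun x => W x * tf' x)).
  by apply: eq_integrable i3' => // x _ /=; rewrite mulrC.
have ivW' : mu.-integrable halfline (EFin \o (fun x => v x * derive1 W x)).
  apply: (@le_integrable_real _ _ _ mu _ _ (fun x => `| `|v x| * derive1 W x|)) => //.
  - exact: measurable_funM.
  - by move=> x _; rewrite !normrM normr_id.
  - exact: (integrable_norm ivW).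
have K := kato cv v0 ik kv mt CW (fun x hx => ltW (W0 x hx)) WM iWk ivW'.
(* Back from the continuous representative [v] to $\tau f$, whose sign is that of $f$. *)
have K' : 0 <= \int[mu]_(x in halfline) (W x * Num.sg (f x) * tf' x + tau x * `|f x| * derive1 W x).
  apply: (le_trans K); apply: eq_ler.
  apply: Rintegral_ae_eq => //.
  - apply: measurable_funD; apply: measurable_funM => //.
    + by apply: measurable_funM => //; exact: msg.
    + exact: mas.
  - apply: measurable_funD; apply: measurable_funM => //.
    + by apply: measurable_funM => //; exact: msg.
    + by apply: measurable_funM => //; exact: mas.
  - apply: aeS fv => x E Hx; rewrite -(E Hx) /=.
    have t0 : 0 < tau x by rewrite tau_gt0// -halflineE.
    by rewrite sgrM (gtr0_sg t0) mul1r normrM (gtr0_norm t0).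
have q0 x : 0 < x -> 0 <= gain_weight p N x by exact: gain_weight_ge0.
have mq : measurable_fun halfline (gain_weight p N).
  apply: measurable_funD.
    apply: measurable_funM => //; apply: measurable_funB.
      by apply: measurable_funD; apply: measurable_funM.
    apply: measurable_funM => //; apply: continuous_halfline_measurable => x xgt0.
    exact: (phi_C1 xgt0).2.
  apply: measurable_funB => //; apply: measurable_funM => //.
  exact: measurable_trunc_power.
have i6 : mu.-integrable halfline (EFin \o (fun x => `|f x| * gain_weight p N x)).
  have idom : mu.-integrable halfline (EFin \o (fun x =>
      Cphi * lambda * `|f x * phi x| + (Cphi * `|(B \* f) x * phi x| +
      (Cphi * D * (`|f x * phi x| + `|(B \* f) x * phi x|) + `|(B \* f) x| * W x)))).
    by integrable_tac; [exact: (integrable_norm fL)|exact: (integrable_norm BfL)|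
      exact: (integrable_norm fL)|exact: (integrable_norm BfL)].
  apply: (@le_integrable_real _ _ _ mu _ _ _ _ _ _ idom) => //.
    by apply: measurable_funM => //; exact: mas.
  move=> x; rewrite halflineE => xgt0.
  have f0 := normr_ge0 (f x); have ph0 := pgt0 _ xgt0; have B0x := B_ge0 xgt0.
  rewrite /= normrM normr_id (ger0_norm (q0 _ xgt0)) !normrM (ger0_norm B0x) (gtr0_norm ph0).
  have h1 : gain_weight p N x <= Cphi * lambda * phi x + (Cphi * (B x * phi x) +
      (Cphi * D * (phi x + B x * phi x) + B x * W x)).
    rewrite /gain_weight; have := hD _ xgt0; rewrite ler_norml => /andP[+ _].
    rewrite lerNl => hd; have := ler_wpM2l (ltW Cphi_gt0) hd.
    have := dissipation_ge0 N x p0.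
    have : B x * trunc_power N p x <= B x * W x.
      by rewrite ler_wpM2l// /W /trunc_weight lerDr mulr_ge0 ?ltW.
    rewrite !mulrBr !mulrDr !mulrDl ?mul1r !mulrA; lra.
  rewrite (le_trans (ler_wpM2l f0 h1))//; apply: eq_ler; ring.
(* Through the finiteness of its right-hand side, the dual bound also gives the integrability of
   [Ff] against the weight. *)
have FI := Fplus_weight_le B_ge0 B_cont FF _ mW _ mq q0 (fun y hy => pushed_trunc_weight_le p0 N0 hy).
have {}FI : (\int[mu]_(x in halfline) (`|Ff x| * W x)%:E <=
    \int[mu]_(x in halfline) (`|f x| * gain_weight p N x)%:E)%E.
  apply: (FI (C * Cphi)).
    by rewrite !mulr_ge0 ?(ltW Cphi_gt0)// addr_ge0// powR_ge0.
  move=> x xgt0; rewrite (ltW (W0 _ xgt0))/= (le_trans (trunc_weight_le p0 N0 xgt0))//.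
  rewrite -[leRHS]mulrA; apply: ler_wpM2l.
    by rewrite mulr_ge0 ?(ltW Cphi_gt0)// addr_ge0// powR_ge0.
  by have /andP[] := phi_bounds xgt0.
have i6fin : (\int[mu]_(x in halfline) (`|f x| * gain_weight p N x)%:E)%E \is a fin_num.
  exact: integrable_fin_num i6.
have F0 : (0 <= \int[mu]_(x in halfline) (`|Ff x| * W x)%:E)%E.
  by apply: integral_ge0 => x; rewrite halflineE => xgt0; rewrite lee_fin mulr_ge0// ltW// W0.
have Ffin : (\int[mu]_(x in halfline) (`|Ff x| * W x)%:E)%E \is a fin_num.
  by rewrite ge0_fin_numE// (le_lt_trans FI)// -(fineK i6fin) ltry.
have I46 : \int[mu]_(x in halfline) (`|Ff x| * W x) <=
    \int[mu]_(x in halfline) (`|f x| * gain_weight p N x) by rewrite fine_le.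
have i4 : mu.-integrable halfline (EFin \o (fun x => `|Ff x| * W x)).
  apply/integrableP; split.
    by apply/measurable_EFinP; apply: measurable_funM => //; exact: mas.
  rewrite (_ : (\int[mu]_(x in halfline) _)%E = (\int[mu]_(x in halfline) (`|Ff x| * W x)%:E)%E).
    by rewrite -(fineK Ffin) ltry.
  apply: eq_integral => x; rewrite inE halflineE => xgt0.
  by rewrite /= ger0_norm// mulr_ge0// ltW// W0.
have hgL : L1 phi (fun x => f x - h * g x).
  have := L1_add (- h) gL fL; congr (L1 _ _); apply/funext => x.
  by rewrite mulNr addrC.
have i8 : mu.-integrable halfline (EFin \o (fun x => `|f x - h * g x| * W x)).
  exact: L1_integrable_norm mW mphi pgt0 WC hgL.
have i5' : mu.-integrable halfline (EFin \o (fun x => W x * Num.sg (f x) * tf' x + tau x * `|f x| * derive1 W x)).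
  exact: integrable_addfun.
(* Pointwise minorant, almost everywhere, of $\mathrm{sg}(f)(f-hg)W$, obtained from
   $\mathrm{sg}(f)\,\mathcal F_+f\le|\mathcal F_+f|$. *)
pose L (x : R) : R := `|f x| * W x + h * (lambda * (`|f x| * W x) + (`|(B \* f) x| * W x +
  (W x * Num.sg (f x) * tf' x - `|Ff x| * W x))).
have iL : mu.-integrable halfline (EFin \o L) by rewrite /L; integrable_tac.
have low : \int[mu]_(x in halfline) L x <= wnorm W (fun x => f x - h * g x).
  pose g' (x : R) : R := - tf' x - lambda * f x - B x * f x + Ff x.
  have mg' : measurable_fun halfline g'.
    apply: measurable_funD => //; apply: measurable_funB; last exact: measurable_funM.
    by apply: measurable_funB; [exact: measurable_funN|exact: measurable_funM].
  have mfg (u : R -> R) : measurable_fun halfline u -> measurable_fun halfline (fun x => `|f x - h * u x| * W x).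
    move=> mu_; apply: measurable_funM => //; apply: mas.
    by apply: measurable_funB => //; exact: measurable_funM.
  have aeg : {ae mu, forall x, halfline x -> `|f x - h * g x| * W x = `|f x - h * g' x| * W x}.
    by apply: aeS geq => x E Hx; rewrite (E Hx).
  rewrite /wnorm; have -> : \int[mu]_(x in halfline) (`|f x - h * g x| * W x) =
      \int[mu]_(x in halfline) (`|f x - h * g' x| * W x).
    by apply: Rintegral_ae_eq => //; exact: mfg.
  apply: le_Rintegral => //; first exact: integrable_ae_eq (mfg _ mg) (mfg _ mg') aeg i8.
  move=> x; rewrite halflineE => xgt0.
  have Wx := ltW (W0 _ xgt0); have B0x := B_ge0 xgt0.
  have s1 := ler_sgM (f x) (f x - h * g' x).
  have s2 := ler_sgM (f x) (Ff x).
  have s3 : Num.sg (f x) * f x = `|f x| by rewrite -normrEsg.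
  rewrite /L /= (normrM (B x)) (ger0_norm B0x).
  apply: le_trans (ler_wpM2r Wx s1); rewrite /g'.
  have -> : Num.sg (f x) * (f x - h * (- tf' x - lambda * f x - B x * f x + Ff x)) =
     (1 + h * lambda + h * B x) * (Num.sg (f x) * f x) + h * (Num.sg (f x) * tf' x) -
       h * (Num.sg (f x) * Ff x) by ring.
  rewrite s3; have := ler_wpM2r Wx (ler_wpM2l h0 s2).
  set sF := Num.sg (f x) * Ff x; set st := Num.sg (f x) * tf' x => s4.
  have -> : W x * Num.sg (f x) * tf' x = st * W x by rewrite /st; ring.
  rewrite -subr_ge0.
  set e := (X in 0 <= X).
  have -> : e = h * `|Ff x| * W x - h * sF * W x by rewrite /e; ring.
  by rewrite subr_ge0.
apply: le_trans low.
have IL : \int[mu]_(x in halfline) L x = wnorm W f + h * (lambda * wnorm W f +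
   (\int[mu]_(x in halfline) (`|(B \* f) x| * W x) +
   (\int[mu]_(x in halfline) (W x * Num.sg (f x) * tf' x) - \int[mu]_(x in halfline) (`|Ff x| * W x)))).
  rewrite /L RintegralD//; last by integrable_tac.
  rewrite RintegralZl//; last by integrable_tac.
  rewrite RintegralD//; [|by integrable_tac|by integrable_tac].
  rewrite RintegralZl// RintegralD//; last by integrable_tac.
  by rewrite RintegralB.
move: K'; rewrite RintegralD// => K'.
(* Kato's inequality and the dual bound have eliminated [tf'] and [Ff]: the integrand depends on
   $|f|$ only, and what remains to be shown is a pointwise inequality. *)
pose Q (x : R) : R := `|f x| * W x + h * (lambda * (`|f x| * W x) + (`|(B \* f) x| * W x -
   (tau x * `|f x| * derive1 W x + `|f x| * gain_weight p N x))).
have iQ : mu.-integrable halfline (EFin \o Q) by rewrite /Q; integrable_tac.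
have IQ : \int[mu]_(x in halfline) Q x = wnorm W f + h * (lambda * wnorm W f +
   (\int[mu]_(x in halfline) (`|(B \* f) x| * W x) -
   (\int[mu]_(x in halfline) (tau x * `|f x| * derive1 W x) +
    \int[mu]_(x in halfline) (`|f x| * gain_weight p N x)))).
  rewrite /Q RintegralD//; last by integrable_tac.
  rewrite RintegralZl//; last by integrable_tac.
  rewrite RintegralD//; [|by integrable_tac|by integrable_tac].
  rewrite RintegralZl// RintegralB//; last by integrable_tac.
  by rewrite RintegralD.
apply: (@le_trans _ _ (\int[mu]_(x in halfline) Q x)).
  rewrite /wnorm -RintegralZl// -RintegralZl// -RintegralD//; [|by integrable_tac|by integrable_tac].
  apply: le_Rintegral => //; first by integrable_tac.
  suff pw (x : R) : 0 < x -> (1 - h * (tau1 * (1 + p))) * (`|f x| * W x) +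
      h * (`|f x| * dissipation p N x) <= Q x.
    by move=> x; rewrite halflineE; exact: pw.
  move=> xgt0; have f0 := normr_ge0 (f x).
  have /andP[_ dT] := drift_trunc_power_le p0 N0 xgt0.
  rewrite /Q /= (normrM (B x)) (ger0_norm (B_ge0 xgt0)) derive1_trunc_weight//.
  have T0 := trunc_power_ge0 N p xgt0.
  rewrite /gain_weight -subr_ge0.
  set e := (X in 0 <= X).
  (* The [phi] parts of loss, drift and gain cancel, and so do the two dissipation terms; the rest
     is nonnegative by [drift_trunc_power_le] and $\lambda\ge0$. *)
  have -> : e = h * `|f x| * (tau1 * (1 + p) * trunc_weight p N x -
      tau x * derive1 (trunc_power N p) x + lambda * trunc_power N p x).
    by rewrite /e /W /trunc_weight; ring.
  rewrite !mulr_ge0// addr_ge0 ?subr_ge0//.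
  exact: mulr_ge0.
rewrite IL IQ lerD2l ler_wpM2l// lerD2l lerD2l opprD lerB//.
by rewrite lerNl -subr_ge0 opprK addrC.
Qed.

(** * Density of the domain *)

Let mB : measurable_fun halfline B. Proof. exact: continuous_halfline_measurable. Qed.

Lemma alpha_inf_lt a : 1 < a -> (alpha_inf wp < a%:E)%E.
Proof.
move=> a1; apply: (@le_lt_trans _ _ 1%:E); last by rewrite lte_fin.
apply: ereal_inf_lbound; exists 1 => //=; rewrite /wp_moment.
rewrite (_ : (\int[wp]_(z in `]0%R, 1%R[) (z `^ 1)%:E = \int[wp]_(z in `]0%R, 1%R[) z%:E)%E).
  by rewrite wp1 ltry.
by apply: eq_integral => z; rewrite inE/= in_itv/= => /andP[z0 _]; rewrite powRr1// ltW.
Qed.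

Lemma weight_continuous a x : 0 < x -> {for x, continuous (weight a)}.
Proof.
move=> x0; have x10 : 0 < 1 + x by rewrite ltr_wpDl.
have d := is_derive_addfun (is_derive_cst (1 : R) x 1) (is_derive_id x (1 : R)).
by apply: derivable_continuous; have [] := is_derive_compfun (is_derive1_powR a x10) d.
Qed.

(** Finiteness by duality: the pushed weight is at most [K * weight a], and its product with $B$ is
    integrable against the compactly supported [u]. *)
Lemma Fplus_Cc_L1 u a : 1 < a -> Cc u -> L1 (weight a) (Fplus_Cc B wp u).
Proof.
move=> a1 Cu; have mu_ := Cc_measurable Cu; have mF := measurable_Fplus_Cc wp B_cont mu_.
have mw := @measurable_weight R a.
apply/integrableP; split; first by apply/measurable_EFinP; exact: measurable_funM.
have w0 x : 0 < x -> 0 <= weight a x by move=> x0; rewrite ltW// weight_gt0.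
have wb x : 0 < x -> 0 <= weight a x <= 1 * weight a x by move=> x0; rewrite mul1r lexx w0.
have [K K0 hK] := pushed_weight_le (alpha_inf_lt a1) ler01 mw wb.
apply: (@le_lt_trans _ _ (\int[mu]_(x in halfline) (`|Fplus_Cc B wp u x| * weight a x)%:E)%E).
  apply: eq_lee; apply: eq_integral => x.
  by rewrite inE halflineE => x0; rewrite /= normrM (ger0_norm (w0 _ x0)).
apply: (le_lt_trans (Fplus_Cc_weight_le wp B_ge0 B_cont mu_ mw w0)).
have cBw x : 0 < x -> {for x, continuous (fun y => B y * (K * weight a y))}.
  move=> x0; apply: (@continuousM _ _ B (fun y => K * weight a y) x); first exact: B_cont.
  apply: (@continuousM _ _ (fun=> K) (weight a) x); first exact: cst_continuous.
  exact: weight_continuous.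
have := Cc_L1 Cu cBw => /integrableP[_]; apply: le_lt_trans.
apply: ge0_le_integral; [exact: mH| | | |].
- move=> x; rewrite halflineE => x0; apply: mule_ge0; first by rewrite lee_fin mulr_ge0// B_ge0.
  apply: integral_ge0 => z; rewrite /= in_itv/= => /andP[z0 _]; rewrite lee_fin.
  by rewrite w0// mulr_gt0.
- apply: emeasurable_funM.
    by apply/measurable_EFinP; apply: measurable_funM => //; exact: measurableT_comp.
  exact: measurable_pushed_weight.
- apply: measurableT_comp => //; apply/measurable_EFinP; apply: measurable_funM => //.
  by apply: measurable_funM => //; exact: measurable_funM.
- move=> x; rewrite halflineE => x0; rewrite /= !normrM (ger0_norm (B_ge0 x0)) (ger0_norm K0).
  rewrite (ger0_norm (w0 _ x0)) mulrA [X in (_ <= X)%E]EFinM lee_wpmul2l ?hK//.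
  by rewrite lee_fin mulr_ge0// B_ge0.
Qed.

Lemma L1norm_subrr w u : L1norm w (u \- u) = 0%E.
Proof. by rewrite /L1norm integral0_eq// => x _; rewrite /= subrr mul0r normr0. Qed.

(** The constant sequence shows that on $C_c$ the extension is given by the integral formula; the
    exponent 2 is admissible by [alpha_inf_lt]. *)
Lemma Fplus_of_Cc u : Cc u -> Fplus B wp u (Fplus_Cc B wp u).
Proof.
move=> Cu; have a1 : 1 < 1 + 1 :> R by rewrite ltrDl.
exists (1 + 1); split; [exact: alpha_inf_lt| |exact: Fplus_Cc_L1|].
  apply: Cc_L1 => // x x0.
  apply: (@continuousM _ _ (fun y => 1 + B y) (weight (1 + 1)) x); last exact: weight_continuous.
  by apply: cvgD; [exact: cvg_cst|exact: B_cont].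
exists (fun=> u); split=> //.
- by apply: cvg_near_cst; apply: nearW => n; exact: L1norm_subrr.
- by apply: cvg_near_cst; apply: nearW => n; exact: L1norm_subrr.
Qed.

Lemma phi_le_weight p x : 0 < p -> 0 < x -> phi x <= Cphi * weight (1 + p) x.
Proof.
move=> p0 xgt0; have x10 : 0 < 1 + x by rewrite ltr_wpDl.
have /andP[_ h] := phi_bounds xgt0; rewrite (le_trans h)// ler_wpM2l ?(ltW Cphi_gt0)//.
by rewrite /weight -[leLHS]powRr1 ?(ltW x10)// ler_powR ?lerDl ?(ltW xgt0) ?(ltW p0).
Qed.

Lemma weight_L1_phi p f : 0 < p -> L1 (weight (1 + p)) f -> L1 phi f.
Proof.
move=> p0; apply: (@L1_integrable _ _ _ Cphi); [exact: measurable_phi|exact: measurable_weight| |].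
- by move=> x; exact: weight_gt0.
- by move=> x xgt0; rewrite gtr0_norm ?phi_gt0// phi_le_weight.
Qed.

(** The domain asks for regularity of $\tau f$ and not of $f$; its elements are therefore built as
    $V/\tau$ from a differentiable [V]. *)
Lemma Cc_in_domain V dV : (forall x, 0 < x -> is_derive x 1 V (dV x)) -> Cc V -> Cc dV ->
  exists g, A0_plus_Fplus tau B wp lambda phi (fun x => V x * (tau x)^-1) g.
Proof.
move=> VdV CV CdV; set u := fun x => V x * (tau x)^-1.
have cphi := C1_continuous phi_C1; have ctau := C1_continuous tau_C1.
have Cu : Cc u.
  apply: CcM => // x x0; apply: (@continuousV _ _ tau x); first by rewrite gt_eqF// tau_gt0.
  exact: ctau.
have CBu : Cc (B \* u).
  by have := CcM Cu B_cont; congr Cc; apply/funext => x; rewrite /= mulrC.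
have tu x : 0 < x -> (tau \* u) x = V x.
  by move=> x0; rewrite /u /= mulrC divfK// gt_eqF// tau_gt0.
have a1 : 1 < 1 + 1 :> R by rewrite ltrDl.
have LF : L1 phi (Fplus_Cc B wp u).
  exact: (weight_L1_phi ltr01 (Fplus_Cc_L1 a1 Cu)).
have Lu := Cc_L1 Cu cphi; have LBu := Cc_L1 CBu cphi; have LdV := Cc_L1 CdV cphi.
exists (fun x => - dV x - lambda * u x - B x * u x + Fplus_Cc B wp u x).
exists dV, (Fplus_Cc B wp u); split => //.
- by split=> //; exact: Cc_weak_derivative VdV CV CdV tu.
- exists V; split; first by apply: aeW => x; rewrite halflineE; exact: tu.
    by case: CV.
  have [_ [a [b [a0 supp]]]] := CV.
  apply: cvg_near_cst; near=> x; apply: contrapT => /eqP Vx.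
  have x0 : 0 < x by near: x; exact: nbhs_right_gt.
  have /andP[ax _] := supp x x0 Vx.
  have : x < a by near: x; exact: nbhs_right_lt.
  by rewrite ltNge ax.
- exact: Fplus_of_Cc.
- split; last by apply: aeW.
  have := L1_add (-1) LdV (L1_add (- lambda) Lu (L1_add (-1) LBu LF)).
  congr (L1 _ _); apply/funext => x /=; ring.
Unshelve. all: by end_near.
Qed.

(** Density in $L^1_a$ and not merely in $L^1(\phi)$: the bounds to be extended have the $L^1_a$
    norm on the right. A function $g$ of compact support is approximated by $V_n/\tau$, with $V_n$ a
    mollification of $\tau g$. *)
Lemma domain_dense a f (e : R) : 1 < a -> L1 (weight a) f -> 0 < e ->
  exists f' g', [/\ A0_plus_Fplus tau B wp lambda phi f' g', L1 (weight a) f' &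
    wnorm (weight a) (fun x => f x - f' x) < e].
Proof.
move=> a1 Lf e0; have e20 : 0 < e / 2 by rewrite divr_gt0.
have cw x : 0 < x -> {for x, continuous (weight a)} by exact: weight_continuous.
have w0 x : 0 < x -> 0 < weight a x by exact: weight_gt0.
have w0W x : 0 < x -> 0 <= weight a x by move=> /w0/ltW.
have w1 x : 0 < x -> weight a x <= 1 * weight a x by rewrite mul1r.
have mw := @measurable_weight R a.
have ctau := C1_continuous tau_C1.
have citau x : 0 < x -> {for x, continuous (fun y => (tau y)^-1)}.
  by move=> x0; apply: (@continuousV _ _ tau x); [rewrite gt_eqF// tau_gt0|exact: ctau].
have [g [cg [l [r [l0 supp]]]] hg] := Cc_dense cw w0 Lf e20.
(* Outside $(0,\infty)$ the values of [tau] are arbitrary, but [g] vanishes there; the conditional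
   makes $\tau g$ continuous on the whole line. *)
pose K x := (if 0 < x then tau x else 1) * g x.
have KE x : 0 < x -> K x = tau x * g x by move=> x0; rewrite /K x0.
have suppK x : K x != 0 -> l <= x <= r by rewrite mulf_eq0 negb_or => /andP[_]; exact: supp.
have cK : continuous K.
  move=> x; have [x0|x0] := ltP 0 x.
    have h : (fun y => tau y * g y) y @[y --> x] --> tau x * g x.
      by apply: (@continuousM _ _ tau g x); [exact: ctau|exact: cg].
    change (K y @[y --> x] --> K x); rewrite KE//; apply: cvg_trans h; apply: near_eq_cvg.
    have nx : \forall y \near x, 0 < y by exact: lt_nbhsr.
    by apply: filterS nx => y y0; rewrite KE.
  have K0 y : y < l -> K y = 0.
    by move=> yl; apply: contrapT => /eqP/suppK/andP[ly _]; move: yl; rewrite ltNge ly.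
  change (K y @[y --> x] --> K x); rewrite K0; last exact: le_lt_trans l0.
  apply: cvg_near_cst; have nx : \forall y \near x, y < l by apply: lt_nbhsl; exact: le_lt_trans l0.
  by apply: filterS nx => y /K0.
have [V [dV [S [CV CdV VdV bV cvgV]]]] := mollification l0 cK suppK.
have Cg : Cc g by split; [move=> x _; exact: cg|exists l, r; split=> // x _; exact: supp].
have mg := Cc_measurable Cg; have Lg := Cc_L1 Cg cw.
have mit : measurable_fun halfline (fun y => (tau y)^-1) by exact: continuous_halfline_measurable.
have mVn n := Cc_measurable (CV n).
have LV n : L1 (weight a) (fun x => V n x * (tau x)^-1) by apply: Cc_L1 => //; exact: CcM.
pose D : set R := `[l / 2, r]%classic.
have mD : measurable D by exact: measurable_itv.
have l20 : 0 < l / 2 by rewrite divr_gt0.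
have DH : D `<=` (halfline : set R).
  by move=> x; rewrite halflineE /D/= in_itv/= => /andP[+ _]; exact: lt_le_trans.
have outD n x : ~ D x -> V n x = 0 /\ g x = 0.
  move=> xD; split; apply: contrapT => /eqP h; apply: xD; rewrite /D/= in_itv/=.
    exact: (bV n x).2.
  by have /andP[h1 h2] := supp x h; apply/andP; split=> //; lra.
(* Continuous on $[l/2,r]$, which contains the supports of [g] and of all the [V n], hence an
   integrable majorant there. *)
pose dom x := (`|S| * `|(tau x)^-1| + `|g x|) * weight a x.
have cdom x : 0 < x -> {for x, continuous dom}.
  move=> x0; apply: (@continuousM _ _ (fun x => `|S| * `|(tau x)^-1| + `|g x|) (weight a) x); last exact: cw.
  apply: (@continuousD _ _ _ (fun x => `|S| * `|(tau x)^-1|) (fun x => `|g x|) x).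
    apply: (@continuousM _ _ (fun=> `|S|) (fun x => `|(tau x)^-1|) x); first exact: cst_continuous.
    by apply: cvg_norm; exact: citau.
  by apply: cvg_norm; exact: cg.
have idom : mu.-integrable D (EFin \o dom) by exact: continuous_itv_integrable.
have pw x : D x -> `|g x - V n x * (tau x)^-1| * weight a x @[n --> \oo] --> (0 : R).
  move=> /DH; rewrite halflineE => x0.
  have -> : 0 = `|g x - K x * (tau x)^-1| * weight a x.
    by rewrite KE// mulrAC divff ?mul1r ?subrr ?normr0 ?mul0r// gt_eqF// tau_gt0.
  apply: cvgMl; apply: cvg_norm; apply: cvgB; first exact: cvg_cst.
  by apply: cvgMl; exact: cvgV.
have : \int[mu]_(x in D) (`|g x - V n x * (tau x)^-1| * weight a x) @[n --> \oo] -->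
    \int[mu]_(x in (D : set R)) (0 : R).
  apply: proj2; apply: (@Rintegral_dominated_convergence _ _ _ mu D
    (fun n x => `|g x - V n x * (tau x)^-1| * weight a x) (fun=> 0) dom mD).
  - move=> n; apply: (measurable_funS mH DH); apply: measurable_funM => //.
    apply: measurableT_comp => //; apply: measurable_funB => //.
    exact: (measurable_funM (mVn n) mit).
  - exact: measurable_cst.
  - by apply: aeW.
  - exact: idom.
  - move=> n x /DH; rewrite halflineE => x0.
    rewrite normrM normr_id (ger0_norm (w0W _ x0)) ler_wpM2r ?w0W//.
    rewrite (le_trans (ler_normB _ _))// addrC lerD2r normrM ler_wpM2r//.
    by rewrite (le_trans (bV n x).1)// ler_norm.
rewrite Rintegral_cst// mul0r => /cvgrPdist_lt/(_ _ e20)[n _ hn].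
exists (fun x => V n x * (tau x)^-1).
have [g' Ag'] := Cc_in_domain (fun x _ => VdV n x) (CV n) (CdV n).
exists g'; split => //.
apply: (@le_lt_trans _ _ (1 * wnorm (weight a) (fun x => f x - g x) +
    1 * wnorm (weight a) (fun x => g x - V n x * (tau x)^-1))).
  apply: (wnorm_le2 mw w0 mw w0W w1); [exact: L1_sub|exact: L1_sub|exact: L1_sub|].
  by move=> x; rewrite !mul1r (le_trans _ (ler_normD _ _))// addrA subrK.
rewrite !mul1r [ltRHS]splitr ltrD//.
have := hn n (leqnn n); rewrite sub0r normrN ger0_norm; last first.
  by apply: Rintegral_ge0 => x /DH; rewrite halflineE => xp; rewrite mulr_ge0// w0W.
apply: le_lt_trans; rewrite /wnorm (@Rintegral_support _ _ _ mu D)//.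
by move=> x _ /(outD n)[-> ->]; rewrite mul0r subrr normr0 mul0r.
Qed.

(** * Gain of the power gamma0 *)

Variable T : R -> (R -> R) -> R -> R.
Hypothesis TC0 : C0_semigroup phi T.
Hypothesis T_norm : forall (t : R) f, 0 <= t -> L1 phi f -> ge0_ae f ->
  L1norm phi (T t f) = L1norm phi f.
Hypothesis T_generator : forall f g, generator phi T f g <->
  closure_operator phi (A0_plus_Fplus tau B wp lambda phi) f g.

Local Notation W := trunc_weight.
Local Notation D := dissipation.
Local Notation rate p := (tau1 * (1 + p)).

Let mphi := measurable_phi.
Let phi0 := phi_gt0.

Let WC p N : 0 < p -> 0 < N -> forall x, 0 < x -> 0 <= W p N x <= Cphi * (1 + N `^ p) * phi x.
Proof.
move=> p0 N0 x xgt0; rewrite trunc_weight_le// andbT.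
by rewrite (le_trans _ (trunc_weight_ge p N xgt0))// addr_ge0// ltW.
Qed.

Let DC p N : 0 < p -> forall x, 0 < x ->
  0 <= D p N x <= gain p * N `^ (1 + p + gamma0) * Cphi * phi x.
Proof.
move=> p0 x xgt0; rewrite (dissipation_ge0 N x p0)/=.
exact: dissipation_le.
Qed.

Let mW p N : 0 < N -> measurable_fun halfline (W p N).
Proof. exact: measurable_trunc_weight. Qed.

Let mD p N : measurable_fun halfline (D p N).
Proof. exact: measurable_dissipation. Qed.

Let rate_ge0 p : 0 < p -> 0 <= rate p.
Proof. by move=> p0; rewrite mulr_ge0// addr_ge0// ltW. Qed.

Lemma generator_dissipative p N f g (h : R) : 0 < p -> 0 < N -> generator phi T f g ->
  0 <= h -> h * rate p <= 1 ->
  (1 - h * rate p) * wnorm (W p N) f + h * wnorm (D p N) f <=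
  wnorm (W p N) (fun x => f x - h * g x).
Proof.
move=> p0 N0 /T_generator gen h0 hr.
apply: (closure_dissipative mphi phi0 (mW p N0) (WC p0 N0) (mD p N) (DC N p0) h0 hr _ gen).
move=> f' g' A; split.
- by case: A => ? [? [[]]].
- by case: A => ? [? [_ _ _ _ []]].
- exact: A0_dissipative.
Qed.

Let euler p N (t e : R) f g (p0 : 0 < p) (N0 : 0 < N) :=
  @euler_bound R phi T mphi phi0 TC0 T_norm (W p N) (D p N) _ _ (rate p) (rate_ge0 p0)
   (mW p N0) (WC p0 N0) (DC N p0) (fun f g h => @generator_dissipative p N f g h p0 N0)
   t e f g.

(** [euler_bound] started from $T_sf$, which is still in the domain of the generator, over the time
    $t-s$. *)
Lemma generator_growth p N s t f g : 0 < p -> 0 < N -> 0 <= s -> s <= t -> generator phi T f g ->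
  wnorm (W p N) (T t f) <= expR (2 * rate p * (t - s)) * wnorm (W p N) (T s f).
Proof.
move=> p0 N0 s0 st gen; have [Lf _ _] := gen.
move: st; rewrite le_eqVlt => /predU1P[<-|st]; first by rewrite subrr mulr0 expR0 mul1r.
have ts0 : 0 < t - s by rewrite subr_gt0.
have LS := T_L1 TC0 s0 Lf.
have e1 : eq_ae (T t f) (T (t - s) (T s f)).
  by have := semigroup_D TC0 (ltW ts0) s0 Lf; rewrite subrK.
rewrite (wnorm_ae mphi phi0 (mW p N0) (T_L1 TC0 (ltW (le_lt_trans s0 st)) Lf)
  (T_L1 TC0 (ltW ts0) LS) e1).
apply: (@ler_eps _ _ _ (expR (2 * rate p * (t - s)))) => e e0.
have [+ _] := euler p0 N0 ts0 e0 (generator_T mphi phi0 TC0 T_norm s0 gen).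
by rewrite mulrDr.
Qed.

(** Three regions for the power part: below [xB] it is at most a multiple of [phi]; on $[x_B,N]$ it
    is at most the dissipated weight over [gain p]; beyond [N] it is at most $M^{p+\gamma_0}x$,
    while [trunc_id] at level [N] is at least $N/2$. The last coefficient tends to 0 as $N\to\infty$
    at fixed [M]. *)
Lemma trunc_weight_split p N M x : 0 < p -> 0 < M -> 0 < N -> xB <= N -> 0 < x ->
  W (p + gamma0) M x <= Cphi * (1 + xB `^ (p + gamma0)) * phi x + (gain p)^-1 * D p N x +
    M `^ (p + gamma0) * (2 / N) `^ p * W p N x.
Proof.
move=> p0 M0 N0 xN xgt0.
have q0 : 0 < p + gamma0 by rewrite addr_gt0.
have g0 := gain_gt0 p0.
have Wn0 := WC p0 N0 xgt0; have /andP[Wn _] := Wn0.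
have /andP[Dn _] := DC N p0 xgt0.
have ph := phi0 xgt0.
have x1 : x <= Cphi * phi x by rewrite (le_trans _ (one_le_phi xgt0))// lerDr.
have ti0 := trunc_id_gt0 M0 xgt0; have tix := trunc_id_le M0 xgt0; have tiM := trunc_id_leN M0 xgt0.
rewrite /trunc_weight -/(W p N x) mulrDr mulr1 mulrDl -!addrA lerD2l.
have c1 : 0 <= Cphi * xB `^ (p + gamma0) * phi x.
  by rewrite mulr_ge0 ?(ltW ph)// mulr_ge0 ?powR_ge0// ltW.
have c2 : 0 <= (gain p)^-1 * D p N x by rewrite mulr_ge0// invr_ge0 ltW.
have c3 : 0 <= M `^ (p + gamma0) * (2 / N) `^ p * W p N x.
  by rewrite mulr_ge0// mulr_ge0// powR_ge0.
have [xx0|xx0] := ltP x xB.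
  rewrite (@le_trans _ _ (Cphi * xB `^ (p + gamma0) * phi x)) ?lerDl ?addr_ge0//.
  rewrite mulrAC /trunc_power; apply: ler_pM => //; [exact: ltW|exact: powR_ge0|].
  by rewrite ge0_ler_powR ?nnegrE ?(ltW q0) ?(ltW ti0) ?(ltW xB_gt0)// (le_trans tix)// ltW.
have [xN'|xN'] := leP x N.
  rewrite (@le_trans _ _ ((gain p)^-1 * D p N x))//; last by rewrite addrCA lerDl addr_ge0.
  rewrite /dissipation indicE mem_set/=; last by rewrite in_itv/= xx0.
  rewrite mulr1 mulrA mulVf ?gt_eqF// mul1r /trunc_power -addrA [leRHS]powRD; last first.
    by rewrite (gt_eqF xgt0) implybT.
  rewrite powRr1 ?(ltW xgt0)// ler_wpM2l ?(ltW xgt0)//.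
  by rewrite ge0_ler_powR ?nnegrE ?(ltW q0) ?(ltW ti0) ?(ltW xgt0).
rewrite (@le_trans _ _ (M `^ (p + gamma0) * (2 / N) `^ p * W p N x))//; last by rewrite addrA lerDr addr_ge0.
rewrite /trunc_power mulrC -mulrA ler_pM ?powR_ge0 ?(ltW xgt0)//.
  by rewrite ge0_ler_powR ?nnegrE ?(ltW q0) ?(ltW ti0) ?(ltW M0).
rewrite (@le_trans _ _ ((2 / N) `^ p * trunc_power N p x))//; last first.
  by rewrite ler_wpM2l ?powR_ge0// /trunc_weight lerDr mulr_ge0// ltW.
rewrite /trunc_power mulrCA ler_peMr ?(ltW xgt0)//.
have tN := trunc_id_ge_halfN N0 (ltW xN').
have N2 : 0 < N / 2 by rewrite divr_gt0.
have n2 : 0 <= 2 / N by rewrite divr_ge0// ltW.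
have ti2 : 0 <= trunc_id N x by rewrite (le_trans _ tN)// ltW.
rewrite -powRM//.
rewrite (@le_trans _ _ (1 `^ p))//; first by rewrite powR1.
rewrite ge0_ler_powR ?nnegrE ?(ltW p0)//; first exact: mulr_ge0.
rewrite (@le_trans _ _ (2 / N * (N / 2)))//; last by rewrite ler_wpM2l.
by rewrite mulrA divfK ?gt_eqF// divff.
Qed.

Lemma trunc_weight_le_weight p N x : 0 < p -> 0 < N -> 0 < x ->
  W p N x <= (Cphi * Cphi + 1) * weight (1 + p) x.
Proof.
move=> p0 N0 xgt0; have x1 : 1 <= 1 + x by rewrite lerDl ltW.
have x10 : 0 < 1 + x by rewrite (lt_le_trans ltr01).
have /andP[_ h] := phi_bounds xgt0.
have e1 : 1 + x <= weight (1 + p) x.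
  by rewrite /weight -[leLHS]powRr1 ?(ltW x10)// ler_powR// lerDl ltW.
rewrite /trunc_weight mulrDl mul1r -mulrA; apply: lerD.
  by rewrite ler_wpM2l ?(ltW Cphi_gt0)// (le_trans h)// ler_wpM2l ?(ltW Cphi_gt0).
rewrite /weight powRD; last by rewrite (gt_eqF x10) implybT.
rewrite powRr1 ?(ltW x10)// (le_trans (trunc_power_le N0 p0 xgt0))//.
rewrite powRD; last by rewrite (gt_eqF xgt0) implybT.
rewrite powRr1 ?(ltW xgt0)//; apply: ler_pM; rewrite ?powR_ge0 ?lerDr ?(ltW xgt0)//.
by rewrite ge0_ler_powR ?nnegrE ?lerDr ?(ltW p0) ?(ltW x10) ?(ltW xgt0).
Qed.

(** Puts bounded terms into the common form with a factor $1/t$, by $t\le\mathrm e^t$. *)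
Lemma le_expR_div (c t : R) : 0 < t -> 0 <= c -> c <= expR t / t * c.
Proof.
move=> t0 c0; rewrite ler_peMl// ler_pdivlMr// mul1r.
by rewrite (le_trans _ (expR_ge1Dx t))// lerDr.
Qed.

(** At the time $s$ given by [euler_bound], [trunc_weight_split] bounds the stronger norm:
    contraction controls its [phi] term, dissipation its middle term, growth at exponent $p$ its
    tail. The level [N] depends on [M], $f$ and the error $e$, the constant [C] on none of them. *)
Lemma generator_smoothing p : 0 < p -> exists2 C : R, 0 < C &
  forall M t f g, 0 < M -> 0 < t -> generator phi T f g -> L1 (weight (1 + p)) f ->
    wnorm (W (p + gamma0) M) (T t f) <=
    C / t * expR ((2 * rate p + 2 * rate (p + gamma0) + 1) * t) * wnorm (weight (1 + p)) f.
Proof.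
move=> p0; have q0 : 0 < p + gamma0 by rewrite addr_gt0.
have g0 := gain_gt0 p0.
pose K1 := Cphi * Cphi + 1; pose K2 := Cphi * (1 + xB `^ (p + gamma0)).
have K10 : 0 < K1 by rewrite ltr_pwDr// mulr_ge0 ?(ltW Cphi_gt0).
have K20 : 0 < K2 by rewrite mulr_gt0// ltr_pwDl// powR_ge0.
exists (K2 * Cphi + (gain p)^-1 * K1).
  by rewrite addr_gt0// mulr_gt0// invr_gt0.
move=> M t f g M0 t0 gen wf; have [Lf _ _] := gen; have t0W := ltW t0.
set F := wnorm (weight (1 + p)) f.
have mw := @measurable_weight R (1 + p).
have w0 x : 0 < x -> 0 < weight (1 + p) x by exact: weight_gt0.
have F0 : 0 <= F by apply: wnorm_ge0 => x /w0/ltW.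
pose a := rate p; pose b := rate (p + gamma0).
have a0 : 0 <= a by exact: rate_ge0.
have b0 : 0 <= b by exact: rate_ge0.
have phi0W x : 0 < x -> 0 <= phi x by move=> /phi0/ltW.
have phi1 x : 0 < x -> phi x <= 1 * phi x by rewrite mul1r.
have Fphi : wnorm phi f <= Cphi * F.
  by apply: (wnorm_le_phi mw w0 mphi phi0W) => // x xgt0; exact: phi_le_weight.
(* The coefficient collects the error of [euler_bound], amplified by [(gain p)^-1 / t], and the tail
   term, made at most $e$ by the choice of [N]. *)
apply: (@ler_eps _ _ _ (expR ((2 * a + 2 * b + 1) * t) * ((gain p)^-1 / t + 1))) => e e0.
pose Z := M `^ (p + gamma0) * K1 * F.
have Z0 : 0 <= Z by rewrite mulr_ge0// mulr_ge0 ?powR_ge0// ltW.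
(* Chosen so that the tail term $Z(2/N)^p$ is at most $e$; the summand 1 keeps the base positive
   when $Z=0$. *)
pose N := Num.max xB (2 * (Z / e + 1) `^ p^-1).
have Ze : 0 < Z / e + 1 by rewrite ltr_wpDl// divr_ge0// ltW.
have N0 : 0 < N by rewrite lt_max xB_gt0.
have xN : xB <= N by rewrite le_max lexx.
have eN : M `^ (p + gamma0) * (2 / N) `^ p * (K1 * F) <= e.
  rewrite mulrAC mulrA mulrAC -/Z mulrAC -/Z.
  have : (2 / N) `^ p <= (Z / e + 1)^-1.
    have y0 : 0 < (Z / e + 1) `^ p^-1 by rewrite powR_gt0.
    have h : 2 / N <= ((Z / e + 1) `^ p^-1)^-1.
      rewrite ler_pdivrMr// mulrC ler_pdivlMr//.
      by rewrite le_max lexx orbT.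
    apply: (@le_trans _ _ ((((Z / e + 1) `^ p^-1)^-1) `^ p)).
      rewrite ge0_ler_powR ?nnegrE ?(ltW p0)//; first by rewrite divr_ge0// ltW.
      by rewrite invr_ge0 ltW.
    rewrite -powRN -powRrM mulNr mulVf ?gt_eqF// powR_inv1// ltW//.
  move=> h; rewrite (le_trans (ler_wpM2l Z0 h))// ler_pdivrMr// mulrDr mulr1 mulrCA divff ?gt_eqF//.
  by rewrite mulr1 lerDl ltW.
set WN := wnorm (W p N) f.
have WNF : WN <= K1 * F.
  apply: (wnorm_le_phi mw w0 (mW p N0)) => // x xgt0; first by have /andP[] := WC p0 N0 xgt0.
  exact: trunc_weight_le_weight.
have [_ [s /andP[s0 st] Ds]] := euler p0 N0 t0 e0 gen.
have s0W := ltW s0; have LS := T_L1 TC0 s0W Lf.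
apply: (le_trans (generator_growth q0 M0 s0W st gen)).
have split3 : wnorm (W (p + gamma0) M) (T s f) <=
    K2 * wnorm phi (T s f) + (gain p)^-1 * wnorm (D p N) (T s f) +
    M `^ (p + gamma0) * (2 / N) `^ p * wnorm (W p N) (T s f).
  have [I1 I2] : mu.-integrable halfline (EFin \o (fun x => `|T s f x| * phi x)) /\
      mu.-integrable halfline (EFin \o (fun x => `|T s f x| * D p N x)).
    split; first exact: (wnorm_integrable mphi phi0 mphi phi0W phi1).
    apply: (wnorm_integrable mphi phi0 (mD p N) _ _ LS) => x xgt0.
      by have /andP[] := DC N p0 xgt0.
    by have /andP[] := DC N p0 xgt0; move=> _; exact.
  have Iw n r : 0 < r -> 0 < n -> mu.-integrable halfline (EFin \o (fun x => `|T s f x| * W r n x)).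
    move=> r0 n0; apply: (wnorm_integrable mphi phi0 (mW r n0) _ _ LS) => x xgt0.
      by have /andP[] := WC r0 n0 xgt0.
    by have /andP[] := WC r0 n0 xgt0; move=> _; exact.
  have I3 := Iw N p p0 N0; have I4 := Iw M (p + gamma0) q0 M0.
  have Sc c (u : R -> R) : mu.-integrable halfline (EFin \o u) ->
    mu.-integrable halfline (EFin \o (fun x => c * u x)) by exact: integrable_scalefun.
  rewrite /wnorm -!RintegralZl//.
  rewrite -RintegralD//; [|exact: Sc|exact: Sc].
  rewrite -RintegralD//; [|by apply: integrable_addfun => //; exact: Sc|exact: Sc].
  apply: le_Rintegral => //.
    by apply: integrable_addfun; [exact: mH|apply: integrable_addfun; [exact: mH|exact: Sc|exact: Sc]|exact: Sc].
  move=> x; rewrite halflineE => xgt0.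
  rewrite (le_trans (ler_wpM2l (normr_ge0 _) (trunc_weight_split p0 M0 N0 xN xgt0)))//.
  apply: eq_ler; rewrite /K2; ring.
have ex1 : 1 <= expR (2 * a * t) by rewrite -[leLHS]expR0 ler_expR mulr_ge0// mulr_ge0.
have c1 : K2 * wnorm phi (T s f) <= expR (2 * a * t) * (expR t / t * (K2 * Cphi * F)).
  rewrite (@le_trans _ _ (K2 * Cphi * F))//.
    rewrite -mulrA ler_wpM2l ?(ltW K20)// (le_trans _ Fphi)//.
    exact: T_contraction mphi phi0 TC0 T_norm _ _ s0W Lf.
  have k0 : 0 <= K2 * Cphi * F by rewrite mulr_ge0// mulr_ge0 ?(ltW K20) ?(ltW Cphi_gt0).
  rewrite (le_trans (le_expR_div t0 k0))// ler_peMl// mulr_ge0// divr_ge0// expR_ge0.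
have et1 : 1 <= expR t by rewrite -[leLHS]expR0 ler_expR.
have c2 : (gain p)^-1 * wnorm (D p N) (T s f) <=
    expR (2 * a * t) * (expR t / t * ((gain p)^-1 * K1 * F + (gain p)^-1 * e)).
  rewrite (@le_trans _ _ ((gain p)^-1 * (expR (2 * a * t) * (K1 * F + e) / t)))//.
    rewrite ler_wpM2l ?invr_ge0 ?(ltW g0)// (le_trans Ds)// ler_wpM2r ?invr_ge0//.
    by rewrite ler_wpM2l ?expR_ge0// lerD2r.
  rewrite [leLHS](_ : _ = expR (2 * a * t) * ((gain p)^-1 * (K1 * F + e) / t)); last by ring.
  rewrite ler_wpM2l ?expR_ge0// [leRHS](_ : _ = expR t * ((gain p)^-1 * (K1 * F + e) / t)); last by ring.
  rewrite ler_peMl// divr_ge0// mulr_ge0 ?invr_ge0 ?(ltW g0)// addr_ge0 ?(ltW e0)//.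
  by rewrite mulr_ge0 ?(ltW K10).
have c3 : M `^ (p + gamma0) * (2 / N) `^ p * wnorm (W p N) (T s f) <=
    expR (2 * a * t) * (expR t * e).
  have P0 : 0 <= M `^ (p + gamma0) * (2 / N) `^ p by rewrite mulr_ge0 ?powR_ge0.
  have gr : wnorm (W p N) (T s f) <= expR (2 * a * t) * (K1 * F).
    apply: (le_trans (generator_growth p0 N0 (lexx 0) s0W gen)); rewrite subr0.
    apply: ler_pM; [exact: expR_ge0| | |].
    - by apply: wnorm_ge0 => x /(WC p0 N0)/andP[].
    - by rewrite ler_expR ler_wpM2l// mulr_ge0.
    - rewrite (le_trans _ WNF)//; apply: eq_ler; apply: (wnorm_ae mphi phi0 (mW p N0)) => //; first exact: T_L1.
      exact: (semigroup_0 TC0).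
  rewrite (le_trans (ler_wpM2l P0 gr))// mulrCA ler_wpM2l ?expR_ge0// (le_trans eN)//.
  by rewrite ler_peMl// ltW.
have := lerD (lerD c1 c2) c3 => c123.
rewrite (le_trans (ler_wpM2l (expR_ge0 _) (le_trans split3 c123)))//.
have e1 : expR (2 * rate (p + gamma0) * (t - s)) <= expR (2 * b * t).
  rewrite ler_expR ler_wpM2l//; first by rewrite mulr_ge0.
  by rewrite gerBl.
pose Q := expR t / t * (K2 * Cphi * F + ((gain p)^-1 * K1 * F + (gain p)^-1 * e)) + expR t * e.
have Q0 : 0 <= Q.
  have i0 : 0 <= (gain p)^-1 by rewrite invr_ge0 ltW.
  have q1 : 0 <= expR t / t by rewrite divr_ge0// expR_ge0.
  have q2 : 0 <= K2 * Cphi * F by rewrite mulr_ge0// mulr_ge0 ?(ltW K20) ?(ltW Cphi_gt0).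
  have q3 : 0 <= (gain p)^-1 * K1 * F by rewrite mulr_ge0// mulr_ge0 ?(ltW K10).
  have q4 : 0 <= (gain p)^-1 * e by rewrite mulr_ge0// ltW.
  have q5 : 0 <= expR t * e by rewrite mulr_ge0 ?expR_ge0// ltW.
  by apply: addr_ge0 => //; apply: mulr_ge0 => //; apply: addr_ge0 => //; exact: addr_ge0.
rewrite [leLHS](_ : _ = expR (2 * rate (p + gamma0) * (t - s)) * (expR (2 * a * t) * Q)); last first.
  by rewrite /Q; ring.
rewrite (le_trans (ler_wpM2r (mulr_ge0 (expR_ge0 _) Q0) e1))//.
rewrite -/a -/b (_ : expR ((2 * a + 2 * b + 1) * t) = expR (2 * b * t) * (expR (2 * a * t) * expR t)); last first.
  by rewrite -!expRD; congr expR; ring.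
apply: eq_ler; rewrite /Q /F; ring.
Qed.

(** The factor $2^{1+q}$ comes from $1+x\le2\max(1,x)$, the factor $2^q$ from [trunc_id_ge_half],
    used for $1<x\le M$. *)
Lemma trunc_weight_ge_weight q M x : 0 < q -> 0 < x -> x <= M ->
  weight (1 + q) x <= 2 `^ (1 + q) * 2 `^ q * W q M x.
Proof.
move=> q0 x0' xM; have M0 := lt_le_trans x0' xM.
have W1 := trunc_weight_ge q M x0'.
have c0 : 0 <= 2 `^ (1 + q) :> R by exact: powR_ge0.
have c1 : 1 <= 2 `^ q :> R.
  by rewrite -[leLHS](powRr0 2) ler_powR ?ler1n// ltW.
have W0 : 0 <= W q M x by rewrite (le_trans _ W1)// addr_ge0// ltW.
have q1 : 0 <= 1 + q by rewrite addr_ge0// ltW.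
rewrite -mulrA; have [x1|x1] := leP x 1.
  rewrite (@le_trans _ _ (2 `^ (1 + q) * 1))//.
    by rewrite mulr1 /weight ge0_ler_powR ?nnegrE ?addr_ge0 ?(ltW x0')//; lra.
  rewrite ler_wpM2l// (@le_trans _ _ (1 * W q M x))// ?ler_wpM2r//.
  by rewrite mul1r (le_trans _ W1)// lerDl ltW.
rewrite (@le_trans _ _ (2 `^ (1 + q) * x `^ (1 + q)))//.
  rewrite -powRM ?(ltW x0')// /weight ge0_ler_powR ?nnegrE ?addr_ge0 ?mulr_ge0 ?(ltW x0')//; lra.
rewrite ler_wpM2l// (@le_trans _ _ (2 `^ q * trunc_power M q x))//; last first.
  by rewrite ler_wpM2l ?powR_ge0// /trunc_weight lerDr mulr_ge0// ltW// phi0.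
rewrite powRD; last by rewrite (gt_eqF x0') implybT.
rewrite powRr1 ?(ltW x0')// /trunc_power mulrCA ler_wpM2l ?(ltW x0')//.
have ti := trunc_id_ge_half M0 x0' xM.
have x20 : 0 <= x / 2 by rewrite divr_ge0// ltW.
have ti0 : 0 <= trunc_id M x := le_trans x20 ti.
set y := trunc_id M x in ti ti0 *.
have y0 : 0 <= 2 * y by exact: mulr_ge0.
have y2 : x <= 2 * y by lra.
by rewrite -powRM// ge0_ler_powR ?nnegrE ?(ltW q0) ?(ltW x0').
Qed.

(** Two limits: at fixed [M] the weight is dominated by [phi], so that the bound extends by density
    from the domain of the generator; as [K] does not depend on [M], the truncation is then removed
    by exhausting $(0,\infty)$. *)
Lemma weight_bound p q t (K : R) : 0 < p -> 0 < q -> 0 < t -> 0 <= K ->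
  (forall M f g, 0 < M -> generator phi T f g -> L1 (weight (1 + p)) f ->
    wnorm (W q M) (T t f) <= K * wnorm (weight (1 + p)) f) ->
  forall f, L1 (weight (1 + p)) f -> L1 (weight (1 + q)) (T t f) /\
    wnorm (weight (1 + q)) (T t f) <= 2 `^ (1 + q) * 2 `^ q * K * wnorm (weight (1 + p)) f.
Proof.
move=> p0 q0 t0 K0 hK f Lf; have t0W := ltW t0.
have mw := @measurable_weight R (1 + p).
have w0 x : 0 < x -> 0 < weight (1 + p) x by exact: weight_gt0.
have w0W x : 0 < x -> 0 <= weight (1 + p) x by move=> /w0/ltW.
have w1 x : 0 < x -> weight (1 + p) x <= 1 * weight (1 + p) x by rewrite mul1r.
have phi0W x : 0 < x -> 0 <= phi x by move=> /phi0/ltW.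
have L1p u : L1 (weight (1 + p)) u -> L1 phi u.
  exact: (weight_L1_phi p0).
have LTf := T_L1 TC0 t0W (L1p _ Lf).
set F := wnorm (weight (1 + p)) f.
have F0 : 0 <= F by exact: wnorm_ge0.
have trunc M : 0 < M -> wnorm (W q M) (T t f) <= K * F.
  move=> M0; set CM := Cphi * (1 + M `^ q).
  have CM0 : 0 <= CM by rewrite mulr_ge0 ?(ltW Cphi_gt0)// addr_ge0// powR_ge0.
  apply: (@ler_eps _ _ _ (K + CM * Cphi)) => e e0.
  have a1 : 1 < 1 + p by rewrite ltrDl.
  have [f' [g' [Afg Lf' fe]]] := domain_dense a1 Lf e0.
  have gen : generator phi T f' g'.
    apply/T_generator; split.
    - by case: Afg => ? [? [[]]].
    - by case: Afg => ? [? [_ _ _ _ []]].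
    - by move=> eps eps0; exists f', g'; split; rewrite ?L1norm_subrr ?lte_fin.
  have LTf' := T_L1 TC0 t0W (L1p _ Lf').
  have Ld := L1_sub Lf Lf'.
  have W0 x : 0 < x -> 0 <= W q M x by move=> /(WC q0 M0)/andP[].
  have W1 x : 0 < x -> W q M x <= CM * phi x by move=> /(WC q0 M0)/andP[].
  have lip := wnorm_lip mphi phi0 (mW q M0) W0 W1 LTf LTf'.
  apply: (le_trans lip).
  have e1 : eq_ae (T t (fun x => f x - f' x)) (fun x => T t f x - T t f' x).
    have := T_lin TC0 (-1) t0W (L1p _ Lf') (L1p _ Lf).
    rewrite (_ : (fun x => -1 * f' x + f x) = (fun x => f x - f' x)); last first.
      by apply/funext => x; rewrite mulN1r addrC.
    by apply: aeS => x E Hx; rewrite (E Hx) mulN1r addrC.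
  rewrite -(wnorm_ae mphi phi0 mphi (T_L1 TC0 t0W (L1p _ Ld)) (L1_sub LTf LTf') e1).
  have c1 : wnorm phi (T t (fun x => f x - f' x)) <= Cphi * e.
    rewrite (le_trans (T_contraction mphi phi0 TC0 T_norm t0W (L1p _ Ld)))//.
    rewrite (@le_trans _ _ (Cphi * wnorm (weight (1 + p)) (fun x => f x - f' x)))//.
      by apply: (wnorm_le_phi mw w0 mphi phi0W) => // x x0'; exact: phi_le_weight.
    by rewrite ler_wpM2l ?(ltW Cphi_gt0)// ltW.
  have c2 : wnorm (weight (1 + p)) f' <= F + e.
    rewrite (@le_trans _ _ (1 * F + 1 * wnorm (weight (1 + p)) (fun x => f x - f' x)))//.
      apply: (wnorm_le2 mw w0 mw w0W w1) => // x; rewrite !mul1r.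
      by rewrite -[X in `|X| <= _](subKr (f x)) ler_normB.
    by rewrite !mul1r lerD2l ltW.
  rewrite (le_trans (lerD (le_trans (hK M f' g' M0 gen Lf') (ler_wpM2l K0 c2)) (ler_wpM2l CM0 c1)))//.
  by apply: eq_ler; ring.
set C := 2 `^ (1 + q) * 2 `^ q.
have C0 : 0 <= C by rewrite mulr_ge0// powR_ge0.
have mTf := L1_measurable mphi phi0 LTf.
have mq := @measurable_weight R (1 + q).
have q0W x : 0 < x -> 0 <= weight (1 + q) x by move=> x0'; rewrite ltW// weight_gt0.
have bound : (\int[mu]_(x in halfline) (`|T t f x| * weight (1 + q) x)%:E <= (C * K * F)%:E)%E.
  have mi : measurable_fun halfline (fun x => `|T t f x| * weight (1 + q) x).
    by apply: measurable_funM => //; exact: measurableT_comp.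
  apply: ge0_integral_halfline_le.
  - exact/measurable_EFinP.
  - by move=> x x0'; rewrite lee_fin mulr_ge0// q0W.
  (* The level $n+1$ is positive even for $n=0$, and it is at least $n$, so that
     [trunc_weight_ge_weight] applies on $(0,n]$. *)
  move=> n; pose M : R := n.+1%:R; have M0 : 0 < M by rewrite ltr0n.
  have sub : `]0%R, n%:R]%classic `<=` (halfline : set R).
    by move=> x; rewrite halflineE/= in_itv/= => /andP[].
  have iW : mu.-integrable halfline (EFin \o (fun x => `|T t f x| * W q M x)).
    apply: (wnorm_integrable mphi phi0 (mW q M0) _ _ LTf) => x x0'.
      by have /andP[] := WC q0 M0 x0'.
    by have /andP[] := WC q0 M0 x0'; move=> _; exact.
  have iCW : mu.-integrable halfline (EFin \o (fun x => C * (`|T t f x| * W q M x))).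
    exact: integrable_scalefun.
  apply: (@le_trans _ _ (\int[mu]_(x in halfline) (C * (`|T t f x| * W q M x))%:E)%E); last first.
    have fin : (\int[mu]_(x in halfline) (C * (`|T t f x| * W q M x))%:E)%E \is a fin_num.
      exact: integrable_fin_num iCW.
    rewrite -(fineK fin) lee_fin.
    have -> : fine (\int[mu]_(x in halfline) (C * (`|T t f x| * W q M x))%:E)%E =
        C * wnorm (W q M) (T t f) by rewrite /wnorm -RintegralZl.
    by rewrite -mulrA ler_wpM2l// trunc.
  apply: (@le_trans _ _ (\int[mu]_(x in `]0%R, n%:R]) (C * (`|T t f x| * W q M x))%:E)%E).
    apply: ge0_le_integral; [exact: measurable_itv| | | |].
    - by move=> x /sub; rewrite halflineE => x0'; rewrite lee_fin mulr_ge0// q0W.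
    - by apply/measurable_EFinP; apply: measurable_funS mi.
    - exact: (measurable_funS mH sub (measurable_int mu iCW)).
    - move=> x; rewrite /= in_itv/= => /andP[x0' xn]; rewrite lee_fin mulrCA ler_wpM2l//.
      by apply: trunc_weight_ge_weight => //; rewrite (le_trans xn)// ler_nat leqnSn.
  apply: ge0_subset_integral => //; first exact: (measurable_int mu iCW).
  move=> x; rewrite halflineE => x0'; rewrite lee_fin mulr_ge0// mulr_ge0//.
  by have /andP[] := WC q0 M0 x0'.
have LQ : L1 (weight (1 + q)) (T t f).
  apply/integrableP; split; first by apply/measurable_EFinP; exact: measurable_funM.
  apply: (@le_lt_trans _ _ (\int[mu]_(x in halfline) (`|T t f x| * weight (1 + q) x)%:E)%E).
    apply: eq_lee; apply: eq_integral => x.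
    by rewrite inE halflineE => x0'; rewrite /= normrM (ger0_norm (q0W _ x0')).
  by rewrite (le_lt_trans bound)// ltry.
split=> //; rewrite -lee_fin -(L1normE q0W LQ); apply: le_trans bound.
apply: eq_lee; apply: eq_integral => x.
by rewrite inE halflineE => x0'; rewrite /= normrM (ger0_norm (q0W _ x0')).
Qed.

Lemma weight_growth p : 0 < p -> exists C c : R, [/\ 0 < C, 0 < c & forall f t, 0 < t ->
  L1 (weight (1 + p)) f -> L1 (weight (1 + p)) (T t f) /\
    wnorm (weight (1 + p)) (T t f) <= C * expR (c * t) * wnorm (weight (1 + p)) f].
Proof.
move=> p0; pose K1 := Cphi * Cphi + 1.
have K10 : 0 < K1 by rewrite ltr_pwDr// mulr_ge0 ?(ltW Cphi_gt0).
(* The summand 1 makes the rate positive, [tau1] being assumed nonnegative here. *)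
exists (2 `^ (1 + p) * 2 `^ p * K1), (2 * rate p + 1); split.
- by rewrite mulr_gt0// mulr_gt0// powR_gt0.
- by rewrite ltr_wpDl// mulr_ge0// rate_ge0.
move=> f t t0 Lf; have t0W := ltW t0.
have mw := @measurable_weight R (1 + p).
have w0 x : 0 < x -> 0 < weight (1 + p) x by exact: weight_gt0.
rewrite [X in _ <= X](_ : _ = 2 `^ (1 + p) * 2 `^ p * (K1 * expR ((2 * rate p + 1) * t)) *
  wnorm (weight (1 + p)) f); last by ring.
apply: weight_bound => //; first by rewrite mulr_ge0 ?(ltW K10)// expR_ge0.
move=> M {}f g M0 gen {}Lf; have [Lfp _ _] := gen.
have gr := generator_growth p0 M0 (lexx 0) t0W gen.
have E0 := wnorm_ae mphi phi0 (mW p M0) (T_L1 TC0 (lexx 0) Lfp) Lfp (semigroup_0 TC0 Lfp).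
rewrite E0 subr0 in gr; apply: (le_trans gr).
rewrite [leRHS](_ : _ = expR ((2 * rate p + 1) * t) * (K1 * wnorm (weight (1 + p)) f)); last by ring.
apply: ler_pM; [exact: expR_ge0| | |].
- by apply: wnorm_ge0 => x /(WC p0 M0)/andP[].
- by rewrite ler_expR ler_wpM2r// lerDl.
- apply: (wnorm_le_phi mw w0 (mW p M0)) => // x xgt0; first by have /andP[] := WC p0 M0 xgt0.
  exact: trunc_weight_le_weight.
Qed.

Lemma weight_smoothing p : 0 < p -> exists C c : R, [/\ 0 < C, 0 < c & forall f t, 0 < t ->
  L1 (weight (1 + p)) f -> L1 (weight (1 + p + gamma0)) (T t f) /\
    wnorm (weight (1 + p + gamma0)) (T t f) <= C / t * expR (c * t) * wnorm (weight (1 + p)) f].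
Proof.
move=> p0; have q0 : 0 < p + gamma0 by rewrite addr_gt0.
have [C C0 hC] := generator_smoothing p0.
exists (2 `^ (1 + (p + gamma0)) * 2 `^ (p + gamma0) * C), (2 * rate p + 2 * rate (p + gamma0) + 1); split.
- by rewrite mulr_gt0// mulr_gt0// powR_gt0.
- by rewrite ltr_wpDl// addr_ge0// mulr_ge0// rate_ge0.
move=> f t t0 Lf; rewrite -addrA.
rewrite [X in _ <= X](_ : _ = 2 `^ (1 + (p + gamma0)) * 2 `^ (p + gamma0) *
  (C / t * expR ((2 * rate p + 2 * rate (p + gamma0) + 1) * t)) *
  wnorm (weight (1 + p)) f); last by ring.
apply: weight_bound => //; first by rewrite mulr_ge0 ?expR_ge0// divr_ge0// ltW.
by move=> M {}f g M0 gen {}Lf; exact: (hC M t f g).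
Qed.

End GrowthFragmentation.

(** * Iteration and interpolation *)

Section Iteration.
Context {R : realType} (T : R -> (R -> R) -> R -> R) (gamma0 : R).
Local Notation mu := (@lebesgue_measure R).
Implicit Types (f : R -> R) (a b t x y : R).
Let mH := @measurable_halfline R.
Hypothesis gamma0_gt0 : 0 < gamma0.
Hypothesis T_weight : forall a : R, 1 < a -> C0_semigroup (weight a) T.
Hypothesis T_growth : forall a : R, 1 < a -> exists C c : R, [/\ 0 < C, 0 < c &
  forall f t, 0 < t -> L1 (weight a) f -> L1 (weight a) (T t f) /\
    wnorm (weight a) (T t f) <= C * expR (c * t) * wnorm (weight a) f].
Hypothesis T_smoothing : forall a : R, 1 < a -> exists C c : R, [/\ 0 < C, 0 < c &
  forall f t, 0 < t -> L1 (weight a) f -> L1 (weight (a + gamma0)) (T t f) /\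
    wnorm (weight (a + gamma0)) (T t f) <= C / t * expR (c * t) * wnorm (weight a) f].

Let mw a : measurable_fun halfline (weight a). Proof. exact: measurable_weight. Qed.
Let w0 a x : 0 < x -> 0 < weight a x. Proof. exact: weight_gt0. Qed.
Let w0W a x : 0 < x -> 0 <= weight a x. Proof. by move=> /(w0 a)/ltW. Qed.
Let w1 a x : 0 < x -> weight a x <= 1 * weight a x. Proof. by rewrite mul1r. Qed.

(** Equality almost everywhere on the half-line does not transfer Borel measurability; that of [g]
    is supplied by its integrability against another weight. *)
Lemma L1_weight_ae a b f g : L1 (weight b) f -> L1 (weight a) g -> eq_ae f g -> L1 (weight b) g.
Proof.
move=> Lf Lg fg; have mf := L1_measurable (mw b) (@w0 b) Lf.
have mg := L1_measurable (mw a) (@w0 a) Lg.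
apply: (integrable_ae_eq (f := fun x => f x * weight b x)) => //.
- exact: measurable_funM.
- exact: measurable_funM.
- by apply: aeS fg => x E Hx; rewrite (E Hx).
Qed.

(** Constants of one iteration: the powers of $2/t$ from the two halves contribute $2$ and $2^k$,
    and the exponentials at $t/2$ are bounded by the one at $t$. *)
Lemma halving_bound (C C' c c' t F : R) (k : nat) :
  0 < C -> 0 < C' -> 0 < c -> 0 < c' -> 0 < t -> 0 <= F ->
  C' / (t / 2) * expR (c' * (t / 2)) * (C * (t / 2)^-1 ^+ k * expR (c * (t / 2)) * F) <=
  C' * 2 * C * 2 ^+ k * t^-1 ^+ k.+1 * expR ((c' + c) * t) * F.
Proof.
move=> C0 C'0 c0 c'0 t0 F0; rewrite invf_div.
have -> : C' * (2 / t) * expR (c' * (t / 2)) * (C * (2 / t) ^+ k * expR (c * (t / 2)) * F) =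
   (C' * 2 * C * 2 ^+ k * t^-1 ^+ k.+1) * (expR (c' * (t / 2)) * expR (c * (t / 2)) * F).
  by rewrite exprMn exprS; ring.
rewrite -[leRHS]mulrA ler_wpM2l//.
  by rewrite mulr_ge0 ?exprn_ge0 ?invr_ge0 ?(ltW t0)// mulr_ge0 ?exprn_ge0// !mulr_ge0// ltW.
by rewrite ler_wpM2r// -expRD ler_expR; have := mulr_gt0 c0 t0; have := mulr_gt0 c'0 t0; lra.
Qed.

(** $T_t=T_{t/2}T_{t/2}$: the induction hypothesis acts on the first half of the time, one more gain
    of $\gamma_0$ on the second. *)
Lemma iterated_smoothing (k : nat) a : 1 < a -> exists C c : R, [/\ 0 < C, 0 < c &
  forall f t, 0 < t -> L1 (weight a) f -> L1 (weight (a + k%:R * gamma0)) (T t f) /\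
    wnorm (weight (a + k%:R * gamma0)) (T t f) <=
      C * t^-1 ^+ k * expR (c * t) * wnorm (weight a) f].
Proof.
move=> a1; elim: k => [|k [C [c [C0 c0 IH]]]].
  have [C [c [C0 c0 h]]] := T_growth a1; exists C, c; split => // f t t0 Lf.
  by rewrite mul0r addr0 expr0 mulr1; exact: h.
set b := a + k%:R * gamma0 in IH.
have b1 : 1 < b by rewrite (lt_le_trans a1)// lerDl mulr_ge0// ltW.
have [C' [c' [C'0 c'0 h]]] := T_smoothing b1.
exists (C' * 2 * C * 2 ^+ k), (c' + c); split; [|exact: addr_gt0|].
  by rewrite mulr_gt0 ?exprn_gt0// !mulr_gt0.
move=> f t t0 Lf; have t20 : 0 < t / 2 by rewrite divr_gt0.
have [L1' N1] := IH f _ t20 Lf.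
have [L2 N2] := h _ _ t20 L1'.
have bE : a + k.+1%:R * gamma0 = b + gamma0 by rewrite /b -natr1 mulrDl mul1r addrA.
rewrite bE; have e : eq_ae (T (t / 2) (T (t / 2) f)) (T t f).
  have := semigroup_D (T_weight a1) (ltW t20) (ltW t20) Lf; rewrite -splitr.
  by apply: aeS => x E Hx; rewrite (E Hx).
have LTa : L1 (weight a) (T t f).
  by have [hb _ _] := semigroup_bounded (T_weight a1) (ltW t0); exact: hb.
have L3 := L1_weight_ae L2 LTa e; split; first exact: L3.
have F0 : 0 <= wnorm (weight a) f by apply: wnorm_ge0; exact: w0W.
have E := wnorm_ae (mw _) (@w0 _) (mw _) L2 L3 e; rewrite -E; apply: (le_trans N2).
have P0 : 0 <= C' / (t / 2) * expR (c' * (t / 2)).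
  by apply: mulr_ge0 (expR_ge0 _); apply: divr_ge0; exact: ltW.
apply: (le_trans (ler_wpM2l P0 N1)); exact: halving_bound.
Qed.

(* [y `^ theta <= 1 + y] with [y = s * (1 + x) `^ d] and [theta = (b - a) / d] *)
Lemma weight_interpolation a b (d s x : R) : a < b -> b <= a + d -> 0 < s -> 0 < x ->
  weight b x <= s `^ (- ((b - a) / d)) * (weight a x + s * weight (a + d) x).
Proof.
move=> ab bd s0 x0; have d0 : 0 < d by lra.
have x10 : 0 < 1 + x by rewrite ltr_wpDl.
set th := (b - a) / d; set y := s * (1 + x) `^ d.
have th0 : 0 < th by rewrite divr_gt0// subr_gt0.
have th1 : th <= 1 by rewrite ler_pdivrMr// mul1r; lra.
have y0 : 0 < y by rewrite mulr_gt0// powR_gt0.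
have yth : y `^ th <= 1 + y.
  have [y1|y1] := leP y 1.
    rewrite (@le_trans _ _ 1)// ?lerDl ?(ltW y0)//.
    have := @ge0_ler_powR R th (ltW th0) y 1; rewrite !nnegrE powR1; apply => //; exact: ltW.
  rewrite (@le_trans _ _ (y `^ 1))//; first by rewrite ler_powR// ltW.
  by rewrite powRr1 ?(ltW y0)// lerDr.
have yE : y `^ th = s `^ th * (1 + x) `^ (b - a).
  by rewrite powRM ?powR_ge0 ?(ltW s0)// -powRrM /th mulrCA divff ?mulr1// gt_eqF.
have wE : weight b x = s `^ (- th) * (y `^ th * weight a x).
  rewrite yE !mulrA -powRD; last by rewrite (gt_eqF s0) implybT.
  rewrite addNr powRr0 mul1r /weight -powRD ?subrK//.
  by rewrite (gt_eqF x10) implybT.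
rewrite wE ler_wpM2l ?powR_ge0// (le_trans (ler_wpM2r (w0W _ x0) yth))//.
rewrite mulrDl mul1r lerD2l /y -mulrA ler_wpM2l ?(ltW s0)// /weight -powRD; last first.
  by rewrite (gt_eqF x10) implybT.
by rewrite [d + a]addrC.
Qed.

(** The number $k$ of iterations is such that $k\gamma_0$ exceeds $b-a$. With $s=t^k$ both terms of
    [weight_interpolation] are at most a constant times an exponential, and
    $s^{-(b-a)/(k\gamma_0)}=t^{-(b-a)/\gamma_0}$. *)
Lemma interpolated_smoothing a b : 1 < a -> a < b -> exists C c : R, [/\ 0 < C, 0 < c &
  forall f t, 0 < t -> L1 (weight a) f -> L1 (weight b) (T t f) /\
    wnorm (weight b) (T t f) <= C * t `^ (- ((b - a) / gamma0)) * expR (c * t) * wnorm (weight a) f].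
Proof.
move=> a1 ab; pose k := (Num.truncn ((b - a) / gamma0)).+1.
have k0 : 0 < k%:R :> R by rewrite ltr0n.
pose d := k%:R * gamma0.
have d0 : 0 < d by rewrite mulr_gt0.
have bd : b <= a + d.
  by rewrite -lerBlDl /d -ler_pdivrMr// ltW// truncnS_gt.
have [C1 [c1 [C10 c10 h1]]] := T_growth a1.
have [C2 [c2 [C20 c20 h2]]] := iterated_smoothing k a1.
exists (C1 + C2), (c1 + c2); split; [exact: addr_gt0|exact: addr_gt0|].
move=> f t t0 Lf; have t0W := ltW t0.
have [La Na] := h1 f t t0 Lf; have [Ld Nd] := h2 f t t0 Lf.
rewrite -/d in Ld Nd.
have mT := L1_measurable (mw a) (@w0 a) La.
pose s := t ^+ k; have s0 : 0 < s by exact: exprn_gt0.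
set F := wnorm (weight a) f in Na Nd *.
have F0 : 0 <= F by apply: wnorm_ge0; exact: w0W.
pose z := s `^ (- ((b - a) / d)).
have z0 : 0 <= z by exact: powR_ge0.
have zE : z = t `^ (- ((b - a) / gamma0)).
  rewrite /z /s -powR_mulrn// -powRrM; congr (_ `^ _).
  by rewrite /d mulrN; congr (- _); field; rewrite !gt_eqF.
have pw x : 0 < x -> `|T t f x| * weight b x <=
    z * (`|T t f x| * weight a x + s * (`|T t f x| * weight (a + d) x)).
  move=> x0; have := ler_wpM2l (normr_ge0 (T t f x)) (weight_interpolation ab bd s0 x0).
  move/le_trans; apply; apply: eq_ler; rewrite -/z; ring.
have Ia := wnorm_integrable (mw a) (@w0 a) (mw a) (@w0W a) (@w1 a) La.
have Id := wnorm_integrable (mw (a + d)) (@w0 (a + d)) (mw (a + d)) (@w0W (a + d)) (@w1 (a + d)) Ld.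
have Isum : mu.-integrable halfline (EFin \o (fun x =>
    z * (`|T t f x| * weight a x + s * (`|T t f x| * weight (a + d) x)))).
  apply: integrable_scalefun => //; apply: integrable_addfun => //.
  exact: integrable_scalefun.
have Lb : L1 (weight b) (T t f).
  apply: (@le_integrable_real _ _ _ mu _ _ _ _ _ _ Isum) => //; first exact: measurable_funM mT (mw b).
  by move=> x; rewrite halflineE => x0; rewrite normrM (ger0_norm (w0W b x0)); exact: pw.
split=> //.
have Ib := wnorm_integrable (mw b) (@w0 b) (mw b) (@w0W b) (@w1 b) Lb.
have Nb : wnorm (weight b) (T t f) <=
    z * (wnorm (weight a) (T t f) + s * wnorm (weight (a + d)) (T t f)).
  rewrite /wnorm -[s * _]RintegralZl// -RintegralD//; last exact: integrable_scalefun.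
  rewrite -RintegralZl//; last by apply: integrable_addfun => //; exact: integrable_scalefun.
  by apply: le_Rintegral => // x; rewrite halflineE; exact: pw.
apply: (le_trans Nb); rewrite -zE -!mulrA mulrCA ler_wpM2l//.
have e1 : expR (c1 * t) <= expR ((c1 + c2) * t).
  by rewrite ler_expR ler_wpM2r// lerDl ltW.
have e2 : expR (c2 * t) <= expR ((c1 + c2) * t).
  by rewrite ler_expR ler_wpM2r// lerDr ltW.
rewrite mulrDl; apply: lerD.
  rewrite (le_trans Na)// -mulrA ler_wpM2l ?(ltW C10)// ler_wpM2r//.
rewrite (le_trans (ler_wpM2l (ltW s0) Nd))//.
rewrite (_ : s * _ = (s * t^-1 ^+ k) * (C2 * (expR (c2 * t) * F))); last by ring.
rewrite /s -exprMn divff ?gt_eqF// expr1n mul1r ler_wpM2l ?(ltW C20)// ler_wpM2r//.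
Qed.

(** $C=n!$ with $n\ge r$: for $t\le1$ the left-hand side is at most 1, for $t>1$ it is at most
    $t^n\le n!\,\mathrm e^t$. *)
Lemma powR_le_expR (r : R) : 0 < r -> exists2 C : R, 1 <= C & forall t, 0 < t -> t `^ r <= C * expR t.
Proof.
move=> r0; pose n := (Num.truncn r).+1.
have rn : r <= n%:R by rewrite ltW// truncnS_gt.
exists n`!%:R; first by rewrite ler1n fact_gt0.
move=> t t0; have t0W := ltW t0.
have f1 : 1 <= n`!%:R :> R by rewrite ler1n fact_gt0.
have et : 1 <= expR t by rewrite -[leLHS]expR0 ler_expR.
have [t1|t1] := leP t 1.
  apply: (@le_trans _ _ (1 * 1)); last by apply: ler_pM.
  rewrite mul1r; have := @ge0_ler_powR R r (ltW r0) t 1; rewrite !nnegrE powR1; apply => //.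
rewrite (@le_trans _ _ (t ^+ n))//; last exact: exprn_le_fact_expR.
by rewrite -powR_mulrn// ler_powR// ltW.
Qed.

(** $t^{-(b-a)/\gamma_0}=t^{-(b-d)/\gamma_0}\,t^{(a-d)/\gamma_0}$, and the last factor is at most
    $K\mathrm e^t$. Only [K] depends on [d]: the rate $c+1$ is fixed beforehand. *)
Lemma delayed_smoothing a b : 1 < a -> a < b -> exists2 c : R, 0 < c & forall d, d < a ->
  exists2 C : R, 0 < C & forall f t, L1 (weight a) f -> 0 < t -> L1 (weight b) (T t f) /\
    wnorm (weight b) (T t f) <= C * t `^ (- ((b - d) / gamma0)) * expR (c * t) * wnorm (weight a) f.
Proof.
move=> a1 ab; have [C [c [C0 c0 h]]] := interpolated_smoothing a1 ab.
exists (c + 1); first exact: addr_gt0.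
move=> d da; have r0 : 0 < (a - d) / gamma0 by rewrite divr_gt0// subr_gt0.
have [K K1 hK] := powR_le_expR r0.
exists (C * K); first by rewrite mulr_gt0// (lt_le_trans ltr01).
move=> f t Lf t0; have [Lb Nb] := h f t t0 Lf; split=> //.
apply: (le_trans Nb); have F0 : 0 <= wnorm (weight a) f by apply: wnorm_ge0; exact: w0W.
rewrite ler_wpM2r//.
have -> : - ((b - a) / gamma0) = - ((b - d) / gamma0) + (a - d) / gamma0 by ring.
rewrite powRD; last by rewrite (gt_eqF t0) implybT.
have -> : (c + 1) * t = c * t + t by ring.
rewrite expRD; have := hK t t0.
have P0 : 0 <= C * t `^ (- ((b - d) / gamma0)) * expR (c * t).
  by rewrite mulr_ge0 ?expR_ge0// mulr_ge0 ?powR_ge0// ltW.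
move=> /(ler_wpM2l P0) hP.
by rewrite [leLHS](_ : _ = C * t `^ (- ((b - d) / gamma0)) * expR (c * t) * t `^ ((a - d) / gamma0));
  [rewrite (le_trans hP)//; apply: eq_ler; ring|ring].
Qed.

End Iteration.

Theorem lemma2p7 (R : realType) (tau B : R -> R) (gamma0 : R)
    (wp : {finite_measure set (measurableTypeR R) -> \bar R})
    (lambda : R) (G phi : R -> R) (T : R -> (R -> R) -> R -> R)
    (htau : growth_rate tau)
    (hB : fragmentation_rate B gamma0)
    (hwp : fragmentation_measure wp)
    (hperron : perron_elements tau B wp lambda G phi)
    (hT : growth_fragmentation_semigroup tau B wp lambda phi T) :
  (forall t alpha beta : R, 0 < t -> 1 < alpha -> alpha < beta ->
     bounded_linear (weight alpha) (weight beta) (T t)) /\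
  (forall alpha beta : R, 1 < alpha -> alpha < beta ->
     exists2 a : R, 0 < a &
       forall delta : R, delta < alpha ->
         exists2 C : R, 0 < C &
           forall (f : R -> R) (t : R), L1 (weight alpha) f -> 0 < t ->
             (L1norm (weight beta) (T t f) <=
              (C * t `^ (- ((beta - delta) / gamma0)) * expR (a * t))%:E
                * L1norm (weight alpha) f)%E).
Proof.
have [tau_gt0 tau_C1 _ [nu0 [tau0 [tau1 [_ tau00 tau01 tau_bounds]]]]] := htau.
have [B_ge0 B_cont _ [gamma1 [B0 [B1 [x0 [/andP[g0 _] /andP[B00 _] x00 B_bounds]]]]]] := hB.
have [_ wp1] := hwp.
have [Cphi Cphi0 phi_bounds] := perron_phi_bounds hperron.
have tau1_ge0 : 0 <= tau1 by rewrite (le_trans _ tau01)// ltW.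
have tau_le x : 0 < x -> tau x <= tau1 * Num.max 1 x by move=> /tau_bounds/andP[].
have B_ge x : x0 <= x -> B0 * x `^ gamma0 <= B x.
  move=> xx0; have /andP[+ _] := B_bounds x (lt_le_trans x00 xx0).
  by rewrite indicE mem_set ?mulr1//= in_itv/= xx0.
have w0 (a x : R) : 0 < x -> 0 <= weight a x by move=> x0'; rewrite ltW// weight_gt0.
have shift (a : R) : 1 < a -> exists2 p : R, 0 < p & a = 1 + p.
  by move=> a1; exists (a - 1); rewrite ?subr_gt0// addrCA subrr addr0.
have growth a : 1 < a -> exists C c : R, [/\ 0 < C, 0 < c &
    forall f t, 0 < t -> L1 (weight a) f -> L1 (weight a) (T t f) /\
    wnorm (weight a) (T t f) <= C * expR (c * t) * wnorm (weight a) f].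
  move=> /shift[p p0 ->].
  exact: (weight_growth tau_gt0 tau_C1 tau1_ge0 tau_le B_ge0 B_cont B00 g0 B_ge wp1
    (ltW (perron_lambda_gt0 hperron)) (perron_phi_C1 hperron) (perron_phi_eq hperron)
    Cphi0 phi_bounds (gf_semigroup hT) (gf_norm hT) (gf_generator hT)).
have smoothing a : 1 < a -> exists C c : R, [/\ 0 < C, 0 < c &
    forall f t, 0 < t -> L1 (weight a) f -> L1 (weight (a + gamma0)) (T t f) /\
    wnorm (weight (a + gamma0)) (T t f) <= C / t * expR (c * t) * wnorm (weight a) f].
  move=> /shift[p p0 ->].
  exact: (weight_smoothing tau_gt0 tau_C1 tau1_ge0 tau_le B_ge0 B_cont B00 x00 g0 B_ge wp1
    (ltW (perron_lambda_gt0 hperron)) (perron_phi_C1 hperron) (perron_phi_eq hperron)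
    Cphi0 phi_bounds (gf_semigroup hT) (gf_norm hT) (gf_generator hT)).
have main := delayed_smoothing g0 (gf_weight hT) growth smoothing.
split; last first.
  move=> alpha beta a1 ab; have [a a0 ha] := main _ _ a1 ab.
  exists a => // delta da; have [C C0 hC] := ha _ da; exists C => // f t Lf t0.
  have [Lb Nb] := hC f t Lf t0.
  by rewrite (L1normE (w0 beta) Lb) (L1normE (w0 alpha) Lf) -EFinM lee_fin.
move=> t alpha beta t0 a1 ab; have [a a0 ha] := main _ _ a1 ab.
(* For boundedness at a given time any $\delta<\alpha$ will do; $\alpha-1$ is an arbitrary
   choice. *)
have [|C C0 hC] := ha (alpha - 1); first by rewrite gtrBl.
split.
- by move=> f Lf; have [] := hC f t Lf t0.
(* Linearity up to null sets is inherited from the semigroup on $L^1_\alpha$. *)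
- by have [_ + _] := semigroup_bounded (gf_weight hT a1) (ltW t0).
- exists (C * t `^ (- ((beta - (alpha - 1)) / gamma0)) * expR (a * t)) => f Lf.
  have [Lb Nb] := hC f t Lf t0.
  by rewrite (L1normE (w0 beta) Lb) (L1normE (w0 alpha) Lf) -EFinM lee_fin.
Qed.
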